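(* Let $\nu<1$ and $0<\sigma<-\nu+1$. Let $A,B\in\mathbb{R}$ and assume that $1\le p,q\le\infty$. (i) $L^p(x^{Ap}d\eta_{\nu})$ is contained in the domain of $\widetilde{I}^{\nu,\sigma}$ if and only if $$2\sigma-\frac{2\nu+2}{p}+2\nu<A<\frac{2\nu+2}{p'}-2\nu\qquad(\text{both }\le\text{ when }p=1).$$ (ii) The operator $\widetilde{I}^{\nu,\sigma}$ is bounded from $L^p(x^{Ap}d\eta_{\nu})$ to $L^q(x^{-Bq}d\eta_{\nu})$ if and only if the following conditions are satisfied: (a) $p\le q$, (b) $A+B-2\sigma=(2\nu+2)\big(\frac1q-\frac1p\big)$, (c) $A<\frac{2\nu+2}{p'}-2\nu$ ($\le$ when $p=q'=1$), (d) $B<\frac{2\nu+2}{q}-2\nu$ ($\le$ when $p=q'=1$), (e) $\frac1q-\frac1p\ge-2\sigma$ ($>$ when $p=1$ or $q=\infty$).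
   Context: Notation: $\mathbb{R}_+=(0,\infty)$, $d\eta_{\nu}(x)=x^{2\nu+1}dx$ on $\mathbb{R}_+$, and $p'$ denotes the conjugate exponent, $1/p+1/p'=1$. For $\mu>-1$ let $I_{\mu}$ be the modified Bessel function of the first kind of order $\mu$ and $$W_t^{\mu}(x,y)=\frac{1}{2t}(xy)^{-\mu}e^{-(x^2+y^2)/4t}I_{\mu}\Big(\frac{xy}{2t}\Big),\qquad t,x,y>0.$$ For $\nu<1$ let $\widetilde{W}_t^{\nu}(x,y)=(xy)^{-2\nu}W_t^{-\nu}(x,y)$ (exotic Bessel heat kernel). The exotic fractional integral of order $\sigma>0$ is $$\widetilde{I}^{\nu,\sigma}f(x)=\int_0^{\infty}\widetilde{K}^{\nu,\sigma}(x,y)f(y)\,d\eta_{\nu}(y),\qquad \widetilde{K}^{\nu,\sigma}(x,y)=\frac{1}{\Gamma(\sigma)}\int_0^{\infty}\widetilde{W}_t^{\nu}(x,y)t^{\sigma-1}\,dt,\qquad x,y>0.$$ Its (natural) domain consists of all $f$ for which the defining integral converges for a.e. $x$. For $A\in\mathbb{R}$ and $1\le p\le\infty$, $f\in L^p(x^{Ap}d\eta_{\nu})$ if and only if $x^Af\in L^p(\mathbb{R}_+,d\eta_{\nu})$, with norm $\|x^Af\|_{L^p(d\eta_{\nu})}$; by convention, for $p=\infty$ this means that $x^Af$ is essentially bounded on $\mathbb{R}_+$, with norm $\|x^Af\|_{\infty}$. Similarly, the norm in $L^q(x^{-Bq}d\eta_{\nu})$ is $\|x^{-B}f\|_{L^q(d\eta_{\nu})}$.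 *)

(* Defs.v *)
From HB Require Import structures.
From mathcomp Require Import all_boot all_order all_algebra.
From mathcomp Require Import all_classical all_reals all_analysis.
From mathcomp Require Import measurable_realfun.
Set Implicit Arguments.
Unset Strict Implicit.
Unset Printing Implicit Defensive.
Import Order.TTheory GRing.Theory Num.Theory.
Import numFieldNormedType.Exports.
Local Open Scope classical_set_scope.
Local Open Scope ring_scope.

(* The ambient space (0, +oo) is handled inside R: the measure [eta nu] below
   is carried by (0, +oo), so the values of functions at x <= 0 play no role
   (apart from measurability). *)
Definition Rpos {R : realType} : set R := `]0, +oo[.

Definition eta {R : realType} (nu : R) (A : set (measurableTypeR R)) : \bar R :=
  (\int[lebesgue_measure]_(x in A `&` Rpos) (x `^ (2 * nu + 1))%:E)%E.

Section eta_measure.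
Context {R : realType} (nu : R).
Local Open Scope ereal_scope.

Let mRpos : measurable (Rpos : set (measurableTypeR R)).
Proof. exact: measurable_itv. Qed.

Let eta0 : eta nu set0 = 0.
Proof. by rewrite /eta set0I integral_set0. Qed.

Let eta_ge0 A : 0 <= eta nu A.
Proof. by apply: integral_ge0 => x _; rewrite lee_fin powR_ge0. Qed.

Let eta_sigma_additive : semi_sigma_additive (eta nu).
Proof.
move=> F mF tF mU; rewrite /eta setI_bigcupl.
apply: (@semi_sigma_additive_nng_induced _ _ R lebesgue_measure
  (fun x => (x `^ (2 * nu + 1))%:E)).
- by apply/measurable_EFinP; exact: measurable_powR.
- by move=> x; rewrite lee_fin powR_ge0.
- by move=> i; exact: measurableI.
- apply/trivIsetP => i j _ _ ij.
  by move/trivIsetP : tF => /(_ i j Logic.I Logic.I ij); rewrite setIACA => ->;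
    rewrite set0I.
- by apply: bigcup_measurable => i _; exact: measurableI.
Qed.

HB.instance Definition _ := isMeasure.Build _ _ _ (eta nu)
  eta0 eta_ge0 eta_sigma_additive.

End eta_measure.

Section exotic_potential.
Context {R : realType}.
Implicit Types (nu mu sigma s t x y z A B : R) (p q : \bar R) (f : R -> R).

Definition Gamma s : R :=
  \int[lebesgue_measure]_(t in Rpos) (t `^ (s - 1) * expR (- t)).

(* for z > 0 and mu > -1 *)
Definition besselI mu z : R :=
  limn (series (fun k : nat =>
    (z / 2) `^ (2 * k%:R + mu) / (k`!%:R * Gamma (k%:R + mu + 1)))).

Definition bessel_heat mu t x y : R :=
  (2 * t)^-1 * (x * y) `^ (- mu) * expR (- (x ^+ 2 + y ^+ 2) / (4 * t))
  * besselI mu (x * y / (2 * t)).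

Definition exotic_heat nu t x y : R :=
  (x * y) `^ (- (2 * nu)) * bessel_heat (- nu) t x y.

(* Extended-real-valued: the kernel is +oo on the diagonal when
   sigma <= 1/2. *)
Definition exotic_kernel nu sigma x y : \bar R :=
  ((Gamma sigma)^-1%:E *
   \int[lebesgue_measure]_(t in Rpos)
     (exotic_heat nu t x y * t `^ (sigma - 1))%:E)%E.

Definition exotic_domain nu sigma : set (R -> R) :=
  [set f | {ae eta nu, forall x, (eta nu).-integrable Rpos
    (fun y => exotic_kernel nu sigma x y * (f y)%:E)%E}].

(* Set to 0 outside (0, +oo); for f in the domain, [fine] changes nothing at
   almost every x. *)
Definition exotic_integral nu sigma f : R -> R :=
  (fun x => fine (\int[eta nu]_(y in Rpos)
    (exotic_kernel nu sigma x y * (f y)%:E))%E) \_ Rpos.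

Definition pow_weight A f : R -> R := fun x => x `^ A * f x.

(* L^p(x^(A p) d eta_nu), with its sup-norm convention for p = +oo *)
Definition wLp nu A p : set (R -> R) :=
  [set f | pow_weight A f \in Lfun (eta nu) p].

Definition wnorm nu A p f : \bar R :=
  'N[eta nu]_p[EFin \o pow_weight A f].

Definition exotic_bounded nu sigma A p B q : Prop :=
  wLp nu A p `<=` exotic_domain nu sigma /\
  exists C : R, forall f, wLp nu A p f ->
    wLp nu (- B) q (exotic_integral nu sigma f) /\
    (wnorm nu (- B) q (exotic_integral nu sigma f) <= C%:E * wnorm nu A p f)%E.

(* 1/p as a real number, with 1/(+oo) = 0 *)
Definition rinv p : R := fine (p^-1)%E.

End exotic_potential.

(* Main.v *)
(* Put x = e^u, y = e^v and s = 1 - nu - sigma. Integrating the Bessel series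
   term by term in t turns the potential kernel into an elementary factor times
   k(u - v), where k(w) is cosh(w)^(-s) times a power series in cosh(w)^(-2) whose
   n-th coefficient has order n^(-sigma - 1/2). Hence k decays exactly like
   e^(-s|w|) at infinity, while near 0 it behaves like |w|^(2 sigma - 1) when
   sigma < 1/2, is unbounded but weaker than any power when sigma = 1/2, and is
   bounded when sigma > 1/2. Absorbing the weights and the density of eta_nu, the
   operator becomes the convolution on the line with e^(c w) k(w), where
   c = A + (2 nu + 2)/p - sigma - 1 - nu, followed by multiplication by e^(d u).
   Condition (b) says d = 0; the bounds on A in (i), respectively (c) and (d) in
   (ii), say that |c| < s (or <=), i.e. that e^(c w) k(w) decays.
   Sufficiency is Schur's test for p = q, Jensen or Hoelder for p = 1 or
   q = +oo, and the Hardy-Littlewood-Sobolev inequality otherwise. Necessity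
   comes from test functions: unit intervals moved to infinity for (b), long
   intervals for (a), short ones for (e), and functions at the edge of
   integrability for the bounds on c and for the endpoint cases of (e). *)

From HB Require Import structures.
Require Import Defs.
From mathcomp Require Import all_boot all_order all_algebra.
From mathcomp Require Import all_classical all_reals all_analysis.
From mathcomp Require Import measurable_realfun ess_sup_inf.
From mathcomp Require Import ring lra.
Set Implicit Arguments.
Unset Strict Implicit.
Unset Printing Implicit Defensive.
Import Order.TTheory GRing.Theory Num.Theory.
Import numFieldNormedType.Exports.
Local Open Scope classical_set_scope.
Local Open Scope ring_scope.

(** * Exponential change of variables *)

(** The operator is real-valued through [fine], while its kernel is infinite on the diagonal when
    sigma <= 1/2. The reduction therefore goes to nonnegative functions and extended-valued
    convolutions, where Tonelli needs no finiteness: |T f| <= T |f| gives one direction, nonnegative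
    test functions the other. Kernels are compared only for w <> 0, at the cost of a null set. Near
    0 the kernel is bounded by a multiple of 1 + |w|^(-lam) with a free [lam >= 1 - 2 sigma]. A
    positive [lam] hides the logarithm at sigma = 1/2, and the strict inequality in (e) leaves room
    for it. Hardy-Littlewood-Sobolev dictates its own [lam], which is 1 - 2 sigma at equality in
    (e); only the bounded kernel from L^1 to L^oo takes [lam = 0]. The order of the coefficients is
    obtained without Stirling's formula, by comparing quotients of consecutive coefficients with
    quotients of shifted powers. Tests along a scale give e^(t x) <= M e^(t y) for all t >= 1, and
    hence an inequality of exponents. *)

Section density.
Local Open Scope ereal_scope.
Context d (T : measurableType d) (R : realType).
Import HBNNSimple.

(** Monotone convergence along simple functions reduces this to indicators. The density is assumed
    on subsets of [D] only, because the power weight is the density of [eta nu] on (0, +oo)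
    alone. *)
Lemma ge0_integral_density (mu mw : {measure set T -> \bar R})
    (D : set T) (w : T -> R) (f : T -> \bar R) :
  measurable D -> measurable_fun D w -> (forall x, (0 <= w x)%R) ->
  (forall A, measurable A -> A `<=` D -> mw A = \int[mu]_(x in A) (w x)%:E) ->
  measurable_fun D f -> (forall x, D x -> 0 <= f x) ->
  \int[mw]_(x in D) f x = \int[mu]_(x in D) (f x * (w x)%:E).
Proof.
move=> mD mw_ w0 mwE mf f0.
pose h := nnsfun_approx mD mf.
have mwE' : measurable_fun D (EFin \o w) by exact/measurable_EFinP.
transitivity (limn (fun n => \int[mw]_(x in D) (h n x)%:E)).
  rewrite -monotone_convergence//.
  - apply: eq_integral => y /[!inE] yD; apply/esym/cvg_lim => //.
    exact: cvg_nnsfun_approx.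
  - by move=> n; exact/measurable_EFinP/measurable_funTS.
  - by move=> n y _; rewrite lee_fin.
  - by move=> y _ m n mn; rewrite lee_fin; exact/lefP/nd_nnsfun_approx.
have -> : \int[mu]_(x in D) (f x * (w x)%:E) =
    limn (fun n => \int[mu]_(x in D) ((h n x)%:E * (w x)%:E)).
  rewrite -monotone_convergence//.
  - apply: eq_integral => y /[!inE] yD; apply/esym/cvg_lim => //.
    by apply: cvgeZr => //; exact: cvg_nnsfun_approx.
  - move=> n; apply: emeasurable_funM => //.
    exact/measurable_EFinP/measurable_funTS.
  - by move=> n y Dy; rewrite mule_ge0// ?lee_fin// w0.
  - move=> y Dy m n mn; rewrite lee_wpmul2r ?lee_fin//.
    exact/lefP/nd_nnsfun_approx.
congr (limn _); apply/funext => n.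
transitivity (\int[mw]_(x in D)
   (\sum_(y \in range (h n)) (y * \1_(h n @^-1` [set y]) x)%:E)).
  by apply: eq_integral => t tE; rewrite /= fimfunE -fsumEFin.
rewrite ge0_integral_fsum//; last 2 first.
- move=> r; apply/measurable_EFinP.
  by apply/measurable_funTS/measurable_funM.
- by move=> m y Ey; exact: nnfun_muleindic_ge0.
transitivity (\int[mu]_(x in D) (\sum_(y \in range (h n))
    (y * \1_(h n @^-1` [set y]) x)%:E * (w x)%:E)); last first.
  under [RHS]eq_integral => x xE.
    rewrite fimfunE -fsumEFin// ge0_mule_fsuml => [|y]; last exact: nnfun_muleindic_ge0.
    over.
  by [].
rewrite ge0_integral_fsum//; last 2 first.
- move=> y; apply: emeasurable_funM => //; apply/measurable_EFinP.
  by apply/measurable_funTS/measurable_funM.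
- by move=> m y Ey; rewrite mule_ge0 ?lee_fin// -lee_fin; exact: nnfun_muleindic_ge0.
apply: eq_fsbigr => r rhn.
under [LHS]eq_integral do rewrite EFinM.
rewrite integralZl_indic_nnsfun => //.
under [RHS]eq_integral do rewrite EFinM -muleA.
rewrite ge0_integralZl//.
- congr (_ * _); rewrite [RHS](eq_integral ((EFin \o w) \_ (h n @^-1` [set r]))); last first.
    by move=> x xE; rewrite epatch_indic muleC.
  rewrite -integral_mkcondr -mwE; [|exact: measurableI|exact: subIsetl].
  by rewrite integral_indic// setIC.
- apply: emeasurable_funM => //; apply/measurable_EFinP; exact/measurable_funTS.
- by move=> x Dx; rewrite mule_ge0 ?lee_fin.
- by move: rhn; rewrite inE => -[t _ <-]; rewrite lee_fin.
Qed.
End density.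

Section log_substitution.
Context {R : realType}.
Local Open Scope ereal_scope.
Local Notation mu := (@lebesgue_measure R).

Lemma integral_ocitv_FTC (f F : R -> R) (a b : R) : (a < b)%R ->
  {in `[a, b], continuous f} ->
  (forall x, x \in `[a, b] -> is_derive x (1:R)%R F (f x)) ->
  \int[mu]_(x in `]a, b]) (f x)%:E = (F b - F a)%:E.
Proof.
move=> ab cf dF.
have cfw : {within `[a, b], continuous f} by apply: continuous_in_subspaceT => x; rewrite inE => /cf.
have mcc : measurable_fun `[a, b] f.
  by apply: subspace_continuous_measurable_fun.
rewrite integral_itv_obnd_cbnd//; last first.
  apply/measurable_EFinP; apply: measurable_funS mcc => //.
  by move=> x /=; rewrite !in_itv/= => /andP[/ltW -> ->].
rewrite (continuous_FTC2 ab cfw (F := F)) ?EFinB//.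
- split.
  + by move=> x xab; have := dF _ (subset_itv_oo_cc xab).
  + apply/cvg_at_right_filter/differentiable_continuous/derivable1_diffP.
    have aab : a \in `[a, b] by rewrite in_itv/= lexx ltW.
    by have := dF _ aab.
  + apply/cvg_at_left_filter/differentiable_continuous/derivable1_diffP.
    have bab : b \in `[a, b] by rewrite in_itv/= lexx ltW.
    by have := dF _ bab.
- move=> x xab; rewrite derive1E.
  by have := dF _ (subset_itv_oo_cc xab) => ?; rewrite derive_val.
Qed.

Lemma ge0_integral_transfer d1 d2 (X : measurableType d1) (Y : measurableType d2)
    (m : {measure set X -> \bar R}) (m' : {measure set Y -> \bar R})
    (phi : X -> Y) (g : Y -> \bar R) :
  measurable_fun [set: X] phi ->
  (forall A, measurable A -> m' A = m (phi @^-1` A)) ->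
  measurable_fun [set: Y] g -> (forall y, 0 <= g y) ->
  \int[m']_y g y = \int[m]_x g (phi x).
Proof.
move=> mphi m'E mg g0.
transitivity (\int[pushforward m phi]_(y in setT) g y).
  by apply: eq_measure_integral => A mA _; exact: m'E.
by rewrite ge0_integral_pushforward ?preimage_setT.
Qed.

Lemma lebesgue_measure_shift (c : R) (A : set R) : measurable A ->
  mu A = mu ((fun x => x + c)%R @^-1` A).
Proof.
move=> mA.
have mf : measurable_fun [set: measurableTypeR R] (fun x : measurableTypeR R => x + c : measurableTypeR R)%R.
  exact: measurable_funD.
rewrite -[RHS]/(pushforward mu (fun x : measurableTypeR R => x + c : measurableTypeR R)%R A).
apply: lebesgue_measure_unique => //= _ [[a b]] _ <-.
rewrite /pushforward/=.
rewrite (_ : _ @^-1` _ = `](a - c)%R, (b - c)%R]%classic); last first.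
  by apply/seteqP; split => x /=; rewrite !in_itv/= ltrBlDr lerBrDr.
rewrite !lebesgue_measure_itv/= !lte_fin ltrD2r; case: ifP => // _.
by rewrite -!EFinB; congr EFin; lra.
Qed.

Lemma ge0_integral_shift (g : R -> \bar R) (c : R) :
  measurable_fun setT g -> (forall x, 0 <= g x) ->
  \int[mu]_x g (x + c)%R = \int[mu]_x g x.
Proof.
move=> mg g0; rewrite [RHS](@ge0_integral_transfer _ _ _ _ mu mu (fun x => x + c)%R)//.
- exact: measurable_funD.
- by move=> A mA; exact: lebesgue_measure_shift.
Qed.

Lemma ge0_integral_reflect (g : R -> \bar R) :
  measurable_fun setT g -> (forall x, 0 <= g x) ->
  \int[mu]_x g (- x)%R = \int[mu]_x g x.
Proof.
move=> mg g0; rewrite [RHS](@ge0_integral_transfer _ _ _ _ mu mu (fun x => - x)%R)//.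
- exact: oppr_measurable.
- by move=> A mA; symmetry; exact: lebesgue_measureN.
Qed.

Lemma ge0_integral_subl (g : R -> \bar R) (u : R) :
  measurable_fun setT g -> (forall x, 0 <= g x) ->
  \int[mu]_v g (u - v)%R = \int[mu]_x g x.
Proof.
move=> mg g0; rewrite -(ge0_integral_shift u mg g0).
rewrite -(@ge0_integral_reflect (fun v => g (v + u)%R))//.
- by apply: eq_integral => x _; rewrite addrC.
- by apply: measurableT_comp => //; exact: measurable_funD.
Qed.

Lemma RposE (x : R) : Rpos x = (0 < x)%R :> Prop.
Proof. by rewrite /Rpos/= in_itv/= andbT. Qed.

(** [eta (-1)] is dx/x, the Haar measure of the multiplicative group, and its image under the
    logarithm is Lebesgue measure. By uniqueness it suffices to compare them on half-open
    intervals. *)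
Lemma eta_ln (A : set R) : measurable A ->
  mu A = eta (-1) ((@ln R) @^-1` A).
Proof.
move=> mA.
have mln : measurable_fun [set: measurableTypeR R]
    (@ln R : measurableTypeR R -> measurableTypeR R) by exact: measurable_ln.
rewrite -[RHS]/(pushforward (eta (-1)) (@ln R : measurableTypeR R -> measurableTypeR R) A).
apply: lebesgue_measure_unique => //= _ [[a b]] _ <-; rewrite /pushforward/= lebesgue_measure_itv/= lte_fin /eta.
have -> : (@ln R) @^-1` `]a, b] `&` Rpos = `]expR a, expR b]%classic.
  apply/seteqP; split => x /=; rewrite RposE !in_itv/=.
    by move=> [/andP[ax xb] x0]; rewrite -[x]lnK// ltr_expR ler_expR ax xb.
  move=> /andP[ax xb]; have x0 : (0 < x)%R by apply: lt_trans ax; exact: expR_gt0.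
  by rewrite -ltr_expR -ler_expR lnK// ax xb.
case: ifPn => [ab|]; last first.
  rewrite -leNgt => ba.
  by rewrite set_itv_ge ?integral_set0// bnd_simp -leNgt ler_expR.
have e0 : (0 < expR a)%R by exact: expR_gt0.
transitivity (\int[mu]_(x in `]expR a, expR b]) (x^-1)%:E); last first.
  apply: eq_integral => x; rewrite inE/= in_itv/= => /andP[ax _].
  rewrite (_ : 2 * -1 + 1 = -1)%R; last lra.
  by rewrite powR_inv1// ltW// (lt_trans e0).
have dln (x : R) : x \in `[expR a, expR b] -> is_derive x (1:R)%R (@ln R) (x^-1)%R.
  rewrite in_itv/= => /andP[ax _]; apply: is_derive1_ln.
  by rewrite (lt_le_trans e0).
rewrite (integral_ocitv_FTC _ _ dln) ?ltr_expR ?expRK//.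
move=> x; rewrite in_itv/= => /andP[ax _]; apply: inv_continuous.
by rewrite gt_eqF// (lt_le_trans e0).
Qed.

Lemma measurable_Rpos : measurable (Rpos : set R).
Proof. exact: measurable_itv. Qed.

(** The right side is pulled back by [ln] to [eta (-1)], for which the points x <= 0 are null. Both
    sides are then Lebesgue integrals over (0, +oo), and x^(2 nu + 1) = x^(2 nu + 2) x^(-1). *)
Lemma ge0_integral_eta_log (nu : R) (f : R -> \bar R) :
  measurable_fun Rpos f -> (forall x, Rpos x -> 0 <= f x) ->
  \int[eta nu]_(x in Rpos) f x =
  \int[mu]_u (f (expR u) * (expR ((2 * nu + 2) * u))%:E).
Proof.
move=> mf f0; have mR := measurable_Rpos.
rewrite (@ge0_integral_density _ _ _ mu _ _ (fun x => x `^ (2 * nu + 1))%R)//; last 3 first.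
- by apply: measurable_funTS; exact: measurable_powR.
- by move=> x; exact: powR_ge0.
- by move=> A mA AR; rewrite -[LHS]/(eta nu A) /eta setIidl.
have me : measurable_fun [set: R] (fun u => f (expR u) * (expR ((2 * nu + 2) * u))%:E).
  apply: emeasurable_funM.
    apply: (measurable_comp mR) mf _ => //.
      by move=> _ [x _ <-]; rewrite RposE expR_gt0.
  by apply/measurable_EFinP; apply: measurableT_comp => //; exact: measurable_funM.
have gf0 u : 0 <= f (expR u) * (expR ((2 * nu + 2) * u))%:E.
  rewrite mule_ge0 ?lee_fin ?expR_ge0// f0// RposE.
  exact: expR_gt0.
rewrite (@ge0_integral_transfer _ _ _ _ (eta (-1)) mu (@ln R))//; last first.
  by move=> A mA; exact: eta_ln.
have mln : measurable_fun [set: R] (fun x => f (expR (ln x)) * (expR ((2 * nu + 2) * ln x))%:E).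
  by apply: (measurableT_comp me); exact: measurable_ln.
rewrite -(setUv Rpos) ge0_integral_setU//=; last 3 first.
- exact: measurableC.
- by rewrite setUv.
- exact/disj_setPCl.
rewrite [X in _ + X]null_set_integral ?adde0//; last 3 first.
- exact: measurableC.
- exact: measurable_funTS.
- by rewrite -[LHS]/(eta (-1) (~` Rpos)) /eta setICl integral_set0.
rewrite [RHS](@ge0_integral_density _ _ _ mu _ _ (fun x => x `^ (2 * (-1) + 1))%R); last 6 first.
- exact: mR.
- by apply: measurable_funTS; exact: measurable_powR.
- by move=> x; exact: powR_ge0.
- by move=> A mA AR; rewrite -[LHS]/(eta (-1) A) /eta setIidl.
- exact: measurable_funTS.
- by move=> x _; exact: gf0.
apply: eq_integral => x; rewrite inE RposE => x0.
rewrite lnK// -muleA; congr (_ * _); rewrite -EFinM; congr EFin.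
rewrite /powR gt_eqF// -expRD; congr expR; ring.
Qed.

(** For nu = -1/2 the weight x^(2 nu + 1) is 1, so Lebesgue measure on (0, +oo) is itself one of the
    measures [eta]. *)
Lemma eta_half_lebesgue (f : R -> \bar R) :
  measurable_fun Rpos f -> (forall x, Rpos x -> 0 <= f x) ->
  \int[mu]_(x in Rpos) f x = \int[mu]_u (f (expR u) * (expR u)%:E).
Proof.
move=> mf f0; have mR := measurable_Rpos.
transitivity (\int[eta (- 2^-1)]_(x in Rpos) f x).
  rewrite [RHS](@ge0_integral_density _ _ _ mu _ _ (fun x => x `^ (2 * - 2^-1 + 1))%R)//; last 3 first.
  - by apply: measurable_funTS; exact: measurable_powR.
  - by move=> x; exact: powR_ge0.
  - by move=> A mA AR; rewrite -[LHS]/(eta (- 2^-1) A) /eta setIidl.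
  apply: eq_integral => x _; rewrite (_ : 2 * - 2^-1 + 1 = 0)%R; last by field.
  by rewrite powRr0 mule1.
rewrite (ge0_integral_eta_log _ mf f0); apply: eq_integral => u _.
by rewrite (_ : (2 * - 2^-1 + 2) * u = u)%R; last by field.
Qed.
End log_substitution.

(** * Exponential integrals over half-lines *)

Section exp_integrals.
Context {R : realType}.
Local Open Scope ereal_scope.
Local Notation mu := (@lebesgue_measure R).

Lemma integral_expRN_ray (a c : R) : (0 < c)%R ->
  \int[mu]_(x in `[a, +oo[) (expR (- (c * x)))%:E = (expR (- (c * a)) / c)%:E.
Proof.
move=> c0; pose F x := (- (c^-1 * expR (- (c * x))))%R.
have dF x : is_derive x (1:R)%R F (expR (- (c * x))).
  by rewrite /F; apply: is_derive_eq; rewrite /GRing.scale/=; field; rewrite gt_eqF.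
have Fc : forall x, {for x, continuous F}.
  by move=> x; apply/differentiable_continuous/derivable1_diffP; have := dF x.
rewrite (@ge0_continuous_FTC2y _ _ F a 0%R).
- by rewrite sub0e /F -EFinN opprK mulrC.
- by move=> x _; exact: expR_ge0.
- apply: continuous_subspaceT => x.
  apply: continuous_comp; last exact: continuous_expR.
  by apply: continuousN; apply: mulrl_continuous.
- rewrite /F -[X in _ --> X]oppr0; apply: cvgN; rewrite -(mulr0 c^-1%R).
  apply: cvgMr; apply: (cvg_comp (fun x => c * x)%R _ _ (@cvgr_expR R)).
  exact: gt0_cvgMry.
- by move=> x _; have := dF x.
- by apply: cvg_at_right_filter; exact: Fc.
- by move=> x _; rewrite derive1E; have ? := dF x; rewrite derive_val.
Qed.

Lemma integral_expR_ray (a c : R) : (0 < c)%R ->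
  \int[mu]_(x in `]-oo, a]) (expR (c * x))%:E = (expR (c * a) / c)%:E.
Proof.
move=> c0; have me : measurable_fun [set: R] (fun x => (expR (c * x))%:E).
  by apply/measurable_EFinP; apply: measurableT_comp => //; exact: measurable_funM.
rewrite integral_mkcond/= -ge0_integral_reflect; last 2 first.
- by apply/(measurable_restrictT _ _).1 => //; exact: measurable_funTS.
- by move=> x; apply: erestrict_ge0 => y _; rewrite lee_fin expR_ge0.
rewrite -[X in _ = (expR X / _)%:E]opprK -mulrN -integral_expRN_ray//.
rewrite [RHS]integral_mkcond/=; apply: eq_integral => x _.
rewrite !patchE; congr (if _ then _ else _); last by rewrite mulrN.
by apply/idP/idP; rewrite !inE/= !in_itv/= andbT lerNl.
Qed.

Lemma integral_gumbel_ray (a : R) :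
  \int[mu]_(x in `[a, +oo[) (expR (x - expR x))%:E = (expR (- expR a))%:E.
Proof.
pose F x : R := (- expR (- expR x))%R.
have dF x : is_derive x (1:R)%R F (expR (x - expR x)).
  rewrite /F; apply: is_derive_eq; rewrite /GRing.scale/= expRD; ring.
have Fc : forall x, {for x, continuous F}.
  by move=> x; apply/differentiable_continuous/derivable1_diffP; have := dF x.
rewrite (@ge0_continuous_FTC2y _ _ F a 0%R).
- by rewrite sub0e /F -EFinN opprK.
- by move=> x _; exact: expR_ge0.
- apply: continuous_subspaceT => x.
  apply: continuous_comp; last exact: continuous_expR.
  by apply: continuousB => //; exact: continuous_expR.
- rewrite /F -[X in _ --> X]oppr0; apply: cvgN.
  apply: (cvg_comp _ _ _ (@cvgr_expR R)).
  apply/cvgryPge => A; near=> x; rewrite (@le_trans _ _ (1 + x)%R) ?expR_ge1Dx//.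
  by rewrite -lerBlDl; near: x; apply: nbhs_pinfty_ge; rewrite num_real.
- by move=> x _; have := dF x.
- by apply: cvg_at_right_filter; exact: Fc.
- by move=> x _; rewrite derive1E; have ? := dF x; rewrite derive_val.
Unshelve. all: by end_near. Qed.

End exp_integrals.

(** * The Gamma function *)

Section gamma.
Context {R : realType}.
Local Open Scope ereal_scope.
Local Notation mu := (@lebesgue_measure R).

(** Euler's integral after t = e^u, kept extended-valued so that Tonelli can be applied before
    finiteness is known. *)
Definition eGamma (s : R) : \bar R := \int[mu]_u (expR (s * u - expR u))%:E.

Let measurable_gumbel (s : R) : measurable_fun [set: R] (fun u => (expR (s * u - expR u))).
Proof.
apply: measurableT_comp => //; apply: measurable_funB => //.
Qed.

Let measurable_gumbelE (s : R) D :
  measurable_fun D (fun u : R => (expR (s * u - expR u))%:E).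
Proof. by apply: measurable_funTS; apply/measurable_EFinP. Qed.

Lemma eGamma_ge0 s : 0 <= eGamma s.
Proof. by apply: integral_ge0 => x _; rewrite lee_fin expR_ge0. Qed.

Lemma measurable_powR_pos (a : R) D : measurable_fun D (fun t : R => t `^ a)%R.
Proof. by apply: measurable_funTS; exact: measurable_powR. Qed.

Lemma eGammaE (s : R) :
  \int[mu]_(t in Rpos) (t `^ (s - 1) * expR (- t))%:E = eGamma s.
Proof.
rewrite eta_half_lebesgue; last 2 first.
- apply/measurable_EFinP; apply: measurable_funM; first exact: measurable_powR_pos.
  by apply: measurable_funTS; exact: measurableT_comp.
- by move=> x _; rewrite lee_fin mulr_ge0 ?powR_ge0 ?expR_ge0.
apply: eq_integral => u _; rewrite -EFinM; congr EFin.
by rewrite -expRM -!expRD; congr expR; ring.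
Qed.

Lemma GammaE (s : R) : Gamma s = fine (eGamma s).
Proof. by rewrite -eGammaE. Qed.

Lemma eGamma_lty (s : R) : (0 < s)%R -> eGamma s < +oo.
Proof.
move=> s0; pose n := Num.truncn s.
pose C : R := (n.+1`!%:R)%R.
have sn : (s < n.+1%:R)%R by exact: truncnS_gt.
rewrite /eGamma -(setUv `]-oo, 0%R]%classic) ge0_integral_setU//=; last 3 first.
- by apply: measurableC; exact: measurable_itv.
- exact: measurable_gumbelE.
- exact/disj_setPCl.
apply: lte_add_pinfty.
  apply: (@le_lt_trans _ _ (\int[mu]_(x in `]-oo, 0%R]) (expR (s * x))%:E)).
    apply: ge0_le_integral => //=.
    - exact: measurable_gumbelE.
    - apply/measurable_funTS/measurable_EFinP; apply: measurableT_comp => //.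
    - by move=> x _; rewrite lee_fin ler_expR gerBl expR_ge0.
  by rewrite integral_expR_ray// ltry.
rewrite setCitvl.
(* On the positive half-line one term of the exponential series suffices: e^(e^x) >= e^((n + 1) x) /
   (n + 1)!, and n + 1 > s. *)
apply: (@le_lt_trans _ _ (\int[mu]_(x in `[0%R, +oo[) (C%:E * (expR (- ((n.+1%:R - s) * x)))%:E))).
  apply: (@le_trans _ _ (\int[mu]_(x in `[0%R, +oo[) (expR (s * x - expR x))%:E)).
    apply: ge0_subset_integral => //=.
    - exact: measurable_gumbelE.
    - by move=> x /=; rewrite !in_itv/= !andbT => /ltW.
  apply: ge0_le_integral => //=.
  - exact: measurable_gumbelE.
  - apply/measurable_funTS/measurable_EFinP; apply: measurable_funM => //.
    by apply: measurableT_comp => //; apply: measurable_funN; exact: measurable_funM.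
  - move=> x _; rewrite -EFinM lee_fin.
    have e0 : (0 < expR x)%R by exact: expR_gt0.
    have := expR_ge1Dxn n (ltW e0); rewrite -expRM_natl => h.
    have C0 : (0 < C)%R by rewrite ltr0n fact_gt0.
    have : (expR (n.+1%:R * x) / C <= expR (expR x))%R.
      by apply: le_trans h; rewrite lerDr.
    rewrite ler_pdivrMr// => h2.
    rewrite expRB ler_pdivrMr ?expR_gt0//.
    rewrite (_ : - (_ * x) = s * x - n.+1%:R * x)%R; last ring.
    rewrite expRB (_ : C * _ * _ = expR (s * x) *
      ((expR (expR x) * C) / expR (n.+1%:R * x)))%R; last by ring.
    by rewrite ler_peMr ?expR_ge0// ler_pdivlMr ?expR_gt0// mul1r.
rewrite ge0_integralZl//=.
- by rewrite integral_expRN_ray ?subr_gt0// -EFinM ltry.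
- apply/measurable_funTS/measurable_EFinP; apply: measurableT_comp => //.
  by apply: measurable_funN; exact: measurable_funM.
- by rewrite lee_fin ler0n.
Qed.

Lemma eGamma_gt0 (s : R) : 0 < eGamma s.
Proof.
apply: (@lt_le_trans _ _ (\int[mu]_(x in `[0%R, 1%R]) (expR (- `|s| - expR 1))%:E)).
  rewrite integral_cst//= lebesgue_measure_itv/= lte01 oppr0 adde0 mule1.
  by rewrite lte_fin expR_gt0.
apply: (@le_trans _ _ (\int[mu]_(x in `[0%R, 1%R]) (expR (s * x - expR x))%:E)).
  apply: ge0_le_integral => //=.
  - exact: measurable_gumbelE.
  - move=> x; rewrite in_itv/= => /andP[x0 x1].
    rewrite lee_fin ler_expR lerB ?ler_expR//.
    rewrite lerNl -mulNr (@le_trans _ _ (`|s| * x)%R)//.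
      by rewrite ler_wpM2r// -normrN ler_norm.
    by rewrite ler_piMr.
apply: ge0_subset_integral => //=.
exact: measurable_gumbelE.
Qed.

Lemma eGamma_fin (s : R) : (0 < s)%R -> (Gamma s)%:E = eGamma s.
Proof.
by move=> s0; rewrite GammaE fineK// ge0_fin_numE ?eGamma_ge0 ?eGamma_lty.
Qed.

Lemma Gamma_gt0 (s : R) : (0 < s)%R -> (0 < Gamma s)%R.
Proof. by move=> s0; rewrite -lte_fin eGamma_fin// eGamma_gt0. Qed.

(** Tonelli takes the place of integration by parts: s e^(s x) e^(y - e^y) is integrated over x <= y
    in both orders, the inner integrals being e^(-e^x) and e^(s y) / s. *)
Lemma eGammaS (s : R) : (0 < s)%R -> eGamma (s + 1) = s%:E * eGamma s.
Proof.
move=> s0; pose D : set (R * R) := [set z | (z.1 <= z.2)%R].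
have mD : measurable D.
  rewrite -[D]setTI.
  by apply: (measurable_fun_ler _ _ measurableT (Y := [set true])).
pose f (z : R * R) :=
  (s * (expR (s * z.1) * expR (z.2 - expR z.2)))%:E * (\1_D z)%:E.
have mf : measurable_fun [set: R * R] f.
  apply: emeasurable_funM; apply/measurable_EFinP => //.
  apply: measurable_funM => //; apply: measurable_funM => //.
    by apply: measurableT_comp => //; apply: measurable_funM.
  apply: measurableT_comp => //; apply: measurable_funB => //.
  by apply: measurableT_comp.
have f0 z : 0 <= f z.
  by rewrite mule_ge0// lee_fin ?indicE ?ler0n// !mulr_ge0 ?expR_ge0// ltW.
have mexp : measurable_fun [set: R] (fun x => (expR (s * x))%:E).
  by apply/measurable_EFinP; apply: measurableT_comp => //; exact: measurable_funM.
have := fubini_tonelli (m1 := mu) (m2 := mu) f mf f0.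
have -> : \int[mu]_x \int[mu]_y f (x, y) = s%:E * eGamma s.
  rewrite /eGamma -ge0_integralZl//=; last 2 first.
  - exact: measurable_gumbelE.
  - by rewrite lee_fin ltW.
  apply: eq_integral => x _; rewrite expRD EFinM -(integral_gumbel_ray x) muleA -EFinM.
  rewrite -ge0_integralZl//=; last 2 first.
  - apply: (eq_measurable_fun (fun u : R => (expR (1 * u - expR u))%:E)) => [u _|].
      by rewrite mul1r.
    exact: measurable_gumbelE.
  - by rewrite lee_fin mulr_ge0 ?expR_ge0// ltW.
  rewrite [RHS]integral_mkcond epatch_indic; apply: eq_integral => y _.
  rewrite /f/= mulrA EFinM; congr (_ * _); rewrite !indicE; congr (_%:R%:E).
  by congr nat_of_bool; apply/idP/idP; rewrite !inE/= in_itv/= andbT.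
have -> : \int[mu]_y \int[mu]_x f (x, y) = eGamma (s + 1).
  apply: eq_integral => y _.
  transitivity (\int[mu]_(x in `]-oo, y]) ((s * expR (y - expR y))%:E * (expR (s * x))%:E)).
    rewrite [RHS]integral_mkcond epatch_indic; apply: eq_integral => x _.
    rewrite /f/= (mulrC (expR (s * x))) mulrA EFinM.
    by congr (_ * _).
  rewrite ge0_integralZl//=; last 2 first.
  - exact/measurable_funTS.
  - by rewrite lee_fin mulr_ge0 ?expR_ge0// ltW.
  rewrite integral_expR_ray// -EFinM; congr EFin.
  rewrite (_ : (s + 1) * y - expR y = (y - expR y) + s * y)%R; last ring.
  by rewrite [in RHS]expRD; field; rewrite gt_eqF.
by [].
Qed.

Lemma GammaS (s : R) : (0 < s)%R -> Gamma (s + 1) = (s * Gamma s)%R.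
Proof.
move=> s0; have s1 : (0 < s + 1)%R by rewrite addr_gt0.
by have := eGammaS s0; rewrite -(eGamma_fin s0) -(eGamma_fin s1) -EFinM => -[].
Qed.

(** The t-integral of a single term of the Bessel series. With t = b e^(-u), a reflection and a
    translation in the logarithm, it becomes Euler's integral. *)
Lemma integral_gamma_inv (alpha b : R) : (0 < b)%R ->
  \int[mu]_(t in Rpos) (t `^ (- alpha - 1) * expR (- (b / t)))%:E =
  (b `^ (- alpha))%:E * eGamma alpha.
Proof.
move=> b0.
rewrite eta_half_lebesgue; last 2 first.
- apply/measurable_EFinP; apply: measurable_funM; first exact: measurable_powR_pos.
  apply: measurableT_comp => //; apply: measurable_funN => //.
  apply: measurable_funM => //.
  apply: (eq_measurable_fun (fun t : R => t `^ (-1))%R); last exact: measurable_powR_pos.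
  by move=> t; rewrite inE RposE => t0; rewrite powR_inv1// ltW.
- by move=> x _; rewrite lee_fin mulr_ge0 ?powR_ge0 ?expR_ge0.
rewrite /eGamma -ge0_integralZl; last 4 first.
- exact: measurableT.
- exact: measurable_gumbelE.
- by move=> x _; rewrite lee_fin expR_ge0.
- by rewrite lee_fin powR_ge0.
rewrite -[RHS](ge0_integral_subl (ln b)); last 2 first.
- by apply: emeasurable_funM => //; exact: measurable_gumbelE.
- by move=> x; rewrite -EFinM lee_fin mulr_ge0 ?powR_ge0 ?expR_ge0.
apply: eq_integral => u _; rewrite -!EFinM; congr EFin.
rewrite -expRM -!expRD -[in RHS](lnK b0) -expRM lnK//.
rewrite -[b in LHS]lnK// -expRB -!expRD; congr expR; ring.
Qed.

End gamma.

(** * Power series with power-law coefficients *)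

Section power_series.
Context {R : realType}.
Implicit Types (a b : nat -> R) (r t x : R) (k n : nat).

Lemma gt0_powRD x (p q : R) : 0 < x -> x `^ (p + q) = x `^ p * x `^ q.
Proof. by move=> x0; rewrite powRD// (gt_eqF x0) implybT. Qed.

Lemma gt0_powRB1 x (p : R) : 0 < x -> x `^ (p - 1) = x `^ p / x.
Proof. by move=> x0; rewrite gt0_powRD// powR_inv1// ltW. Qed.

Lemma gt0_powRV x (p : R) : 0 < x -> x^-1 `^ p = x `^ (- p).
Proof.
by move=> x0; rewrite /powR invr_eq0 gt_eqF// lnV ?posrE// mulrN mulNr.
Qed.

Lemma le_expR_ratio x : 0 <= x <= 1 -> expR (- x) <= 1 - x / 2.
Proof.
move=> /andP[x0 x1]; rewrite expRN.
rewrite (@le_trans _ _ (1 + x)^-1)//.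
  by rewrite lef_pV2 ?posrE ?expR_gt0 ?expR_ge1Dx//; lra.
rewrite -[X in X <= _]mul1r ler_pdivrMr; last lra.
nra.
Qed.

(** Cross-multiplied, the hypothesis says that a / b is nonincreasing from [k0] on; the sum of its
    values up to [k0] therefore bounds it everywhere. *)
Lemma dominated_of_eventually_ratio a b k0 :
  (forall k, 0 < a k) -> (forall k, 0 < b k) ->
  (forall k, (k0 <= k)%N -> a k.+1 * b k <= a k * b k.+1) ->
  exists2 C, 0 < C & forall k, a k <= C * b k.
Proof.
move=> a0 b0 h; exists (\sum_(i < k0.+1) a i / b i).
  rewrite big_ord_recl/= ltr_wpDr ?divr_gt0// sumr_ge0// => i _.
  by rewrite divr_ge0 ?ltW.
move=> k; rewrite -ler_pdivrMr//.
have hk j : (j <= k0)%N -> a j / b j <= \sum_(i < k0.+1) a i / b i.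
  move=> jk; rewrite (bigD1 (Ordinal (ltnSE (jk : (j < k0.+1)%N) : (j < k0.+1)%N)))//=.
  rewrite lerDl sumr_ge0// => i _; by rewrite divr_ge0 ?ltW.
have [kk|/ltnW kk] := leqP k k0; first exact: hk.
have -> : k = (k0 + (k - k0))%N by rewrite subnKC.
elim: (k - k0)%N => [|m IHm]; first by rewrite addn0 hk.
apply: le_trans IHm; rewrite addnS ler_pdivrMr// mulrAC ler_pdivlMr//.
by apply: h; rewrite leq_addr.
Qed.

Lemma nneseries_ge_sum (u : nat -> R) n : (forall k, 0 <= u k) ->
  ((\sum_(k < n) u k)%:E <= \sum_(k <oo) (u k)%:E)%E.
Proof.
move=> u0; rewrite -(big_mkord xpredT) -sumEFin.
by apply: nneseries_lim_ge => k _; rewrite lee_fin.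
Qed.

Lemma nneseries_le_sum (u : nat -> R) (M : R) :
  (forall n, \sum_(k < n) u k <= M) -> (forall k, 0 <= u k) ->
  (\sum_(k <oo) (u k)%:E <= M%:E)%E.
Proof.
move=> h u0; apply: lime_le; first by apply: is_cvg_nneseries => k _; rewrite lee_fin.
by apply: nearW => n; rewrite sumEFin big_mkord lee_fin.
Qed.

Lemma ln_increment k : (0 : R) < k%:R -> k.+1%:R^-1 <= ln k.+1%:R - ln k%:R :> R.
Proof.
move=> k0; have k1 : (0 : R) < k.+1%:R by rewrite ltr0n.
have : ln (k%:R / k.+1%:R) <= - k.+1%:R^-1 :> R.
  rewrite (_ : k%:R / _ = 1 + - k.+1%:R^-1); last first.
    by rewrite -natr1; field; rewrite natr1 gt_eqF.
  apply: le_ln1Dx; rewrite ltrN2 invf_lt1// ltr1n ltnS.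
  by rewrite -(ltr0n R).
by rewrite ln_div ?posrE// lerNr opprB.
Qed.

(* [(k + 1)^(th - 1)] is dominated by the increments of [k^th]. *)
Lemma powR_increment (th : R) k : 0 < th -> th <= 1 ->
  (th / 2) * (k.+1%:R `^ (th - 1)) <= k.+1%:R `^ th - k%:R `^ th.
Proof.
move=> th0 th1; have k0 : (0 : R) < k.+1%:R by rewrite ltr0n.
rewrite gt0_powRB1//.
have p0 : 0 < k.+1%:R `^ th :> R by rewrite powR_gt0.
suff : k%:R `^ th <= k.+1%:R `^ th * (1 - (th / k.+1%:R) / 2).
  set P := k.+1%:R `^ th; set Q := k%:R `^ th.
  by move: (k.+1%:R^-1) => i h; lra.
have := @le_expR_ratio (th / k.+1%:R).
have -> : 0 <= th / k.+1%:R <= 1.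
  apply/andP; split; first by rewrite divr_ge0// ltW.
  by rewrite ler_pdivrMr// mul1r (le_trans th1)// ler1n.
move=> /(_ isT) h.
apply: le_trans (ler_wpM2l (ltW p0) h).
have [->|kn0] := eqVneq k 0%N.
  by rewrite powR0 ?gt_eqF// mulr_ge0 ?powR_ge0 ?expR_ge0.
have k1 : (0 : R) < k%:R by rewrite ltr0n lt0n.
rewrite {1}/powR {1}/powR !gt_eqF// -expRD ler_expR -[X in _ <= _ - X]/(th * k.+1%:R^-1).
rewrite -subr_ge0.
rewrite (_ : _ - _ = th * (ln k.+1%:R - k.+1%:R^-1 - ln k%:R)); last ring.
rewrite mulr_ge0 ?(ltW th0)//.
by rewrite addrAC subr_ge0; exact: ln_increment.
Qed.

Lemma sum_geometric_le r n : 0 <= r < 1 -> \sum_(k < n) r ^+ k <= (1 - r)^-1.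
Proof.
move=> /andP[r0 r1]; rewrite -[X in _ <= X]mul1r ler_pdivlMr ?subr_gt0// mulrC.
rewrite -opprB mulNr -subrX1 opprB gerBl exprn_ge0//.
Qed.

(** The natural cutoff is N = 1 / (1 - r). Up to N the geometric factor is dropped and the powers
    telescope; beyond N the power is at most N^(th - 1) and the geometric series contributes N.
    Truncating at N inside [phi] makes a single telescoping sum serve for all indices. *)
Lemma sum_power_geometric_le (th r : R) n : 0 < th -> th <= 1 -> 0 <= r < 1 ->
  \sum_(k < n) (k.+1%:R `^ (th - 1) * r ^+ k) <=
  (2 / th + 1) * (1 - r) `^ (- th).
Proof.
move=> th0 th1 /andP[r0 r1].
set N : R := (1 - r)^-1.
have N0 : 0 < N by rewrite invr_gt0 subr_gt0.
have NE : (1 - r) `^ (- th) = N `^ th.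
  by rewrite /N gt0_powRV// subr_gt0.
rewrite NE.
pose phi k : R := (Num.min k%:R N) `^ th.
have phiS k : 0 <= phi k.+1 - phi k.
  rewrite subr_ge0 ge0_ler_powR ?(ltW th0)// ?nnegrE ?le_min ?ler0n ?(ltW N0)//.
  by rewrite !ge_min ler_nat leqnSn lexx orbT.
have tk k : k.+1%:R `^ (th - 1) * r ^+ k <=
    (2 / th) * (phi k.+1 - phi k) + N `^ (th - 1) * r ^+ k.
  have [kN|Nk] := leP k.+1%:R N.
    have kN' : k%:R <= N by rewrite (le_trans _ kN)// ler_nat.
    rewrite /phi !min_l// ler_wpDr ?mulr_ge0 ?powR_ge0 ?exprn_ge0//.
    apply: (@le_trans _ _ (k.+1%:R `^ (th - 1))).
      by rewrite ler_piMr ?powR_ge0 ?exprn_ile1// ltW.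
    have := powR_increment k th0 th1.
    by rewrite -[X in X <= _]mulrC -ler_pdivlMr ?divr_gt0// invf_div mulrC.
  rewrite ler_wpDl//; first by apply: mulr_ge0 => //; rewrite divr_ge0// ltW.
  rewrite ler_wpM2r ?exprn_ge0// -!(opprB 1 th) !powRN lef_pV2 ?posrE ?powR_gt0//.
  by rewrite ge0_ler_powR ?nnegrE ?subr_ge0 ?(ltW N0) ?(ltW Nk).
apply: (@le_trans _ _ (\sum_(k < n)
    ((2 / th) * (phi k.+1 - phi k) + N `^ (th - 1) * r ^+ k))).
  by apply: ler_sum => k _; exact: tk.
rewrite big_split/= -!mulr_sumr [leRHS]mulrDl mul1r; apply: lerD.
  rewrite ler_wpM2l ?divr_ge0 ?(ltW th0)//.
  rewrite -(big_mkord xpredT (fun k => phi k.+1 - phi k)) telescope_sumr//.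
  have -> : phi 0%N = 0 by rewrite /phi min_l ?(ltW N0)// powR0 ?gt_eqF.
  rewrite subr0 /phi.
  by rewrite ge0_ler_powR ?nnegrE ?(ltW th0) ?le_min ?ler0n ?(ltW N0)// ge_min lexx orbT.
rewrite (@le_trans _ _ (N `^ (th - 1) * N))//.
  by rewrite ler_wpM2l ?powR_ge0// sum_geometric_le// r0.
by rewrite -{2}(powRr1 (ltW N0)) -gt0_powRD// subrK.
Qed.

(** The integral test in telescoping form: from the second term on, each one is at most a multiple
    of the decrease of k^(1 - be). *)
Lemma sum_pseries_le (be : R) n : 1 < be ->
  \sum_(k < n) (k.+1%:R `^ (- be)) <= 1 + (be - 1)^-1.
Proof.
move=> b1; have e0 : 0 < be - 1 by lra.
have tk k : k.+2%:R `^ (- be) <=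
    (be - 1)^-1 * (k.+1%:R `^ (- (be - 1)) - k.+2%:R `^ (- (be - 1))).
  have k1 : (0 : R) < k.+1%:R by rewrite ltr0n.
  have k2 : (0 : R) < k.+2%:R by rewrite ltr0n.
  rewrite -ler_pdivrMl ?invr_gt0// invrK.
  rewrite (_ : - be = - (be - 1) - 1); last ring.
  rewrite gt0_powRB1//.
  have p0 : 0 < k.+2%:R `^ (- (be - 1)) :> R by rewrite powR_gt0.
  suff : k.+2%:R `^ (- (be - 1)) * (1 + (be - 1) / k.+2%:R) <= k.+1%:R `^ (- (be - 1)) :> R.
    set P := k.+2%:R `^ _; set Q := k.+1%:R `^ _.
    by move: (k.+2%:R^-1) => i h; lra.
  apply: le_trans (ler_wpM2l (ltW p0) (expR_ge1Dx _)) _.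
  rewrite /powR !gt_eqF// -expRD ler_expR -subr_ge0.
  rewrite (_ : _ - _ = (be - 1) * (ln k.+2%:R - k.+2%:R^-1 - ln k.+1%:R)); last ring.
  rewrite mulr_ge0 ?(ltW e0)//.
  by rewrite addrAC subr_ge0; exact: ln_increment.
case: n => [|n]; first by rewrite big_ord0 addr_ge0 ?invr_ge0 ?ltW.
rewrite big_ord_recl/= powR1 lerD2l.
apply: (@le_trans _ _ (\sum_(k < n) ((be - 1)^-1 *
    (k.+1%:R `^ (- (be - 1)) - k.+2%:R `^ (- (be - 1)))))).
  by apply: ler_sum => k _; exact: tk.
rewrite -mulr_sumr ler_piMr ?invr_ge0 ?(ltW e0)//.
rewrite -(big_mkord xpredT (fun k => k.+1%:R `^ (- (be - 1)) - k.+2%:R `^ (- (be - 1)))).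
rewrite -[leLHS]opprK -sumrN.
under eq_bigr do rewrite opprB.
rewrite (telescope_sumr (fun k => k.+1%:R `^ (- (be - 1)))) // opprB powR1 gerBl.
exact: powR_ge0.
Qed.

Lemma bernoulli_ineq t k : 0 <= t <= 1 -> 1 - k%:R * t <= (1 - t) ^+ k.
Proof.
move=> /andP[t0 t1]; elim: k => [|k IHk]; first by rewrite mul0r subr0 expr0.
rewrite exprS (le_trans _ (ler_wpM2l _ IHk)) ?subr_ge0//.
rewrite -natr1; have := ler0n R k; nra.
Qed.

(* Only the terms of index at most [1 / (2 (1 - r))] are kept; there [r ^+ k]
   is at least [1 / 2]. *)
Lemma sum_power_geometric_ge (be r : R) : 0 <= be -> 0 <= r < 1 ->
  exists n, (8 * 2 `^ be)^-1 * (1 - r) `^ (be - 1) <=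
    \sum_(k < n) (k.+1%:R `^ (- be) * r ^+ k).
Proof.
move=> b0 /andP[r0 r1]; set t := 1 - r.
have t0 : 0 < t by rewrite subr_gt0.
have t1 : t <= 1 by rewrite gerBl.
pose n := (Num.truncn (t^-1 / 2)).
have nN : n%:R <= t^-1 / 2 by have /truncn_itv/andP[] : 0 <= t^-1 / 2 by rewrite divr_ge0 ?invr_ge0 ?ltW.
have Nn : t^-1 / 2 < n.+1%:R by exact: truncnS_gt.
exists n.+1.
have t1' : 1 <= t^-1 by rewrite invf_ge1.
have tk (k : 'I_n.+1) : (2 * t^-1) `^ (- be) / 2 <= k.+1%:R `^ (- be) * r ^+ k.
  have kn : k%:R <= n%:R :> R by rewrite ler_nat -ltnS.
  apply: ler_pM; rewrite ?powR_ge0 ?invr_ge0//.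
    rewrite !powRN lef_pV2 ?posrE ?powR_gt0 ?mulr_gt0 ?invr_gt0//.
    rewrite ge0_ler_powR ?nnegrE ?mulr_ge0 ?invr_ge0 ?(ltW t0)//.
    rewrite -natr1; lra.
  have -> : r = 1 - t by rewrite /t; ring.
  apply: le_trans (bernoulli_ineq k _); last by rewrite (ltW t0).
  suff : k%:R * t <= 1 / 2 by lra.
  rewrite -ler_pdivlMr//; lra.
have : \sum_(k < n.+1) ((2 * t^-1) `^ (- be) / 2) <= \sum_(k < n.+1) (k.+1%:R `^ (- be) * r ^+ k).
  by apply: ler_sum => k _; exact: tk.
rewrite sumr_const card_ord -[X in X <= _ -> _]mulr_natl; apply: le_trans.
apply: (@le_trans _ _ ((t^-1 / 2) * ((2 * t^-1) `^ (- be) / 2))); last first.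
  by apply: ler_wpM2r; rewrite ?divr_ge0 ?powR_ge0// ltW.
rewrite powRM ?invr_ge0 ?(ltW t0)// gt0_powRV// opprK powRN.
rewrite gt0_powRB1//.
have p2 : 0 < 2 `^ be :> R by rewrite powR_gt0.
have pt : 0 < t `^ be by rewrite powR_gt0.
rewrite invfM -subr_ge0.
rewrite (_ : _ - _ = (t^-1 * (2 `^ be)^-1 * t `^ be) / 8); last first.
  by field; rewrite !gt_eqF.
by rewrite !mulr_ge0 ?invr_ge0 ?ltW.
Qed.

(** A harmonic sum of value at least 2 |M| is fixed first; for r close enough to 1, Bernoulli's
    inequality keeps all its geometric factors above 1/2. The value r = 1 is included because it
    corresponds to w = 0 in the kernel. *)
Lemma sum_harmonic_geometric_ge (M : R) : exists2 d : R, 0 < d &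
  forall r, 0 <= r <= 1 -> 1 - r <= d ->
  exists n, M <= \sum_(k < n) (k.+1%:R `^ (- 1) * r ^+ k).
Proof.
have [n hn] : exists n, 2 * `|M| <= \sum_(k < n) k.+1%:R `^ (- 1).
  have h m : ln m.+1%:R <= \sum_(k < m) k.+1%:R `^ (- 1) :> R.
    elim: m => [|m IHm]; first by rewrite ln1 big_ord0.
    rewrite big_ord_recr/= (le_trans _ (lerD IHm (lexx _)))// -lerBlDl -ln_div ?posrE//.
    rewrite powR_inv1//; have m1 : (0 : R) < m.+1%:R by rewrite ltr0n.
    rewrite (_ : m.+2%:R / _ = 1 + m.+1%:R^-1); last first.
      by rewrite -(natr1 m.+1); field; rewrite gt_eqF.
    apply: le_ln1Dx; apply: (@lt_trans _ _ 0); first by rewrite ltrN10.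
    by rewrite invr_gt0.
  exists (Num.truncn (expR (2 * `|M|))); apply: le_trans (h _).
  by rewrite -ler_expR lnK ?posrE ?ltr0n// ltW// truncnS_gt.
exists (2 * n.+1%:R)^-1; first by rewrite invr_gt0 mulr_gt0// ltr0n.
move=> r /andP[r0 r1] rd; exists n.
apply: (@le_trans _ _ (\sum_(k < n) (k.+1%:R `^ (- 1) * 2^-1))).
  by rewrite -mulr_suml ler_pdivlMr// mulrC (le_trans _ hn)// ler_wpM2l// ler_norm.
apply: ler_sum => k _; rewrite ler_wpM2l ?powR_ge0//.
have -> : r = 1 - (1 - r) by ring.
apply: le_trans (bernoulli_ineq k _); last by lra.
have kn : k%:R <= n.+1%:R :> R by rewrite ler_nat ltnW// ltnS ltnW.
suff : k%:R * (1 - r) <= 1 / 2 by lra.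
apply: (@le_trans _ _ (n.+1%:R * (2 * n.+1%:R)^-1)).
  by rewrite ler_pM ?subr_ge0.
by rewrite invfM mulrCA divff ?mulr1 ?mul1r// gt_eqF ?ltr0n.
Qed.

End power_series.

(** * The potential kernel *)

Section kernel_series.
Context {R : realType}.
Local Open Scope ereal_scope.
Local Notation mu := (@lebesgue_measure R).

Definition bessel_term (m z : R) (k : nat) : R :=
  ((z / 2) `^ (2 * k%:R + m) / (k`!%:R * Gamma (k%:R + m + 1)))%R.

(** From k = 1 on the factor in the functional equation is at least 1, so the first two values give
    the minimum. This makes the Bessel series comparable with an exponential series. *)
Lemma Gamma_shift_ge (m : R) : (-1 < m)%R ->
  exists2 c : R, (0 < c)%R & forall k : nat, (c <= Gamma (k%:R + m + 1))%R.
Proof.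
move: (@Gamma R) (@GammaS R) (@Gamma_gt0 R) => G GS G0.
move=> m1; have h k : (0 < k%:R + m + 1)%R.
  by rewrite -addrA ltr_wpDl ?ler0n//; lra.
exists (Num.min (G (m + 1)) (G (m + 1 + 1)))%R.
  by rewrite lt_min !G0//; lra.
case; first by rewrite add0r ge_min lexx.
elim=> [|k IHk]; first by rewrite (addrC 1%:R) -addrA ge_min lexx orbT.
apply: (le_trans IHk).
rewrite [X in (_ <= G X)%R](_ : _ = (k.+1%:R + m + 1) + 1)%R; last first.
  by rewrite -(natr1 k.+1); ring.
rewrite [X in (_ <= X)%R]GS// ler_peMl ?(ltW (G0 _ _))//.
by rewrite -natr1; have := ler0n R k; lra.
Qed.

(** The limit defining [besselI] is taken in the reals, so convergence has to be shown before it can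
    be read as an extended sum and exchanged with integrals. *)
Lemma besselI_series (m z : R) : (-1 < m)%R -> (0 < z)%R ->
  (besselI m z)%:E = \sum_(k <oo) (bessel_term m z k)%:E.
Proof.
move=> m1 z0; have z2 : (0 < z / 2)%R by rewrite divr_gt0.
have [c c0 cG] := Gamma_shift_ge m1.
have G0 k : (0 < Gamma (k%:R + m + 1))%R by rewrite (lt_le_trans c0).
rewrite /besselI -EFin_lim; last first.
  apply: (@series_le_cvg _ _
      (fun k => (c^-1 * (z / 2) `^ m) *: exp_coeff ((z / 2) ^+ 2) k)%R).
  - by move=> k; rewrite divr_ge0 ?powR_ge0// mulr_ge0 ?ler0n// ltW.
  - move=> k; rewrite /GRing.scale/= mulr_ge0// ?mulr_ge0 ?powR_ge0 ?invr_ge0 ?(ltW c0)//.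
    by rewrite exprn_ge0// exprn_ge0// ltW.
  - move=> k; rewrite /GRing.scale/= /exp_coeff/=.
    rewrite gt0_powRD// -natrM powR_mulrn ?(ltW z2)// exprM.
    rewrite invfM.
    rewrite [X in (X <= _)%R](_ : _ = (Gamma (k%:R + m + 1))^-1 * (z / 2) `^ m *
      (((z / 2) ^+ 2) ^+ k / k`!%:R))%R; last by ring.
    rewrite ler_wpM2r//; first by rewrite divr_ge0 ?exprn_ge0 ?ler0n// ltW.
    by rewrite ler_wpM2r ?powR_ge0// lef_pV2 ?posrE.
  - by apply: is_cvg_seriesZ; exact: is_cvg_series_exp_coeff.
by congr (limn _); apply/funext => n; rewrite /= /series/= -sumEFin.
Qed.

Definition coshR (w : R) : R := ((expR w + expR (- w)) / 2)%R.

Lemma coshR_gt0 w : (0 < coshR w)%R.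
Proof. by rewrite divr_gt0// addr_gt0 ?expR_gt0. Qed.

Lemma measurable_expR_inv (b : R) :
  measurable_fun Rpos (fun t : R => expR (- (b / t)))%R.
Proof.
apply: measurableT_comp => //; apply: measurable_funN => //.
apply: measurable_funM => //.
apply: (eq_measurable_fun (fun t : R => t `^ (-1))%R); last exact: measurable_powR_pos.
by move=> t; rewrite inE RposE => t0; rewrite powR_inv1// ltW.
Qed.

Variables nu sigma : R.
Hypotheses (nu1 : (nu < 1)%R) (sigma0 : (0 < sigma)%R) (sigma1 : (sigma < - nu + 1)%R).
Local Notation s := (1 - nu - sigma)%R.

(* The coefficients of the t-integral of the Bessel series, as a power series
   in [cosh(u - v)^(-2)]. *)
Definition kcoef (k : nat) : R :=
  (Gamma (2 * k%:R + s) / (4 ^+ k * (k`!%:R * Gamma (k%:R + - nu + 1))))%R.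

Definition kprof_series (r : R) : \bar R := \sum_(k <oo) (kcoef k * r ^+ k)%:E.

(** At w = 0 the series is evaluated at 1, where it diverges if sigma <= 1/2; hence the extended
    values. *)
Definition kprof (w : R) : \bar R :=
  (coshR w `^ (- s))%:E * kprof_series ((coshR w) ^- 2).

Definition kconst : R := ((Gamma sigma)^-1 * 2 `^ (s + 2 * nu - 1))%R.

Lemma kconst_gt0 : (0 < kconst)%R.
Proof. by rewrite mulr_gt0 ?powR_gt0// invr_gt0 Gamma_gt0. Qed.

Lemma kcoef_gt0 k : (0 < kcoef k)%R.
Proof.
have k0 := ler0n R k; have [n1 n2 n3] := And3 nu1 sigma0 sigma1.
have G1 : (0 < Gamma (2 * k%:R + s))%R by apply: Gamma_gt0; lra.
have G2 : (0 < Gamma (k%:R + - nu + 1))%R by apply: Gamma_gt0; lra.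
rewrite /kcoef; move: (Gamma _) (Gamma _) G1 G2 => x y x0 y0.
by rewrite divr_gt0// mulr_gt0 ?exprn_gt0// mulr_gt0// ltr0n fact_gt0.
Qed.

Lemma exotic_kernel_exp (u v : R) :
  exotic_kernel nu sigma (expR u) (expR v) =
  (kconst * expR ((u + v) * (sigma - 1 - nu)))%:E * kprof (u - v).
Proof.
rewrite /exotic_kernel; have [n1 n2 n3] := And3 nu1 sigma0 sigma1.
(* This is (x^2 + y^2) / 4 for x = e^u and y = e^v. *)
pose b : R := (expR (u + v) * coshR (u - v) / 2)%R.
have b0 : (0 < b)%R by rewrite divr_gt0// mulr_gt0 ?expR_gt0 ?coshR_gt0.
have bE : ((expR u ^+ 2 + expR v ^+ 2) / 4 = b)%R.
  rewrite /b /coshR expRD expRB expRN expRB; field.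
  by rewrite !gt_eqF ?expR_gt0.
(* Writing powers of 2 as exponentials turns the identities between powers below into linear
   identities of exponents. *)
pose l : R := ln 2; have l2 : (2 = expR l)%R by rewrite lnK// posrE.
pose D k : R := (expR (- nu * (u + v) - l + (u + v - 2 * l) * (2 * k%:R - nu))
   / (k`!%:R * Gamma (k%:R + - nu + 1)))%R.
have D0 k : (0 <= D k)%R.
  have k0 := ler0n R k.
  have G2 : (0 < Gamma (k%:R + - nu + 1))%R by apply: Gamma_gt0; lra.
  by rewrite divr_ge0 ?expR_ge0// mulr_ge0 ?ler0n// ltW.
(* The powers of t in the k-th term are -1, -(2 k - nu) and sigma - 1; their sum is [- al k - 1].
   [D k] collects what does not depend on t. *)
pose al k : R := (2 * k%:R + s)%R.
have al0 k : (0 < al k)%R by rewrite /al; have := ler0n R k; lra.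
pose g k (t : R) := ((D k)%:E * (t `^ (- al k - 1) * expR (- (b / t)))%:E).
have gE k : \int[mu]_(t in Rpos) g k t = (D k * (b `^ (- al k) * Gamma (al k)))%:E.
  rewrite /g ge0_integralZl_EFin//=.
  - by rewrite integral_gamma_inv// -eGamma_fin// -!EFinM.
  - exact: measurable_Rpos.
  - by move=> t _; rewrite lee_fin mulr_ge0 ?powR_ge0 ?expR_ge0.
  - apply/measurable_EFinP; apply: measurable_funM; first exact: measurable_powR_pos.
    exact: measurable_expR_inv.
have -> : \int[mu]_(t in Rpos)
     (exotic_heat nu t (expR u) (expR v) * t `^ (sigma - 1))%:E =
   \int[mu]_(t in Rpos) \sum_(k <oo) g k t.
  apply: eq_integral => t; rewrite inE RposE => t0.
  rewrite -(lnK t0); set T := ln t.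
  rewrite /exotic_heat /bessel_heat.
  have z0 : (0 < expR u * expR v / (2 * expR T))%R.
    by rewrite !(mulr_gt0, invr_gt0, expR_gt0).
  have m1 : (-1 < - nu)%R by lra.
  transitivity (((expR u * expR v) `^ (- (2 * nu)) * ((2 * expR T)^-1 *
     (expR u * expR v) `^ (- - nu) *
     expR (- (expR u ^+ 2 + expR v ^+ 2) / (4 * expR T)) * expR T `^ (sigma - 1)))%:E *
     (besselI (- nu) (expR u * expR v / (2 * expR T)))%:E).
    by rewrite -EFinM; congr EFin; ring.
  rewrite besselI_series// -nneseriesZl; last first.
    move=> k _; rewrite lee_fin divr_ge0 ?powR_ge0// mulr_ge0 ?ler0n// ltW// Gamma_gt0//.
    by have := ler0n R k; lra.
  apply: eq_eseriesr => k _; rewrite /g -!EFinM; congr EFin.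
  rewrite /bessel_term /D [LHS]mulrA [RHS]mulrAC.
  congr (_ / _)%R.
  have -> : (2 * expR T = expR (l + T))%R by rewrite expRD -l2.
  have -> : (2^-1 = expR (- l) :> R)%R by rewrite expRN -l2.
  have -> : (- (expR u ^+ 2 + expR v ^+ 2) / (4 * expR T) = - (b / expR T))%R.
    by rewrite -bE; field; rewrite gt_eqF ?expR_gt0.
  rewrite -!(expRD, expRN, expRB) -!expRM -!expRD; congr expR.
  by rewrite /al; ring.
rewrite integral_nneseries; last 3 first.
- exact: measurable_Rpos.
- move=> k; apply: emeasurable_funM => //; apply/measurable_EFinP.
  apply: measurable_funM; first exact: measurable_powR_pos.
  exact: measurable_expR_inv.
- by move=> k t _; rewrite mule_ge0 ?lee_fin// mulr_ge0 ?powR_ge0 ?expR_ge0.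
under eq_eseriesr do rewrite gE.
rewrite /kprof /kprof_series muleA -EFinM -!nneseriesZl.
- apply: eq_eseriesr => k _; rewrite -!EFinM; congr EFin.
  rewrite /kconst /D /kcoef /al; pose lc := ln (coshR (u - v)).
  have -> : b = expR (u + v + lc - l).
    by rewrite /lc expRB expRD lnK ?posrE ?coshR_gt0// -l2.
  have cE : coshR (u - v) = expR (lc) by rewrite /lc lnK ?posrE ?coshR_gt0.
  have -> : ((coshR (u - v) ^- 2) ^+ k = expR (- (2 * k%:R * lc)))%R.
    by rewrite [in LHS]cE -expRM_natl -expRN -expRM_natl; congr expR; ring.
  have -> : (4 ^+ k = expR (2 * k%:R * l))%R.
    rewrite (_ : 4 = (expR l) ^+ 2)%R; last by rewrite -l2; ring.
    by rewrite -exprM -expRM_natl natrM; congr expR; ring.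
  have -> : (2 `^ (s + 2 * nu - 1) = expR (l * (s + 2 * nu - 1)))%R.
    by rewrite {1}l2 -expRM.
  rewrite [in RHS]cE -!expRM.
  transitivity ((Gamma sigma)^-1 * (Gamma (2 * k%:R + s) / (k`!%:R * Gamma (k%:R + - nu + 1))) *
    (expR (- nu * (u + v) - l + (u + v - 2 * l) * (2 * k%:R - nu)) *
     expR ((u + v + lc - l) * - (2 * k%:R + s))))%R; first by ring.
  rewrite -expRD [in RHS]invfM -[in RHS]expRN.
  transitivity ((Gamma sigma)^-1 * (Gamma (2 * k%:R + s) / (k`!%:R * Gamma (k%:R + - nu + 1))) *
    (expR (l * (s + 2 * nu - 1)) * expR ((u + v) * (sigma - 1 - nu)) *
     expR (lc * - s) * expR (- (2 * k%:R * l)) *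
     expR (- (2 * k%:R * lc))))%R; last by ring.
  by rewrite -!expRD; congr (_ * expR _)%R; ring.
- by move=> k _; rewrite lee_fin mulr_ge0 ?exprn_ge0 ?invr_ge0 ?exprn_ge0 ?ltW ?kcoef_gt0 ?coshR_gt0.
- by move=> k _; rewrite lee_fin mulr_ge0// mulr_ge0 ?powR_ge0// ltW// Gamma_gt0.
Qed.

End kernel_series.

(** * Two-sided bounds for the kernel profile *)

Section kernel_bounds.
Context {R : realType}.
Implicit Types (nu sigma be x w r lam : R) (k : nat).

(** This and the next lemma enclose (1 + 1/x)^(-be) between e^(-be / x) and e^(-be / (x + 1)), both
    from ln(1 + y) <= y. Exponentials then compare with rational quotients through e^y >= 1 + y. *)
Lemma powR_succ_ge be x : 0 <= be -> 0 < x ->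
  expR (- (be / x)) * x `^ (- be) <= (x + 1) `^ (- be).
Proof.
move=> b0 x0; have x1 : 0 < x + 1 by lra.
rewrite /powR !gt_eqF// -expRD ler_expR.
have -> : x + 1 = x * (1 + x^-1) by field; rewrite gt_eqF.
have i0 : 0 < x^-1 by rewrite invr_gt0.
have : ln (1 + x^-1) <= x^-1 by apply: le_ln1Dx; lra.
rewrite lnM ?posrE//; last lra.
move: (x^-1) i0 => i i0 h; nra.
Qed.

Lemma powR_succ_le be x : 0 <= be -> 0 < x ->
  (x + 1) `^ (- be) <= expR (- (be / (x + 1))) * x `^ (- be).
Proof.
move=> b0 x0; have x1 : 0 < x + 1 by lra.
rewrite /powR !gt_eqF// -expRD ler_expR.
have i0 : 0 < (x + 1)^-1 by rewrite invr_gt0.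
have i1 : (x + 1)^-1 < 1 by rewrite invf_lt1//; lra.
have : ln (x / (x + 1)) <= - (x + 1)^-1.
  have -> : x / (x + 1) = 1 + - (x + 1)^-1 by field; rewrite gt_eqF.
  by apply: le_ln1Dx; lra.
rewrite ln_div ?posrE//.
move: (ln x) (ln _) ((x + 1)^-1) i0 i1 => a b i i0 i1 h; nra.
Qed.

(** The functional equation of Gamma, twice above and once below. With s = 1 - nu - sigma, the
    coefficients are, up to a constant factor, those of the hypergeometric series with upper
    parameters s/2, (s + 1)/2 and lower parameter 1 - nu. *)
Lemma kcoefS nu sigma k : nu < 1 -> 0 < sigma -> sigma < - nu + 1 ->
  kcoef nu sigma k.+1 * ((k%:R + 1) * (k%:R + (1 - nu))) =
  kcoef nu sigma k * ((k%:R + (1 - nu - sigma) / 2) * (k%:R + (1 - nu - sigma) / 2 + 1 / 2)).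
Proof.
move=> n1 n2 n3; have k0 : 0 <= k%:R :> R by [].
rewrite /kcoef; set s := 1 - nu - sigma.
have s0 : 0 < s by rewrite /s; lra.
move: (@Gamma R) (@GammaS R) (@Gamma_gt0 R) => G GS G_gt0.
have -> : G (2 * k.+1%:R + s) = (2 * k%:R + s + 1) * ((2 * k%:R + s) * G (2 * k%:R + s)).
  rewrite -GS; last by lra.
  rewrite -GS; last by lra.
  by congr G; rewrite -natr1; ring.
have -> : G (k.+1%:R + - nu + 1) = (k%:R + - nu + 1) * G (k%:R + - nu + 1).
  rewrite -GS; last by lra.
  by congr G; rewrite -natr1; ring.
have G0 : 0 < G (k%:R + - nu + 1) by apply: G_gt0; lra.
have f0 : 0 < k`!%:R :> R by rewrite ltr0n fact_gt0.
rewrite factS natrM exprS -natr1.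
field; rewrite !gt_eqF ?exprn_gt0//; lra.
Qed.

Lemma kcoef_le nu sigma : nu < 1 -> 0 < sigma -> sigma < - nu + 1 ->
  exists2 C : R, 0 < C &
    forall k, kcoef nu sigma k <= C * k.+1%:R `^ (- (sigma + 1 / 2)).
Proof.
move=> n1 n2 n3; set be := sigma + 1 / 2; set s := 1 - nu - sigma; set d := 1 - nu.
have b0 : 0 < be by rewrite /be; lra.
have s0 : 0 < s by rewrite /s; lra.
have d0 : 0 < d by rewrite /d; lra.
(* With this [e] the quotient of consecutive coefficients is 1 - (be k + e) / ((k + 1) (k + d)). *)
pose e := d - s * (s + 1) / 4.
(* It suffices that the quotient be at most 1 - be / (k + ga), that is, (be k + e) (k + ga) >= be (k
   + 1) (k + d). The quadratic terms cancel; this shift makes the coefficient of k in the difference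
   at least 1, and the constant term is absorbed once k exceeds be d + |e| ga. *)
pose ga := 1 + d + (`|e| + 1) / be.
have q0 : 0 < (`|e| + 1) / be by rewrite divr_gt0// ltr_wpDl.
have qb : (`|e| + 1) / be * be = `|e| + 1 by rewrite divfK// gt_eqF.
have g1 : 1 <= ga by rewrite /ga; lra.
have eN : - `|e| <= e by rewrite lerNl -normrN ler_norm.
have x0 k : 0 < k%:R + ga by have : 0 <= k%:R :> R by []; lra.
have [|C C0 hC] := @dominated_of_eventually_ratio R (kcoef nu sigma)
  (fun k => (k%:R + ga) `^ (- be)) (Num.truncn (be * d + `|e| * ga)).+1
  (kcoef_gt0 n1 n2 n3) (fun k => powR_gt0 _ (x0 k)); last first.
  exists C => // k; apply: (le_trans (hC k)); rewrite ler_wpM2l ?(ltW C0)//.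
  rewrite !powRN lef_pV2 ?posrE ?powR_gt0// ge0_ler_powR ?(ltW b0)// ?nnegrE//.
    exact: ltW.
  by rewrite -natr1; lra.
move=> k kk; have k0 : 0 <= k%:R :> R by [].
have kbig : be * d + `|e| * ga < k%:R.
  by apply: (lt_le_trans (truncnS_gt _)); rewrite ler_nat.
have D0 : 0 < (k%:R + 1) * (k%:R + d) by rewrite mulr_gt0//; lra.
set rho := ((k%:R + s / 2) * (k%:R + s / 2 + 1 / 2)) / ((k%:R + 1) * (k%:R + d)).
have -> : kcoef nu sigma k.+1 = kcoef nu sigma k * rho.
  by rewrite /rho mulrA -kcoefS// mulfK// gt_eqF.
rewrite -mulrA ler_wpM2l ?(ltW (kcoef_gt0 n1 n2 n3 _))//.
rewrite -natr1 (_ : k%:R + 1 + ga = (k%:R + ga) + 1); last ring.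
apply: le_trans (powR_succ_ge (ltW b0) (x0 k)).
rewrite ler_wpM2r ?powR_ge0//.
apply: le_trans (expR_ge1Dx _).
rewrite /rho ler_pdivrMr// -subr_ge0.
rewrite (_ : _ - _ = (k%:R * (be * ga + e - be * (1 + d)) + (e * ga - be * d)) / (k%:R + ga)); last first.
  rewrite /e /be /s /d; field; rewrite gt_eqF//; exact: x0.
rewrite divr_ge0 ?(ltW (x0 k))//.
have h1 : 1 <= be * ga + e - be * (1 + d) by rewrite /ga; lra.
have h2 : - (`|e| * ga) <= e * ga by rewrite -mulNr ler_wpM2r//; lra.
have h3 : k%:R * 1 <= k%:R * (be * ga + e - be * (1 + d)) by rewrite ler_wpM2l.
lra.
Qed.

Lemma kcoef_ge nu sigma : nu < 1 -> 0 < sigma -> sigma < - nu + 1 ->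
  exists2 c : R, 0 < c &
    forall k, c * k.+1%:R `^ (- (sigma + 1 / 2)) <= kcoef nu sigma k.
Proof.
move=> n1 n2 n3; set be := sigma + 1 / 2; set s := 1 - nu - sigma; set d := 1 - nu.
have b0 : 0 < be by rewrite /be; lra.
have s0 : 0 < s by rewrite /s; lra.
have d0 : 0 < d by rewrite /d; lra.
pose e := d - s * (s + 1) / 4.
pose ga := 1 + (`|e| + 1) / be.
have q0 : 0 < (`|e| + 1) / be by rewrite divr_gt0// ltr_wpDl.
have qb : (`|e| + 1) / be * be = `|e| + 1 by rewrite divfK// gt_eqF.
have g1 : 1 <= ga by rewrite /ga; lra.
have eN : e <= `|e| by rewrite ler_norm.
pose k1 := (Num.truncn (ga + `|e| * ga)).+1.
have kbig k : (k1 <= k)%N -> ga + `|e| * ga < k%:R.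
  by move=> kk; apply: (lt_le_trans (truncnS_gt _)); rewrite ler_nat.
have eg : 0 <= `|e| * ga by rewrite mulr_ge0//; lra.
(* A lower bound calls for a shift to the left, and k - ga may be nonpositive for small k. The value
   1 used there still dominates (k + 1)^(-be). *)
pose b k : R := if (k < k1)%N then 1 else (k%:R - ga) `^ (- be).
have bge k : k.+1%:R `^ (- be) <= b k.
  rewrite /b; case: ltnP => kk.
    by rewrite -[leRHS](powRr0 k.+1%:R) ler_powR ?ler1n//; lra.
  have := kbig _ kk => hk.
  rewrite !powRN lef_pV2 ?posrE ?powR_gt0 ?ltr0n//; last lra.
  by rewrite ge0_ler_powR ?(ltW b0)// ?nnegrE ?ler0n// -?natr1; lra.
have bgt0 k : 0 < b k.
  rewrite /b; case: ltnP => // kk; rewrite powR_gt0//.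
  by have := kbig _ kk; lra.
have [|C C0 hC] := @dominated_of_eventually_ratio R b (kcoef nu sigma) k1
  bgt0 (kcoef_gt0 n1 n2 n3); last first.
  exists C^-1; first by rewrite invr_gt0.
  by move=> k; rewrite mulrC ler_pdivrMr// mulrC (le_trans (bge k)).
move=> k kk; have k0 : 0 <= k%:R :> R by [].
have hk := kbig _ kk.
have D0 : 0 < (k%:R + 1) * (k%:R + d) by rewrite mulr_gt0//; lra.
have E0 : 0 < (k%:R + s / 2) * (k%:R + s / 2 + 1 / 2) by rewrite mulr_gt0//; lra.
set rho := ((k%:R + s / 2) * (k%:R + s / 2 + 1 / 2)) / ((k%:R + 1) * (k%:R + d)).
have -> : kcoef nu sigma k.+1 = kcoef nu sigma k * rho.
  by rewrite /rho mulrA -kcoefS// mulfK// gt_eqF.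
rewrite mulrC [leRHS]mulrCA ler_wpM2l ?(ltW (kcoef_gt0 n1 n2 n3 _))// mulrC.
have -> : b k.+1 = ((k%:R - ga) + 1) `^ (- be).
  by rewrite /b ltnNge (leq_trans kk (leqnSn _))/= -natr1; congr (_ `^ _); ring.
have -> : b k = (k%:R - ga) `^ (- be) by rewrite /b ltnNge kk.
have x0 : 0 < k%:R - ga by lra.
apply: le_trans (powR_succ_le (ltW b0) x0) _.
(* Passing to inverses leaves 1 / rho <= 1 + be / (k - ga + 1), again with cancelling quadratic
   terms. *)
rewrite ler_wpM2r ?powR_ge0// expRN -[rho]invrK lef_pV2 ?posrE ?expR_gt0//; last first.
  by rewrite invr_gt0 divr_gt0.
apply: le_trans (expR_ge1Dx _).
rewrite /rho invf_div ler_pdivrMr// -subr_ge0.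
rewrite (_ : _ - _ = (k%:R * (be * (s + 1 / 2) - e + be * (ga - 1)) +
    (be * (s * (s + 1) / 4) + e * (ga - 1))) / (k%:R - ga + 1)); last first.
  rewrite /e /be /s /d; field; rewrite gt_eqF//; lra.
rewrite divr_ge0//; last lra.
have h1 : 1 <= be * (s + 1 / 2) - e + be * (ga - 1).
  have : 0 <= be * (s + 1 / 2) by rewrite mulr_ge0//; lra.
  by rewrite /ga; lra.
have h2 : - (`|e| * ga) <= e * (ga - 1).
  apply: (@le_trans _ _ (- (`|e| * (ga - 1)))); first by have := normr_ge0 e; lra.
  by rewrite -mulNr ler_wpM2r//; [lra|rewrite lerNl -normrN ler_norm].
have h3 : k%:R * 1 <= k%:R * (be * (s + 1 / 2) - e + be * (ga - 1)) by rewrite ler_wpM2l.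
have s10 : 0 <= s + 1 by lra.
have h4 : 0 <= be * (s * (s + 1) / 4) by rewrite !mulr_ge0 ?(ltW b0) ?(ltW s0).
lra.
Qed.

Lemma coshR_norm w : coshR w = coshR `|w|.
Proof.
have [w0|w0] := ger0P w; first by [].
by rewrite /coshR opprK addrC.
Qed.

Lemma coshR_le w : coshR w <= expR `|w|.
Proof.
rewrite coshR_norm /coshR ler_pdivrMr//.
have : expR (- `|w|) <= expR `|w| by rewrite ler_expR; have := normr_ge0 w; lra.
lra.
Qed.

Lemma coshR_ge w : expR `|w| / 2 <= coshR w.
Proof. by rewrite coshR_norm /coshR ler_pM2r// lerDl expR_ge0. Qed.

Lemma coshR_ge1 w : 1 <= coshR w.
Proof. by rewrite /coshR; have := expR_ge1Dx w; have := expR_ge1Dx (- w); lra. Qed.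

Lemma coshR_powRN_ge (a : R) w : 0 <= a -> expR (- (a * `|w|)) <= coshR w `^ (- a).
Proof.
move=> a0; rewrite powRN expRN lef_pV2 ?posrE ?expR_gt0 ?powR_gt0 ?coshR_gt0// mulrC expRM.
by rewrite ge0_ler_powR ?nnegrE ?expR_ge0 ?coshR_le ?(ltW (coshR_gt0 _)).
Qed.

(** The left side is tanh(w)^2. In terms of y = e^(-2|w|) it is controlled by 1 - 2|w| <= y <= 1 /
    (1 + 2|w|), so 1 - r is of order w^2 near 0. *)
Let tanh2E w : 1 - coshR w ^- 2 =
  ((1 - expR (- (2 * `|w|))) / (1 + expR (- (2 * `|w|)))) ^+ 2.
Proof.
rewrite coshR_norm /coshR.
have -> : expR (- (2 * `|w|)) = (expR `|w|)^-1 ^+ 2.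
  by rewrite -expRN -expRM_natl; congr expR; ring.
rewrite expRN; have := expR_gt0 `|w|; move: (expR _) => E E0.
have E2 : 0 < E ^+ 2 by rewrite exprn_gt0.
field; rewrite !gt_eqF//; lra.
Qed.

Lemma one_subV_coshR2_le w : 1 - coshR w ^- 2 <= (2 * `|w|) ^+ 2.
Proof.
rewrite tanh2E; have x0 := normr_ge0 w.
have := expR_ge1Dx (- (2 * `|w|)).
have : expR (- (2 * `|w|)) <= 1 by rewrite expR_le1; lra.
have := expR_gt0 (- (2 * `|w|)).
move: (expR _) => y y0 y1 yx.
rewrite ler_pXn2r ?nnegrE//; last first.
  by rewrite divr_ge0//; lra.
by rewrite ler_pdivrMr; [nra|lra].
Qed.

Lemma one_subV_coshR2_ge w : (`|w| / (1 + 2 * `|w|)) ^+ 2 <= 1 - coshR w ^- 2.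
Proof.
rewrite tanh2E; have x0 := normr_ge0 w.
have x1 : 0 < 1 + 2 * `|w| by lra.
have : expR (- (2 * `|w|)) <= (1 + 2 * `|w|)^-1.
  by rewrite expRN lef_pV2 ?posrE ?expR_gt0// expR_ge1Dx.
have := expR_gt0 (- (2 * `|w|)).
move: (expR _) => y y0 yx.
have y1 : y * (1 + 2 * `|w|) <= 1 by rewrite -ler_pdivlMr// mul1r.
rewrite ler_pXn2r ?nnegrE//; last first.
  by rewrite divr_ge0//; nra.
rewrite ler_pdivrMr// mulrAC ler_pdivlMr; nra.
Qed.

Lemma kprof_ge0 nu sigma w : nu < 1 -> 0 < sigma -> sigma < - nu + 1 -> (0 <= kprof nu sigma w)%E.
Proof.
move=> n1 n2 n3; rewrite mule_ge0 ?lee_fin ?powR_ge0// nneseries_ge0// => k _ _.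
by rewrite lee_fin mulr_ge0 ?(ltW (kcoef_gt0 n1 n2 n3 _))// exprn_ge0// invr_ge0 exprn_ge0// ltW ?coshR_gt0.
Qed.

Lemma measurable_kprof nu sigma : nu < 1 -> 0 < sigma -> sigma < - nu + 1 ->
  measurable_fun [set: R] (kprof nu sigma).
Proof.
move=> n1 n2 n3.
have mc : measurable_fun [set: R] (@coshR R).
  apply: measurable_funM => //; apply: measurable_funD => //.
  by apply: measurableT_comp.
have mcV (p : R) : measurable_fun [set: R] (fun w => coshR w `^ p).
  by apply: (measurableT_comp (measurable_powR p)).
apply: emeasurable_funM; first by apply/measurable_EFinP.
apply: ge0_emeasurable_sum => [k w _ _|k _].
  by rewrite lee_fin mulr_ge0 ?(ltW (kcoef_gt0 n1 n2 n3 _))// exprn_ge0// invr_ge0 exprn_ge0// ltW ?coshR_gt0.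
apply/measurable_EFinP; apply: measurable_funM => //; apply: measurable_funX.
apply: (eq_measurable_fun (fun w => coshR w `^ (- 2%:R))) => // w _.
by rewrite powR_invn// ltW ?coshR_gt0.
Qed.

Lemma kprof_ge_exp nu sigma : nu < 1 -> 0 < sigma -> sigma < - nu + 1 ->
  exists2 c : R, 0 < c &
    forall w, ((c * expR (- ((1 - nu - sigma) * `|w|)))%:E <= kprof nu sigma w)%E.
Proof.
move=> n1 n2 n3; exists (kcoef nu sigma 0); first exact: kcoef_gt0.
move=> w; rewrite mulrC EFinM; apply: lee_pmul; rewrite ?lee_fin ?expR_ge0//.
- exact/ltW/kcoef_gt0.
- by apply: coshR_powRN_ge; lra.
- have := @nneseries_ge_sum R (fun k => kcoef nu sigma k * (coshR w ^- 2) ^+ k) 1%N.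
  rewrite big_ord1 expr0; move: (kcoef nu sigma 0) => k0; rewrite mulr1 => h; rewrite /kprof_series; apply: h => k.
  by rewrite mulr_ge0 ?(ltW (kcoef_gt0 n1 n2 n3 _))// exprn_ge0// invr_ge0 exprn_ge0// ltW ?coshR_gt0.
Qed.

Lemma kterm_ge0 nu sigma r k : nu < 1 -> 0 < sigma -> sigma < - nu + 1 -> 0 <= r ->
  0 <= kcoef nu sigma k * r ^+ k.
Proof.
by move=> n1 n2 n3 r0; rewrite mulr_ge0 ?exprn_ge0// ltW// kcoef_gt0.
Qed.

(** The condition 1 - 2 sigma <= lam is exactly -(sigma + 1/2) <= lam/2 - 1, so for positive [lam]
    the coefficients are dominated by those of [sum_power_geometric_le]. For lam = 0 they have to be
    summable, whence 1 < 2 sigma. *)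
Lemma kprof_series_le nu sigma lam : nu < 1 -> 0 < sigma -> sigma < - nu + 1 ->
  0 <= lam < 1 -> 1 - 2 * sigma <= lam -> 0 < lam \/ 1 < 2 * sigma ->
  exists2 C : R, 0 < C &
    forall r, 0 <= r < 1 -> (kprof_series nu sigma r <= (C * (1 - r) `^ (- (lam / 2)))%:E)%E.
Proof.
move=> n1 n2 n3 /andP[l0 l1] ls lsig.
have [C C0 hC] := kcoef_le n1 n2 n3; set be := sigma + 1 / 2 in hC.
have [lpos|l00] := ltP 0 lam.
  exists (C * (2 / (lam / 2) + 1)).
    by rewrite mulr_gt0// ltr_wpDl// divr_ge0//; lra.
  move=> r /andP[r0 r1].
  apply: nneseries_le_sum => [n|k]; last exact: kterm_ge0.
  apply: (@le_trans _ _ (\sum_(k < n) C * (k.+1%:R `^ (lam / 2 - 1) * r ^+ k))).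
    apply: ler_sum => k _; rewrite mulrA ler_wpM2r ?exprn_ge0// (le_trans (hC k))//.
    by rewrite ler_wpM2l ?(ltW C0)// ler_powR ?ler1n// /be; lra.
  rewrite -mulr_sumr -mulrA ler_wpM2l ?(ltW C0)//.
  by apply: sum_power_geometric_le; rewrite ?r0//; lra.
have -> : lam = 0 by apply/eqP; rewrite eq_le l0 l00.
have s1 : 1 < 2 * sigma by case: lsig => //; lra.
exists (C * (1 + (be - 1)^-1)).
  by rewrite mulr_gt0// ltr_wpDr// invr_ge0 /be; lra.
move=> r /andP[r0 r1]; rewrite mul0r oppr0 powRr0 mulr1.
apply: nneseries_le_sum => [n|k]; last exact: kterm_ge0.
apply: (@le_trans _ _ (\sum_(k < n) C * k.+1%:R `^ (- be))).
  apply: ler_sum => k _; apply: le_trans (hC k).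
  by rewrite ler_piMr ?exprn_ile1 ?(ltW r1)// ltW// kcoef_gt0.
rewrite -mulr_sumr ler_wpM2l ?(ltW C0)//.
by apply: sum_pseries_le; rewrite /be; lra.
Qed.

Lemma inv_cosh2_itv w : w != 0 -> 0 <= coshR w ^- 2 < 1.
Proof.
move=> w0; rewrite invr_ge0 exprn_ge0 ?(ltW (coshR_gt0 _))//=.
rewrite -subr_gt0; apply: lt_le_trans (one_subV_coshR2_ge w).
by rewrite exprn_gt0// divr_gt0 ?normr_gt0//; have := normr_ge0 w; lra.
Qed.

Lemma kprof_le nu sigma lam : nu < 1 -> 0 < sigma -> sigma < - nu + 1 ->
  0 <= lam < 1 -> 1 - 2 * sigma <= lam -> 0 < lam \/ 1 < 2 * sigma ->
  exists2 C : R, 0 < C &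
    forall w, w != 0 -> (kprof nu sigma w <=
      (C * (expR (- ((1 - nu - sigma) * `|w|)) * (1 + `|w| `^ (- lam))))%:E)%E.
Proof.
move=> n1 n2 n3 l01 ls lsig.
have [C C0 hC] := kprof_series_le n1 n2 n3 l01 ls lsig.
move/andP : l01 => [l0 l1].
set s := 1 - nu - sigma; have s0 : 0 < s by rewrite /s; lra.
(* The power of 2 comes from cosh(w) >= e^|w| / 2. The 3 bounds (1 + 2|w|) / |w| for |w| >= 1 and 1
   + 2|w| for |w| < 1. *)
exists (2 `^ s * (C * 3)); first by rewrite mulr_gt0 ?powR_gt0// mulr_gt0.
move=> w w0; have x0 : 0 < `|w| by rewrite normr_gt0.
rewrite (_ : _ * _ = (2 `^ s * expR (- (s * `|w|))) * (C * (3 * (1 + `|w| `^ (- lam))))); last by ring.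
rewrite EFinM; apply: lee_pmul.
- by rewrite lee_fin powR_ge0.
- apply: nneseries_ge0 => k _ _; rewrite lee_fin; apply: kterm_ge0 => //.
  by have /andP[] := inv_cosh2_itv w0.
- have h : expR (s * `|w|) <= 2 `^ s * coshR w `^ s.
    rewrite -powRM ?(ltW (coshR_gt0 _))// mulrC expRM.
    apply: ge0_ler_powR; rewrite ?nnegrE ?expR_ge0 ?mulr_ge0 ?(ltW (coshR_gt0 _)) ?(ltW s0)//.
    by rewrite mulrC -ler_pdivrMr// coshR_ge.
  rewrite lee_fin powRN expRN ler_pdivlMr ?expR_gt0// mulrC.
  by rewrite ler_pdivrMr ?powR_gt0 ?coshR_gt0.
- apply: (le_trans (hC _ (inv_cosh2_itv w0))); rewrite lee_fin ler_wpM2l ?(ltW C0)//.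
  have h := one_subV_coshR2_ge w.
  have x1 : 0 < 1 + 2 * `|w| by lra.
  have y0 : 0 < `|w| / (1 + 2 * `|w|) by rewrite divr_gt0.
  apply: (@le_trans _ _ (((`|w| / (1 + 2 * `|w|)) ^+ 2) `^ (- (lam / 2)))).
    rewrite !powRN lef_pV2 ?posrE ?powR_gt0 ?exprn_gt0//; last first.
      by apply: lt_le_trans h; rewrite exprn_gt0.
    apply: ge0_ler_powR; rewrite ?nnegrE ?exprn_ge0 ?(ltW y0)//; first lra.
    by apply: le_trans h; rewrite exprn_ge0// ltW.
  rewrite -powR_mulrn ?(ltW y0)// -powRrM (_ : _ * - (lam / 2) = - lam); last by field.
  rewrite -gt0_powRV// invf_div.
  have [w1|w1] := leP 1 `|w|.
    rewrite [leRHS]mulrDr mulr1; apply: ler_wpDr; first by rewrite mulr_ge0 ?powR_ge0.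
    apply: (@le_trans _ _ (3 `^ lam)).
      apply: ge0_ler_powR => //; rewrite ?nnegrE ?divr_ge0 ?(ltW x1) ?(ltW x0)//.
      by rewrite ler_pdivrMr//; lra.
    by apply: ler1_powR; lra.
  rewrite [leRHS]mulrDr mulr1; apply: ler_wpDl => //.
  apply: (@le_trans _ _ ((3 * `|w|^-1) `^ lam)).
    apply: ge0_ler_powR; rewrite ?nnegrE ?divr_ge0 ?mulr_ge0 ?invr_ge0 ?(ltW x1) ?(ltW x0)//.
    by rewrite ler_pM2r ?invr_gt0//; lra.
  rewrite powRM ?invr_ge0 ?(ltW x0)// gt0_powRV// ler_wpM2r ?powR_ge0//.
  by apply: ler1_powR; lra.
Qed.

Lemma kprof_ge nu sigma : nu < 1 -> 0 < sigma -> sigma < - nu + 1 ->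
  exists2 c : R, 0 < c & forall w n, `|w| <= 1 ->
    ((c * \sum_(k < n) (k.+1%:R `^ (- (sigma + 1 / 2)) * (coshR w ^- 2) ^+ k))%:E
      <= kprof nu sigma w)%E.
Proof.
move=> n1 n2 n3; have [c c0 hc] := kcoef_ge n1 n2 n3; set be := sigma + 1 / 2 in hc *.
set s := 1 - nu - sigma; have s0 : 0 < s by rewrite /s; lra.
exists (expR (- s) * c); first by rewrite mulr_gt0 ?expR_gt0.
move=> w n w1; have r0 k : 0 <= (coshR w ^- 2) ^+ k.
  by rewrite exprn_ge0// invr_ge0 exprn_ge0// ltW ?coshR_gt0.
rewrite -mulrA EFinM; apply: lee_pmul; rewrite ?lee_fin ?expR_ge0//.
- by rewrite mulr_ge0 ?(ltW c0)// sumr_ge0// => k _; rewrite mulr_ge0 ?powR_ge0.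
- apply: le_trans (coshR_powRN_ge w (ltW s0)).
  by rewrite ler_expR lerN2 ler_piMr// ltW.
apply: le_trans (nneseries_ge_sum n _); last first.
  by move=> k; rewrite mulr_ge0// ltW// kcoef_gt0.
by rewrite lee_fin mulr_sumr; apply: ler_sum => k _; rewrite mulrA ler_wpM2r.
Qed.

(** The partial sums reach a multiple of (1 - r)^(sigma - 1/2). This exponent is negative, so the
    upper bound 1 - r <= (2|w|)^2 turns into a lower bound. *)
Lemma kprof_ge_pow nu sigma : nu < 1 -> 0 < sigma -> sigma < - nu + 1 ->
  sigma < 1 / 2 ->
  exists2 c : R, 0 < c &
    forall w, w != 0 -> `|w| <= 1 ->
      ((c * `|w| `^ (2 * sigma - 1))%:E <= kprof nu sigma w)%E.
Proof.
move=> n1 n2 n3 s2; have [c c0 hc] := kprof_ge n1 n2 n3; set be := sigma + 1 / 2 in hc.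
pose c1 := (8 * 2 `^ be)^-1; have c10 : 0 < c1 by rewrite invr_gt0 mulr_gt0// powR_gt0.
exists (c * (c1 * 2 `^ (2 * sigma - 1))).
  by rewrite mulr_gt0// mulr_gt0// powR_gt0.
move=> w w0 w1; have x0 : 0 < `|w| by rewrite normr_gt0.
have r01 := inv_cosh2_itv w0; have /andP[r0 r1] := r01.
have be0 : 0 <= be by rewrite /be; lra.
have [n hn] := sum_power_geometric_ge be0 r01.
apply: le_trans (hc w n w1); rewrite lee_fin -mulrA ler_wpM2l ?(ltW c0)//.
apply: le_trans hn; rewrite -mulrA -/c1 ler_wpM2l ?(ltW c10)// -powRM//.
rewrite (_ : be - 1 = sigma - 1 / 2); last by rewrite /be; field.
rewrite (_ : 2 * sigma - 1 = 2%:R * (sigma - 1 / 2)); last by field.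
rewrite powRrM powR_mulrn ?mulr_ge0//.
rewrite -!(opprB (1 / 2) sigma) !powRN lef_pV2 ?posrE ?powR_gt0 ?subr_gt0 ?exprn_gt0 ?mulr_gt0//.
apply: ge0_ler_powR; rewrite ?nnegrE ?exprn_ge0 ?mulr_ge0 ?subr_ge0 ?(ltW r1)//; first lra.
exact: one_subV_coshR2_le.
Qed.

Lemma kprof_unbounded nu sigma : nu < 1 -> 0 < sigma -> sigma < - nu + 1 ->
  sigma = 1 / 2 ->
  forall M : R, exists2 d : R, 0 < d & forall w, `|w| <= d -> (M%:E <= kprof nu sigma w)%E.
Proof.
move=> n1 n2 n3 s2 M; have [c c0 hc] := kprof_ge n1 n2 n3.
have [d d0 hd] := @sum_harmonic_geometric_ge R (M / c).
(* With m = min(1, d) and |w| <= m / 4, one has (2|w|)^2 <= m^2 / 4 <= d. *)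
exists (Num.min 1 (Num.min 1 d / 4)).
  by rewrite lt_min ltr01 divr_gt0// lt_min ltr01.
move=> w; rewrite le_min => /andP[w1 wd]; have x0 := normr_ge0 w.
have r0 : 0 <= coshR w ^- 2 by rewrite invr_ge0 exprn_ge0 ?(ltW (coshR_gt0 _)).
have r1 : coshR w ^- 2 <= 1.
  by rewrite invf_le1 ?exprn_gt0 ?coshR_gt0// exprn_ege1// coshR_ge1.
have rd : 1 - coshR w ^- 2 <= d.
  apply: (le_trans (one_subV_coshR2_le w)).
  have m1 : Num.min 1 d <= 1 by rewrite ge_min lexx.
  have m2 : Num.min 1 d <= d by rewrite ge_min lexx orbT.
  move: (Num.min 1 d) wd m1 m2 => m wd m1 m2; nra.
have [n hn] := hd _ (introT andP (conj r0 r1)) rd.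
apply: le_trans (hc w n w1); rewrite lee_fin mulrC -ler_pdivrMr//.
by rewrite s2 (_ : 1 / 2 + 1 / 2 = 1)//; field.
Qed.

End kernel_bounds.

(** * Convolution inequalities on the line *)

Section real_convolution.
Context {R : realType}.
Local Open Scope ereal_scope.
Local Notation mu := (@lebesgue_measure R).

Lemma measurable_expRM (a : R) : measurable_fun [set: R] (fun x => expR (a * x)).
Proof. by apply: measurableT_comp => //; exact: measurable_funM. Qed.

Lemma measurable_natr_bool d (T : measurableType d) (f : T -> bool) :
  measurable_fun [set: T] f -> measurable_fun [set: T] (fun x => (f x)%:R : R).
Proof.
move=> mf; rewrite (_ : (fun _ => _) = (fun x => if f x then 1 else 0)%R).
  exact: measurable_fun_ifT.
by apply/funext => x; case: (f x).
Qed.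

Lemma ge0_integral_even (g : R -> \bar R) :
  measurable_fun [set: R] g -> (forall x, 0 <= g x) ->
  \int[mu]_x g `|x|%R = 2%:E * \int[mu]_(x in Rpos) g x.
Proof.
move=> mg g0.
have mR := @measurable_Rpos R.
have mgn : measurable_fun [set: R] (fun x => g `|x|%R).
  by apply: measurableT_comp.
have h (D : set R) : measurable D -> \int[mu]_(x in D) g `|x|%R = \int[mu]_x ((fun x => g `|x|%R) \_ D) x.
  by move=> _; rewrite integral_mkcond.
rewrite -(setUv Rpos) ge0_integral_setU//=; last 3 first.
- exact: measurableC.
- by rewrite setUv.
- exact/disj_setPCl.
have -> : 2%:E = 1 + 1 :> \bar R by rewrite -EFinD; congr EFin; ring.
rewrite ge0_muleDl// !mul1e; congr (_ + _).
  apply: eq_integral => x; rewrite inE RposE => x0; rewrite gtr0_norm//.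
have -> : ~` Rpos = `]-oo, 0%R]%classic :> set R.
  by rewrite /Rpos -setCitvl setCK.
rewrite -integral_itv_bndo_bndc; last exact: measurable_funTS.
rewrite integral_mkcond/= -ge0_integral_reflect; last 2 first.
- apply/(measurable_restrictT _ _).1 => //; exact: measurable_funTS.
- by move=> x; apply: erestrict_ge0.
rewrite [RHS]integral_mkcond/=; apply: eq_integral => x _.
rewrite !patchE normrN.
have -> : (- x \in `]-oo, 0%R[%classic)%R = (x \in Rpos).
  by apply/idP/idP; rewrite !inE RposE /= in_itv/= oppr_lt0.
by case: ifPn => //; rewrite inE RposE => x0; rewrite gtr0_norm.
Qed.

Lemma integral_powR_ball (a d : R) : (0 < d)%R -> (a < 1)%R ->
  \int[mu]_w (`|w| `^ (- a) * (`|w| < d)%R%:R)%:E = (2 * d `^ (1 - a) / (1 - a))%:E.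
Proof.
move=> d0 a1.
have mind : measurable_fun [set: R] (fun x : R => (x < d)%R%:R : R).
  by apply: measurable_natr_bool; exact: measurable_fun_ltr.
rewrite (@ge0_integral_even (fun w => (w `^ (- a) * (w < d)%R%:R)%:E)); last 2 first.
- by apply/measurable_EFinP; apply: measurable_funM => //; exact: measurable_powR.
- by move=> x; rewrite lee_fin mulr_ge0 ?powR_ge0.
rewrite eta_half_lebesgue; last 2 first.
- by apply/measurable_EFinP/measurable_funTS; apply: measurable_funM.
- by move=> x _; rewrite lee_fin mulr_ge0 ?powR_ge0.
have -> : \int[mu]_u ((expR u `^ (- a) * (expR u < d)%R%:R)%:E * (expR u)%:E) =
    \int[mu]_(u in `]-oo, ln d]) (expR ((1 - a) * u))%:E.
  rewrite -integral_itv_bndo_bndc; last first.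
    apply/measurable_EFinP/measurable_funTS; apply: measurableT_comp => //.
  rewrite [RHS]integral_mkcond epatch_indic; apply: eq_integral => u _.
  rewrite -!EFinM; congr EFin; rewrite mulrAC -expRM -expRD indicE; congr (expR _ * _%:R)%R.
    by ring.
  by rewrite mem_setE in_itv/= -[in RHS]ltr_expR lnK.
rewrite integral_expR_ray ?subr_gt0// -EFinM mulrC (mulrC (1 - a)%R) expRM lnK//.
by congr EFin; ring.
Qed.

Lemma integral_powR_coball (a d : R) : (0 < d)%R -> (1 < a)%R ->
  \int[mu]_w (`|w| `^ (- a) * (d <= `|w|)%R%:R)%:E = (2 * d `^ (1 - a) / (a - 1))%:E.
Proof.
move=> d0 a1.
have mind : measurable_fun [set: R] (fun x : R => (d <= x)%R%:R : R).
  by apply: measurable_natr_bool; exact: measurable_fun_ler.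
rewrite (@ge0_integral_even (fun w => (w `^ (- a) * (d <= w)%R%:R)%:E)); last 2 first.
- by apply/measurable_EFinP; apply: measurable_funM => //; exact: measurable_powR.
- by move=> x; rewrite lee_fin mulr_ge0 ?powR_ge0.
rewrite eta_half_lebesgue; last 2 first.
- by apply/measurable_EFinP/measurable_funTS; apply: measurable_funM.
- by move=> x _; rewrite lee_fin mulr_ge0 ?powR_ge0.
have -> : \int[mu]_u ((expR u `^ (- a) * (d <= expR u)%R%:R)%:E * (expR u)%:E) =
    \int[mu]_(u in `[ln d, +oo[) (expR (- ((a - 1) * u)))%:E.
  rewrite [RHS]integral_mkcond epatch_indic; apply: eq_integral => u _.
  rewrite -!EFinM; congr EFin; rewrite mulrAC -expRM -expRD indicE; congr (expR _ * _%:R)%R.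
    by ring.
  by rewrite mem_setE in_itv/= andbT -[in RHS]ler_expR lnK.
rewrite integral_expRN_ray ?subr_gt0// -EFinM -mulNr (mulrC (- _)%R) expRM lnK//.
by rewrite opprB; congr EFin; rewrite mulrA.
Qed.

Implicit Types (K F : R -> R) (p q u v : R).

Definition convol K F u : \bar R := \int[mu]_v (K (u - v) * F v)%:E.

Lemma measurable_conv_kernel K F :
  measurable_fun [set: R] K -> measurable_fun [set: R] F ->
  measurable_fun [set: R * R] (fun z : R * R => (K (z.1 - z.2) * F z.2)%:E).
Proof.
move=> mK mF; apply/measurable_EFinP; apply: measurable_funM.
  by apply: (measurableT_comp mK); exact: measurable_funB.
exact: measurableT_comp.
Qed.

Lemma measurable_conv_slice K F u :
  measurable_fun [set: R] K -> measurable_fun [set: R] F ->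
  measurable_fun [set: R] (fun v => (K (u - v) * F v)%:E).
Proof.
move=> mK mF; apply/measurable_EFinP; apply: measurable_funM => //.
by apply: (measurableT_comp mK); exact: measurable_funB.
Qed.

Lemma measurable_convol K F :
  measurable_fun [set: R] K -> measurable_fun [set: R] F ->
  (forall x, (0 <= K x)%R) -> (forall x, (0 <= F x)%R) ->
  measurable_fun [set: R] (convol K F).
Proof.
move=> mK mF K0 F0.
apply: (measurable_fun_fubini_tonelli_F (m2 := mu) _ (measurable_conv_kernel mK mF)).
by move=> z; rewrite lee_fin mulr_ge0.
Qed.

Lemma integral_convol K F :
  measurable_fun [set: R] K -> measurable_fun [set: R] F ->
  (forall x, (0 <= K x)%R) -> (forall x, (0 <= F x)%R) ->
  \int[mu]_u convol K F u = (\int[mu]_x (K x)%:E) * (\int[mu]_x (F x)%:E).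
Proof.
move=> mK mF K0 F0; rewrite /convol.
rewrite (fubini_tonelli (m1 := mu) (m2 := mu) _ (measurable_conv_kernel mK mF)); last first.
  by move=> z; rewrite lee_fin mulr_ge0.
rewrite -ge0_integralZl; last 4 first.
- exact: measurableT.
- exact/measurable_EFinP.
- by move=> x _; rewrite lee_fin.
- by apply: integral_ge0 => x _; rewrite lee_fin.
apply: eq_integral => v _ /=.
under eq_integral do rewrite mulrC EFinM.
rewrite ge0_integralZl//=; last 3 first.
- apply/measurable_EFinP; apply: (measurableT_comp mK).
  exact: measurable_funB.
- by move=> x _; rewrite lee_fin.
- by rewrite lee_fin.
rewrite muleC; congr (_ * _).
rewrite (ge0_integral_shift (g := fun x => (K x)%:E) (- v)%R)//.
exact/measurable_EFinP.
Qed.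

Lemma Lnorm_EFin d (T : measurableType d) (m : {measure set T -> \bar R})
    (p : R) (f : T -> R) :
  'N[m]_p%:E[EFin \o f] = (\int[m]_x (`|f x| `^ p)%:E) `^ p^-1.
Proof. by rewrite unlock. Qed.

Lemma hoelder_ge0 d (T : measurableType d) (m : {measure set T -> \bar R})
    (f g : T -> R) (p q : R) :
  measurable_fun [set: T] f -> measurable_fun [set: T] g ->
  (forall x, (0 <= f x)%R) -> (forall x, (0 <= g x)%R) ->
  (0 < p)%R -> (0 < q)%R -> (p^-1 + q^-1 = 1)%R ->
  \int[m]_x (f x * g x)%:E <=
  (\int[m]_x (f x `^ p)%:E) `^ p^-1 * (\int[m]_x (g x `^ q)%:E) `^ q^-1.
Proof.
move=> mf mg f0 g0 p0 q0 pq.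
have := hoelder m mf mg p0 q0 pq.
rewrite Lnorm1 !Lnorm_EFin.
under eq_integral => x _ do rewrite /= ger0_norm ?mulr_ge0//.
under [in X in _ <= X * _ -> _]eq_integral => x _ do rewrite ger0_norm//.
under [in X in _ <= _ * X -> _]eq_integral => x _ do rewrite ger0_norm//.
by [].
Qed.

(* Jensen's inequality for the measure of density [w] *)
Lemma jensen_weighted d (T : measurableType d) (m : {measure set T -> \bar R})
    (g w : T -> R) (q : R) :
  measurable_fun [set: T] g -> measurable_fun [set: T] w ->
  (forall x, (0 <= g x)%R) -> (forall x, (0 <= w x)%R) -> (1 <= q)%R ->
  (\int[m]_x (g x * w x)%:E) `^ q <=
  (\int[m]_x (w x)%:E) `^ (q - 1) * \int[m]_x (g x `^ q * w x)%:E.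
Proof.
move=> mg mw g0 w0; rewrite le_eqVlt => /orP[/eqP <-|q1].
  rewrite subrr poweRe0 mul1e poweRe1; last first.
    by apply: integral_ge0 => x _; rewrite lee_fin mulr_ge0.
  by under [leRHS]eq_integral => x _ do rewrite powRr1//.
have q0 : (0 < q)%R by lra.
pose q' := (q / (q - 1))%R.
have q'0 : (0 < q')%R by rewrite divr_gt0//; lra.
have qq : (q^-1 + q'^-1 = 1)%R by rewrite /q'; field; rewrite !gt_eqF//; lra.
(* Hoelder's inequality with the density split as w^(1/q) w^(1/q'). *)
have := @hoelder_ge0 _ _ m (fun x => g x * w x `^ q^-1)%R (fun x => w x `^ q'^-1)%R q q'.
have -> : \int[m]_x ((g x * w x `^ q^-1) * w x `^ q'^-1)%:E = \int[m]_x (g x * w x)%:E.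
  apply: eq_integral => x _; rewrite -mulrA -powRD ?qq ?oner_eq0// powRr1//.
have -> : \int[m]_x ((g x * w x `^ q^-1) `^ q)%:E = \int[m]_x (g x `^ q * w x)%:E.
  apply: eq_integral => x _; rewrite powRM ?powR_ge0// -powRrM mulVf ?gt_eqF// powRr1//.
have -> : \int[m]_x ((w x `^ q'^-1) `^ q')%:E = \int[m]_x (w x)%:E.
  by apply: eq_integral => x _; rewrite -powRrM mulVf ?gt_eqF// powRr1.
have mwp (a : R) : measurable_fun [set: T] (fun x => w x `^ a)%R.
  exact: (measurableT_comp (measurable_powR a)).
move=> /(_ (measurable_funM mg (mwp _)) (mwp _)).
have h1 x : (0 <= g x * w x `^ q^-1)%R by rewrite mulr_ge0 ?powR_ge0.
have h2 x : (0 <= w x `^ q'^-1)%R by rewrite powR_ge0.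
move=> /(_ h1 h2 q0 q'0 qq) h.
have I0 : 0 <= \int[m]_x (g x * w x)%:E by apply: integral_ge0 => x _; rewrite lee_fin mulr_ge0.
have J0 : 0 <= \int[m]_x (g x `^ q * w x)%:E.
  by apply: integral_ge0 => x _; rewrite lee_fin mulr_ge0 ?powR_ge0.
have W0 : 0 <= \int[m]_x (w x)%:E by apply: integral_ge0 => x _; rewrite lee_fin.
have := gt0_ler_poweR (ltW q0).
move=> /(_ _ _ _ _ h); rewrite !in_itv/= !leey !andbT I0 mule_ge0 ?poweR_ge0// => /(_ isT isT) {}h.
apply: (le_trans h); rewrite poweRM ?poweR_ge0// -!poweRrM mulVf ?gt_eqF// poweRe1// muleC.
rewrite (_ : q'^-1 * q = q - 1)%R// /q'; field; rewrite !gt_eqF//; lra.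
Qed.

(** Jensen for the measure K(u - v) dv, whose total mass does not depend on u, followed by
    Tonelli. *)
Lemma conv_schur K F q :
  measurable_fun [set: R] K -> measurable_fun [set: R] F ->
  (forall x, (0 <= K x)%R) -> (forall x, (0 <= F x)%R) -> (1 <= q)%R ->
  \int[mu]_u (convol K F u `^ q) <=
  (\int[mu]_x (K x)%:E) `^ q * \int[mu]_x (F x `^ q)%:E.
Proof.
move=> mK mF K0 F0 q1; have q0 : (0 < q)%R by lra.
have mFq : measurable_fun [set: R] (fun x => F x `^ q)%R.
  exact: (measurableT_comp (measurable_powR q)).
have IK0 : 0 <= \int[mu]_x (K x)%:E by apply: integral_ge0 => x _; rewrite lee_fin.
apply: (@le_trans _ _ (\int[mu]_u ((\int[mu]_x (K x)%:E) `^ (q - 1) *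
    convol K (fun x => F x `^ q)%R u))).
  apply: ge0_le_integral => //.
  - by move=> u _; exact: poweR_ge0.
  - by apply: (measurableT_comp (measurable_poweR q)); exact: measurable_convol.
  - apply: emeasurable_funM => //; apply: measurable_convol => // x; exact: powR_ge0.
  - move=> u _; rewrite /convol.
    have -> : \int[mu]_x (K x)%:E = \int[mu]_v (K (u - v)%R)%:E.
      by rewrite (ge0_integral_subl (g := fun x => (K x)%:E))//; exact/measurable_EFinP.
    have := @jensen_weighted _ _ mu F (fun v : R => K ((u : R) - v)%R) q mF.
    under eq_integral do rewrite mulrC.
    under [in X in _ -> _ <= _ * X]eq_integral do rewrite mulrC.
    apply => //; apply: (measurableT_comp mK); exact: measurable_funB.
rewrite ge0_integralZl//; last 3 first.
- apply: measurable_convol => // x; exact: powR_ge0.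
- by move=> u _; apply: integral_ge0 => v _; rewrite lee_fin mulr_ge0 ?powR_ge0.
- exact: poweR_ge0.
rewrite integral_convol//; last by move=> x; exact: powR_ge0.
rewrite muleA (_ : (_ `^ (q - 1) * _) = (\int[mu]_x (K x)%:E) `^ q)//.
rewrite -[X in _ * X = _]poweRe1// -poweRD ?subrK//.
rewrite poweRD_defE subrK; apply/implyP => /eqP; lra.
Qed.

Lemma convolC K F u :
  measurable_fun [set: R] K -> measurable_fun [set: R] F ->
  (forall x, (0 <= K x)%R) -> (forall x, (0 <= F x)%R) -> convol K F u = convol F K u.
Proof.
move=> mK mF K0 F0; rewrite /convol -(ge0_integral_subl (g := fun w => (F (u - w) * K w)%:E) u).
- by apply: eq_integral => v _; rewrite subKr mulrC.
- exact: measurable_conv_slice.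
- by move=> w; rewrite lee_fin mulr_ge0.
Qed.

(** Convolution is symmetric, so this is [conv_schur] with the integrable function in the role of
    the kernel. *)
Lemma conv_L1 K F q :
  measurable_fun [set: R] K -> measurable_fun [set: R] F ->
  (forall x, (0 <= K x)%R) -> (forall x, (0 <= F x)%R) -> (1 <= q)%R ->
  \int[mu]_u (convol K F u `^ q) <=
  (\int[mu]_x (F x)%:E) `^ q * \int[mu]_x (K x `^ q)%:E.
Proof.
move=> mK mF K0 F0 q1; under eq_integral do rewrite convolC//.
exact: conv_schur.
Qed.

Lemma integral_scale (c : R) (g : R -> R) : (0 <= c)%R ->
  measurable_fun [set: R] g -> (forall x, (0 <= g x)%R) ->
  \int[mu]_x (c%:E * (g x)%:E) = c%:E * \int[mu]_x (g x)%:E.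
Proof.
move=> c0 mg g0; rewrite ge0_integralZl//.
- exact/measurable_EFinP.
- by move=> x _; rewrite lee_fin.
Qed.

Lemma conv_hoelder K F p p' u :
  measurable_fun [set: R] K -> measurable_fun [set: R] F ->
  (forall x, (0 <= K x)%R) -> (forall x, (0 <= F x)%R) ->
  (0 < p)%R -> (0 < p')%R -> (p'^-1 + p^-1 = 1)%R ->
  convol K F u <= (\int[mu]_x (K x `^ p')%:E) `^ p'^-1 *
                (\int[mu]_x (F x `^ p)%:E) `^ p^-1.
Proof.
move=> mK mF K0 F0 p0 p'0 pp.
rewrite -(ge0_integral_subl (g := fun x => (K x `^ p')%:E) u); last 2 first.
- by apply/measurable_EFinP; exact: (measurableT_comp (measurable_powR p')).
- by move=> x; rewrite lee_fin powR_ge0.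
apply: (@hoelder_ge0 _ _ mu (fun v : R => K (u - v)%R) F p' p) => //.
by apply: (measurableT_comp mK); exact: measurable_funB.
Qed.

(** * The Hardy-Littlewood-Sobolev inequality *)

Section hls.
Variables (p q : R).
Hypotheses (p1 : (1 < p)%R) (pq : (p < q)%R).
Let lam : R := (1 - p^-1 + q^-1)%R.
Let p' : R := (p / (p - 1))%R.
(** [c1] is the integral of |w|^(-lam) over the unit ball. [A] is chosen so that Hoelder outside the
    ball of radius (A / t)^q gives exactly t / 4, and [B] so that the threshold [hh t] equals
    t^(q/p) / B. The exponent [a] is what |w|^(-lam) becomes after multiplication by |w|^(-(q -
    1)/q). *)
Let c1 : R := (2 / (1 - lam))%R.
Let A : R := (4 * (2 / (lam * p' - 1)) `^ p'^-1)%R.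
Let B : R := (4 * c1 * A `^ (q * (1 - lam)))%R.
Let a : R := (lam + (q - 1) / q)%R.

Let p0 : (0 < p)%R. Proof. by have := p1; lra. Qed.
Let q0 : (0 < q)%R. Proof. by have := p0; have := pq; lra. Qed.
Let ip : (0 < p^-1)%R. Proof. by rewrite invr_gt0. Qed.
Let iq : (0 < q^-1)%R. Proof. by rewrite invr_gt0. Qed.
Let ip1 : (p^-1 < 1)%R. Proof. by rewrite invf_lt1. Qed.
Let iqp : (q^-1 < p^-1)%R. Proof. by rewrite ltf_pV2 ?posrE. Qed.
Let lam0 : (0 < lam)%R.
Proof. by rewrite /lam; have := ip1; have := iq; lra. Qed.
Let lam1 : (lam < 1)%R.
Proof. by rewrite /lam; have := iqp; lra. Qed.
Let p'0 : (0 < p')%R. Proof. by rewrite divr_gt0//; have := p1; lra. Qed.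
Let ip' : (p'^-1 = 1 - p^-1)%R.
Proof. by rewrite /p'; field; rewrite !gt_eqF//; have := p1; lra. Qed.
Let lp' : (1 < lam * p')%R.
Proof.
rewrite -ltr_pdivrMr// mul1r ip' /lam; have := iq; lra.
Qed.
Let c10 : (0 < c1)%R. Proof. by rewrite divr_gt0// subr_gt0. Qed.
Let A0 : (0 < A)%R.
Proof. by rewrite mulr_gt0// powR_gt0// divr_gt0// subr_gt0. Qed.
Let B0 : (0 < B)%R.
Proof. by apply: mulr_gt0; [exact: mulr_gt0|exact: powR_gt0]. Qed.
Let a1 : (1 < a)%R.
Proof.
rewrite /a /lam mulrBl divff ?gt_eqF// mul1r.
by have := ip1; lra.
Qed.

Let K (w : R) : R := `|w| `^ (- lam).

Let mK : measurable_fun [set: R] K.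
Proof. by apply: (measurableT_comp (measurable_powR _)). Qed.

Let mlt (d : R) : measurable_fun [set: R] (fun w : R => (`|w| < d)%R%:R : R).
Proof. by apply: measurable_natr_bool; apply: measurable_fun_ltr. Qed.

Let mle (d : R) : measurable_fun [set: R] (fun w : R => (d <= `|w|)%R%:R : R).
Proof. by apply: measurable_natr_bool; apply: measurable_fun_ler. Qed.

(* For [t = (K * F)(u)], Hoelder bounds by [t / 4] the contribution of the [v]
   with [|u - v| >= (A / t)^q]; on the remaining ball, the values of [F] below
   [hh t] contribute another [t / 4]. So [t^q] is at most twice [t^(q - 1)] times
   the rest, whose integrand is dominated by [m (u - v) (F v)]; and
   [\int m(w, f) dw] is a multiple of [f^p]. *)
Let m (w f : R) : R :=
  (f * (B * f) `^ (p * (q - 1) / q) * (`|w| `^ (- lam) * (`|w| < f `^ (- p))%R%:R) +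
   f * A `^ (q - 1) * (`|w| `^ (- a) * (f `^ (- p) <= `|w|)%R%:R))%R.

Let m_ge0 w f : (0 <= f)%R -> (0 <= m w f)%R.
Proof. by move=> f0; rewrite addr_ge0// !mulr_ge0 ?powR_ge0. Qed.

Let conv_far F t u : measurable_fun [set: R] F -> (forall x, (0 <= F x)%R) ->
  (0 < t)%R -> \int[mu]_x (F x `^ p)%:E <= 1 ->
  convol (fun w => K w * ((A / t) `^ q <= `|w|)%R%:R)%R F u <= (t / 4)%:E.
Proof.
move=> mF F0 t0 F1; set dl := ((A / t) `^ q)%R.
have dl0 : (0 < dl)%R by rewrite powR_gt0 ?divr_gt0.
apply: le_trans (@conv_hoelder _ F p p' u _ mF _ F0 p0 p'0 _) _.
- exact: measurable_funM.
- by move=> w; rewrite mulr_ge0 ?powR_ge0.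
- by rewrite ip'; ring.
have -> : \int[mu]_x ((K x * (dl <= `|x|)%R%:R) `^ p')%:E =
    (2 * dl `^ (1 - lam * p') / (lam * p' - 1))%:E.
  rewrite -integral_powR_coball//; apply: eq_integral => x _; congr EFin.
  rewrite powRM ?powR_ge0// -powRrM mulNr; congr (_ * _)%R.
  by case: (dl <= `|x|)%R; rewrite ?powR1// powR0// gt_eqF.
have -> : (t / 4 = (2 * dl `^ (1 - lam * p') / (lam * p' - 1)) `^ p'^-1 * 1)%R.
  have d1 : (0 < lam * p' - 1)%R by rewrite subr_gt0.
  rewrite mulrAC powRM ?powR_ge0 ?divr_ge0 ?(ltW d1)// -powRrM /dl -powRrM.
  rewrite (_ : q * ((1 - lam * p') * p'^-1) = - 1)%R; last first.
    rewrite mulrBl mulfK ?gt_eqF// mul1r ip' /lam; field; rewrite !gt_eqF//.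
  rewrite powR_inv1 ?divr_ge0 ?(ltW A0) ?(ltW t0)// /A.
  have : (0 < (2 / (lam * p' - 1)) `^ p'^-1)%R by rewrite powR_gt0// divr_gt0.
  set c := (_ `^ p'^-1)%R => c0; field; rewrite !gt_eqF//.
rewrite [leRHS]EFinM poweR_EFin; apply: lee_wpmul2l; first by rewrite lee_fin powR_ge0.
apply: (@le_trans _ _ (1 `^ p^-1)); last by rewrite poweR1r.
apply: gt0_ler_poweR; rewrite ?in_itv/= ?leey ?lee01 ?invr_ge0 ?(ltW p0)//.
by rewrite andbT integral_ge0// => x _; rewrite lee_fin powR_ge0.
Qed.

Let integral_near t : (0 < t)%R ->
  \int[mu]_w (K w * (`|w| < (A / t) `^ q)%R%:R)%:E =
  (c1 * (A / t) `^ (q * (1 - lam)))%:E.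
Proof.
move=> t0; rewrite integral_powR_ball ?powR_gt0 ?divr_gt0// /c1 powRrM.
by congr EFin; rewrite mulrAC.
Qed.

Let hh (t : R) : R := (t / 4 / (c1 * (A / t) `^ (q * (1 - lam))))%R.

(** Where the left side is nonzero, |w| < (A / t)^q bounds t^(q - 1) by A^(q - 1) |w|^(-(q - 1)/q),
    and f > [hh t] bounds it by (B f)^(p (q - 1)/q). Up to constants the two balance at |w| =
    f^(-p), where [m] switches from the second to the first; this makes both pieces integrable in
    w. *)
Let rest_le t w f : (0 < t)%R -> (0 <= f)%R ->
  (t `^ (q - 1) * (K w * (`|w| < (A / t) `^ q)%R%:R * (f * (hh t < f)%R%:R)) <= m w f)%R.
Proof.
move=> t0 f0.
(* Zero raised to a nonzero power is 0, so the kernel vanishes at w = 0. *)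
have [->|w0] := eqVneq w 0%R.
  by rewrite /K normr0 powR0 ?oppr_eq0 ?gt_eqF// !mul0r mulr0 m_ge0.
case: ltrP => hw; last by rewrite mulr0 mul0r mulr0 m_ge0.
case: ltrP => hf; last by rewrite !mulr0 m_ge0.
have w1 : (0 < `|w|)%R by rewrite normr_gt0.
rewrite !mulr1.
have h0 : (0 <= hh t)%R.
  by rewrite divr_ge0 ?divr_ge0 ?(ltW t0)// mulr_ge0 ?powR_ge0// ltW.
have f1 : (0 < f)%R by exact: le_lt_trans hf.
have q10 : (0 <= q - 1)%R by have := p1; have := pq; lra.
have lq : (q * (1 - lam) = q / p - 1)%R.
  by rewrite /lam; field; rewrite !gt_eqF.
have t1 : (t `^ (q - 1) <= A `^ (q - 1) * `|w| `^ (- ((q - 1) / q)))%R.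
  have -> : (- ((q - 1) / q) = (- q^-1) * (q - 1))%R by ring.
  rewrite powRrM -powRM ?powR_ge0 ?(ltW A0)//.
  rewrite ge0_ler_powR ?nnegrE ?(ltW t0) ?mulr_ge0 ?powR_ge0 ?(ltW A0)//.
  rewrite powRN ler_pdivlMr ?powR_gt0// mulrC -ler_pdivlMr//.
  have -> : (A / t = ((A / t) `^ q) `^ q^-1)%R.
    by rewrite -powRrM divff ?gt_eqF// powRr1// divr_ge0 ?(ltW A0) ?(ltW t0).
  by rewrite ge0_ler_powR ?nnegrE ?powR_ge0 ?(ltW iq) ?(ltW hw).
have t2 : (t `^ (q - 1) <= (B * f) `^ (p * (q - 1) / q))%R.
  have -> : (p * (q - 1) / q = (p / q) * (q - 1))%R by ring.
  rewrite powRrM ge0_ler_powR ?nnegrE ?(ltW t0) ?powR_ge0//.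
  rewrite [leLHS](_ : t = (t `^ (q / p)) `^ (p / q))%R; last first.
    rewrite -powRrM (_ : q / p * (p / q) = 1)%R ?powRr1 ?(ltW t0)//.
    by field; rewrite !gt_eqF.
  suff tBf : (t `^ (q / p) <= B * f)%R.
    apply: ge0_ler_powR; rewrite ?nnegrE ?powR_ge0//.
      by rewrite divr_ge0 ?(ltW p0) ?(ltW q0).
    by rewrite mulr_ge0// ltW.
  suff : (t `^ (q / p) / B <= f)%R by rewrite ler_pdivrMr// (mulrC f).
  apply: le_trans (ltW hf).
  rewrite /hh /B lq powRM ?invr_ge0 ?(ltW A0) ?(ltW t0)// gt0_powRV//.
  rewrite -[leLHS]mulr1.
  have -> : (t `^ (q / p) = t * t `^ (q / p - 1))%R by rewrite mulr_powRB1 ?divr_gt0 ?(ltW t0).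
  rewrite powRN; have := powR_gt0 (q / p - 1) t0; have := powR_gt0 (q / p - 1) A0.
  move: (t `^ _)%R (A `^ _)%R => x y y0 x0.
  rewrite le_eqVlt; apply/orP; left; apply/eqP; field.
  by rewrite !gt_eqF.
have Kf : (0 <= K w * f)%R by rewrite mulr_ge0 ?powR_ge0.
rewrite /m; case: ltrP => hwf.
  rewrite mulr1 ler_wpDr//; first by rewrite !mulr_ge0 ?powR_ge0.
  rewrite (_ : f * _ * _ = (B * f) `^ (p * (q - 1) / q) * (K w * f))%R; last by rewrite /K; ring.
  exact: ler_wpM2r.
rewrite mulr0 mulr0 add0r mulr1 /a opprD (gt0_powRD (- lam) _ w1).
rewrite (_ : f * _ * _ = (A `^ (q - 1) * `|w| `^ (- ((q - 1) / q))) * (K w * f))%R; last by rewrite /K; ring.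
exact: ler_wpM2r.
Qed.

Let mm : measurable_fun [set: R * R] (fun z : R * R => m z.1 z.2).
Proof.
have mp (c : R) : measurable_fun [set: R * R] (fun z : R * R => z.2 `^ c)%R.
  by apply: (measurableT_comp (measurable_powR c)).
have mn (c : R) : measurable_fun [set: R * R] (fun z : R * R => `|z.1| `^ c)%R.
  apply: (measurableT_comp (measurable_powR c)); exact: measurableT_comp.
have mnn : measurable_fun [set: R * R] (fun z : R * R => `|z.1|)%R.
  exact: measurableT_comp.
apply: measurable_funD.
  apply: measurable_funM.
    apply: measurable_funM => //; apply: (measurableT_comp (measurable_powR _)).
    exact: measurable_funM.
  apply: measurable_funM => //; apply: measurable_natr_bool.
  exact: measurable_fun_ltr.
apply: measurable_funM.
  exact: measurable_funM.
apply: measurable_funM => //; apply: measurable_natr_bool.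
exact: measurable_fun_ler.
Qed.

Let integral_m f : (0 <= f)%R -> \int[mu]_w (m w f)%:E <=
  ((B `^ (p * (q - 1) / q) * c1 + A `^ (q - 1) * (2 / (a - 1))) * f `^ p)%:E.
Proof.
rewrite le_eqVlt => /orP[/eqP <-|f0].
  rewrite (eq_integral (fun=> 0)); last by move=> w _; rewrite /m !mul0r addr0.
  by rewrite integral0 powR0 ?mulr0// gt_eqF.
have r0 : (0 < f `^ (- p))%R by exact: powR_gt0.
have mlam (c : R) : measurable_fun [set: R] (fun w : R => `|w| `^ c)%R.
  by apply: (measurableT_comp (measurable_powR _)).
under eq_integral do rewrite /m EFinD EFinM (EFinM (f * _)).
rewrite ge0_integralD//=; last 4 first.
- by move=> w _; rewrite lee_fin !mulr_ge0 ?powR_ge0// ltW.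
- by apply: emeasurable_funM => //; apply/measurable_EFinP; apply: measurable_funM; [exact: mlam|exact: mlt].
- by move=> w _; rewrite lee_fin !mulr_ge0 ?powR_ge0// ltW.
- by apply: emeasurable_funM => //; apply/measurable_EFinP; apply: measurable_funM; [exact: mlam|exact: mle].
rewrite !integral_scale; last 6 first.
- by rewrite mulr_ge0 ?powR_ge0// ltW.
- by apply: measurable_funM; [exact: mlam|exact: mle].
- by move=> w; rewrite mulr_ge0 ?powR_ge0.
- by rewrite mulr_ge0 ?powR_ge0// ltW.
- by apply: measurable_funM; [exact: mlam|exact: mlt].
- by move=> w; rewrite mulr_ge0 ?powR_ge0.
rewrite integral_powR_ball// integral_powR_coball// -!EFinM -EFinD lee_fin.
rewrite le_eqVlt; apply/orP; left; apply/eqP.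
rewrite powRM ?(ltW B0) ?(ltW f0)// -!powRrM [in RHS]mulrDl.
have e1 : (f `^ p = f * f `^ (p * (q - 1) / q) * f `^ (- p * (1 - lam)))%R.
  rewrite -{2}(powRr1 (ltW f0)) -!gt0_powRD//; congr (_ `^ _)%R.
  by rewrite /lam; field; rewrite !gt_eqF.
have e2 : (f `^ p = f * f `^ (- p * (1 - a)))%R.
  rewrite -{2}(powRr1 (ltW f0)) -!gt0_powRD//; congr (_ `^ _)%R.
  by rewrite /a /lam; field; rewrite !gt_eqF.
congr (_ + _)%R; first by rewrite e1 /c1; ring.
by rewrite e2; ring.
Qed.

Let M F u : \bar R := \int[mu]_v (m (u - v) (F v))%:E.

Let convol_level F t u : measurable_fun [set: R] F -> (forall x, (0 <= F x)%R) ->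
  (0 < t)%R -> \int[mu]_x (F x `^ p)%:E <= 1 ->
  (t `^ (q - 1))%:E * convol K F u <= (t `^ q / 2)%:E + M F u.
Proof.
move=> mF F0 t0 F1; set dl := ((A / t) `^ q)%R.
have dl0 : (0 < dl)%R by rewrite powR_gt0 ?divr_gt0.
have K0 x : (0 <= K x)%R by exact: powR_ge0.
have h0 : (0 <= hh t)%R.
  by rewrite divr_ge0 ?divr_ge0 ?(ltW t0)// mulr_ge0 ?powR_ge0// ltW.
have mdiff : measurable_fun [set: R] (fun v : R => u - v)%R by exact: measurable_funB.
have mfar : measurable_fun [set: R] (fun v : R => K (u - v) * (dl <= `|(u - v)%R|)%R%:R * F v)%R.
  apply: measurable_funM => //.
  by apply: (measurableT_comp (measurable_funM mK (mle dl)) mdiff).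
have mnear : measurable_fun [set: R] (fun v : R => K (u - v) * (`|(u - v)%R| < dl)%R%:R)%R.
  by apply: (measurableT_comp (measurable_funM mK (mlt dl)) mdiff).
have mF1 : measurable_fun [set: R] (fun v : R => F v * (hh t < F v)%R%:R)%R.
  apply: measurable_funM => //; apply: measurable_natr_bool.
  exact: measurable_fun_ltr.
pose rest : \bar R := \int[mu]_v (K (u - v) * (`|(u - v)%R| < dl)%R%:R * (F v * (hh t < F v)%R%:R))%:E.
have rM : (t `^ (q - 1))%:E * rest <= M F u.
  rewrite /rest -ge0_integralZl//=; last 3 first.
  - by apply/measurable_EFinP; exact: measurable_funM.
  - by move=> v _; rewrite lee_fin !mulr_ge0.
  - by rewrite lee_fin powR_ge0.
  apply: ge0_le_integral => //=.
  - by move=> v _; rewrite lee_fin mulr_ge0 ?powR_ge0// !mulr_ge0.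
  - by apply/measurable_EFinP; apply: measurable_funM => //; exact: measurable_funM.
  - apply/measurable_EFinP; apply: (measurableT_comp mm (g := fun v : R => ((u - v)%R, F v))).
    exact: measurable_fun_pair.
  - by move=> v _; rewrite -EFinM lee_fin; exact: rest_le.
have split3 : convol K F u <= (t / 4)%:E + ((t / 4)%:E + rest).
  apply: (@le_trans _ _ (convol (fun w => K w * (dl <= `|w|)%R%:R)%R F u +
     (\int[mu]_v (hh t * (K (u - v) * (`|(u - v)%R| < dl)%R%:R))%:E + rest))).
    rewrite /rest -ge0_integralD//=; last 4 first.
    - by move=> v _; rewrite lee_fin (mulr_ge0 h0)// mulr_ge0.
    - by apply/measurable_EFinP; exact: measurable_funM.
    - by move=> v _; rewrite lee_fin !mulr_ge0.
    - by apply/measurable_EFinP; exact: measurable_funM.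
    rewrite /convol -ge0_integralD//=; last 4 first.
    - by move=> v _; rewrite lee_fin !mulr_ge0.
    - exact/measurable_EFinP.
    - by move=> v _; rewrite adde_ge0// lee_fin ?(mulr_ge0 h0)// !mulr_ge0.
    - under eq_fun do rewrite -EFinD; apply/measurable_EFinP.
      by apply: measurable_funD; exact: measurable_funM.
    apply: ge0_le_integral => //=.
    - by move=> v _; rewrite lee_fin mulr_ge0.
    - exact: measurable_conv_slice.
    - under eq_fun do rewrite -!EFinD; apply/measurable_EFinP.
      by apply: measurable_funD => //; apply: measurable_funD; exact: measurable_funM.
    - move=> v _; rewrite -!EFinD lee_fin.
      have := K0 (u - v)%R; have := F0 v; move: (K _) (F v) => k f f0 k0.
      case: (leP dl) => _; rewrite ?mulr1 ?mulr0 ?mul0r ?addr0 ?add0r//.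
      case: (ltP (hh t)) => hf; rewrite ?mulr1 ?mulr0 ?addr0//.
        by rewrite lerDr mulr_ge0.
      by rewrite mulrC ler_wpM2r.
  apply: leeD; first exact: conv_far.
  apply: leeD => //.
  under eq_integral do rewrite EFinM.
  rewrite ge0_integralZl//=; last 2 first.
  - exact/measurable_EFinP.
  - by move=> v _; rewrite lee_fin mulr_ge0.
  rewrite (ge0_integral_subl (g := fun w => (K w * (`|w| < dl)%R%:R)%:E)); last 2 first.
  - by apply/measurable_EFinP; exact: measurable_funM.
  - by move=> w; rewrite lee_fin mulr_ge0.
  rewrite integral_near// -EFinM lee_fin /hh divfK// gt_eqF//.
  by rewrite mulr_gt0// powR_gt0// divr_gt0.
apply: (le_trans (lee_wpmul2l _ split3)); first by rewrite lee_fin powR_ge0.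
rewrite addeA -EFinD ge0_muleDr ?lee_fin//; last 2 first.
- by have := t0; lra.
- by apply: integral_ge0 => v _; rewrite lee_fin !mulr_ge0.
apply: leeD => //; rewrite -EFinM lee_fin.
have -> : (t `^ q = t * t `^ (q - 1))%R by rewrite mulr_powRB1// ltW.
by rewrite le_eqVlt; apply/orP; left; apply/eqP; field.
Qed.

(** Taking t to be the value of the convolution itself lets t^q / 2 be absorbed on the left, so that
    t^q <= 2 M F u pointwise. Integration in u and Tonelli then yield a multiple of the integral of
    F^p. *)
Lemma hardy_littlewood_sobolev : exists2 C : R, (0 <= C)%R & forall F,
  measurable_fun [set: R] F -> (forall x, (0 <= F x)%R) ->
  \int[mu]_x (F x `^ p)%:E <= 1 ->
  \int[mu]_u (convol (fun w => `|w| `^ (- (1 - p^-1 + q^-1)))%R F u `^ q) <= C%:E.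
Proof.
pose C : R := (B `^ (p * (q - 1) / q) * c1 + A `^ (q - 1) * (2 / (a - 1)))%R.
have C0 : (0 <= C)%R.
  by rewrite addr_ge0 ?mulr_ge0 ?powR_ge0 ?invr_ge0 ?(ltW c10)// subr_ge0 ltW.
exists (2 * C)%R; first by rewrite mulr_ge0.
move=> F mF F0 F1; rewrite -/lam -/K.
have K0 x : (0 <= K x)%R by exact: powR_ge0.
have mmF : measurable_fun [set: R * R] (fun z : R * R => (m (z.1 - z.2) (F z.2))%:E).
  apply/measurable_EFinP; apply: (measurableT_comp mm (g := fun z : R * R => ((z.1 - z.2)%R, F z.2))).
  apply: measurable_fun_pair; last exact: measurableT_comp.
  exact: measurable_funB.
have mF0 z : 0 <= (m (z.1 - z.2) (F z.2))%:E by rewrite lee_fin m_ge0.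
have mMF : measurable_fun [set: R] (M F).
  exact: (measurable_fun_fubini_tonelli_F (m2 := mu) _ mmF mF0).
have M0 u : 0 <= M F u by apply: integral_ge0 => v _; rewrite lee_fin m_ge0.
apply: (@le_trans _ _ (\int[mu]_u (2%:E * M F u))).
  apply: ge0_le_integral => //.
  - by move=> u _; exact: poweR_ge0.
  - by apply: (measurableT_comp (measurable_poweR q)); exact: measurable_convol.
  - exact: emeasurable_funM.
  - move=> u _.
    have T0 : 0 <= convol K F u by apply: integral_ge0 => v _; rewrite lee_fin mulr_ge0.
    have H := fun t t0 => @convol_level F t u mF F0 t0 F1.
    move: T0 H; case: (convol K F u) => [t||//].
      rewrite lee_fin le_eqVlt => /orP[/eqP <- _|t0 /(_ t t0)].
        by rewrite poweR_EFin powR0 ?gt_eqF// mule_ge0.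
      rewrite -EFinM (mulrC (t `^ _)%R) mulr_powRB1 ?(ltW t0)// poweR_EFin.
      move: (M0 u); case: (M F u) => [x||//] _; last by rewrite gt0_muley ?leey ?lte_fin.
      rewrite -EFinD -EFinM !lee_fin => h; lra.
    (* If the convolution is infinite, the estimate at t = 1 already forces M F u = +oo. *)
    move=> _ /(_ 1%R ltr01); rewrite !powR1 mul1e poweRyr ?gt_eqF//.
    move: (M0 u); case: (M F u) => [x||//] _; last by rewrite gt0_muley ?lte_fin.
    by rewrite -EFinD leye_eq.
rewrite ge0_integralZl//= EFinM; apply: lee_wpmul2l; first by rewrite lee_fin.
rewrite /M (fubini_tonelli (m1 := mu) (m2 := mu) _ mmF)//=.
apply: (@le_trans _ _ (\int[mu]_v (C%:E * (F v `^ p)%:E))).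
  apply: ge0_le_integral => //.
  - by move=> v _; apply: integral_ge0 => u _; rewrite lee_fin m_ge0.
  - exact: (measurable_fun_fubini_tonelli_G (m1 := mu) _ mmF mF0).
  - apply: emeasurable_funM => //; apply/measurable_EFinP.
    exact: (measurableT_comp (measurable_powR p)).
  - move=> v _; rewrite -EFinM.
    rewrite (ge0_integral_shift (g := fun w => (m w (F v))%:E) (- v)%R).
    + exact: integral_m.
    + apply/measurable_EFinP; apply: (measurableT_comp mm (g := fun w : R => (w, F v))).
      exact: measurable_fun_pair.
    + by move=> w; rewrite lee_fin m_ge0.
rewrite ge0_integralZl//=; last 2 first.
- by apply/measurable_EFinP; exact: (measurableT_comp (measurable_powR p)).
- by move=> x _; rewrite lee_fin powR_ge0.
by rewrite -[leRHS]mule1; apply: lee_wpmul2l.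
Qed.

End hls.

End real_convolution.

(** * Reduction to a convolution operator *)

Section eta_transfer.
Context {R : realType}.
Local Open Scope ereal_scope.
Local Notation mu := (@lebesgue_measure R).
Implicit Types (nu A p q : R).

Lemma eta_setC_Rpos nu : eta nu (~` Rpos) = 0.
Proof. by rewrite /eta setICl integral_set0. Qed.

Lemma ge0_integral_eta_Rpos nu (f : R -> \bar R) :
  measurable_fun [set: R] f -> (forall x, 0 <= f x) ->
  \int[eta nu]_x f x = \int[eta nu]_(x in Rpos) f x.
Proof.
move=> mf f0; have mR := @measurable_Rpos R.
rewrite -(setUv Rpos) ge0_integral_setU//=; last 3 first.
- exact: measurableC.
- by rewrite setUv.
- exact/disj_setPCl.
rewrite [X in _ + X]null_set_integral ?adde0//.
- exact: measurableC.
- exact: measurable_funTS.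
- exact: eta_setC_Rpos.
Qed.

Lemma eta_null nu (N : set R) : measurable N ->
  (eta nu N = 0) <-> (mu (expR @^-1` N) = 0).
Proof.
move=> mN.
have mE : measurable (expR @^-1` N : set R).
  by rewrite -[_ @^-1` _]setTI; exact: measurable_expR.
have -> : eta nu N = \int[mu]_u ((\1_N (expR u))%:E * (expR ((2 * nu + 2) * u))%:E).
  rewrite -(ge0_integral_eta_log nu (f := EFin \o \1_N)); last 2 first.
  - by apply/measurable_EFinP/measurable_funTS; exact: measurable_indic.
  - by move=> x _; rewrite lee_fin.
  rewrite -ge0_integral_eta_Rpos; last 2 first.
  - by apply/measurable_EFinP; exact: measurable_indic.
  - by move=> x; rewrite lee_fin.
  by rewrite integral_indic ?setIT.
have mf : measurable_fun [set: R] (fun u => (\1_N (expR u))%:E * (expR ((2 * nu + 2) * u))%:E).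
  apply: emeasurable_funM; apply/measurable_EFinP.
    rewrite (_ : (fun _ => _) = \1_(expR @^-1` N)); first exact: measurable_indic.
    by apply/funext => x; rewrite !indicE.
  by apply: measurableT_comp => //; exact: measurable_funM.
have f0 u : 0 <= (\1_N (expR u))%:E * (expR ((2 * nu + 2) * u))%:E.
  by rewrite mule_ge0// lee_fin ?expR_ge0.
split => h.
  have : \int[mu]_u `|(\1_N (expR u))%:E * (expR ((2 * nu + 2) * u))%:E| = 0.
    by under eq_integral do rewrite gee0_abs//.
  move/(ae_eq_integral_abs mu measurableT mf) => -[M [mM M0 hM]].
  apply/eqP; rewrite eq_le measure_ge0 andbT -M0; apply: le_measure; rewrite ?inE//.
  by apply: subset_trans hM => u /= Nu /(_ I)/eqP; rewrite indicE mem_set// mul1e eqe expR_eq0.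
rewrite (ae_eq_integral (fun=> 0))//; first by rewrite integral0.
exists (expR @^-1` N); split => // u /= hu; apply: contrapT => Nu; apply: hu => _.
by rewrite indicE memNset// mul0e.
Qed.

Lemma ae_eta_exp nu (P : set R) :
  {ae eta nu, forall x, P x} <-> {ae mu, forall u, P (expR u)}.
Proof.
split=> -[N [mN N0 hN]].
  exists (expR @^-1` N); split.
  - by rewrite -[_ @^-1` _]setTI; exact: measurable_expR.
  - exact/(eta_null nu mN).
  - by move=> u /= Pu; apply: hN.
(* Nothing is known about [P] at x <= 0; those points are put into the exceptional set. *)
have mM : measurable (((@ln R) @^-1` N) `&` Rpos `|` ~` Rpos : set R).
  apply: measurableU; last by apply: measurableC; exact: measurable_Rpos.
  apply: measurableI; last exact: measurable_Rpos.
  by rewrite -[_ @^-1` _]setTI; exact: measurable_ln.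
exists (((@ln R) @^-1` N) `&` Rpos `|` ~` Rpos); split => //.
  apply/(eta_null nu mM); rewrite -N0; congr (mu _).
  apply/seteqP; split => u /=; rewrite RposE expRK expR_gt0; first by case=> [[]|] //.
  by move=> Nu; left.
move=> x /= Px; have [x0|x0] := ltP 0%R x; last by right; rewrite RposE; apply/negP; rewrite -leNgt.
by left; split; [apply: hN => /=; rewrite lnK|rewrite RposE].
Qed.

(** The norm at +oo is an essential supremum only under positive total mass, hence this lemma and
    the next. *)
Lemma eta_setT_gt0 nu : 0 < eta nu [set: R].
Proof.
rewrite lt0e measure_ge0 andbT; apply/eqP => /(eta_null nu measurableT).
by rewrite preimage_setT => h; have := @lebesgue_measure_itv R `]-oo, +oo[; rewrite set_itvNyy h.
Qed.

Lemma lebesgue_setT_gt0 : 0 < mu [set: R].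
Proof.
rewrite lt0e measure_ge0 andbT; apply/eqP => h.
by have := @lebesgue_measure_itv R `]-oo, +oo[; rewrite set_itvNyy h.
Qed.

Lemma gt0_of_ge1e (r : R) : 1 <= r%:E -> (0 < r)%R.
Proof. by rewrite lee_fin; exact: lt_le_trans. Qed.

Lemma rinv_real (r : R) : (0 < r)%R -> @rinv R r%:E = r^-1%R.
Proof. by move=> r0; rewrite /rinv inver gt_eqF. Qed.

Lemma rinvy : @rinv R +oo = 0%R.
Proof. by rewrite /rinv invey. Qed.

Lemma Lnorm_ereal d (T : measurableType d) (m : {measure set T -> \bar R})
    (p : R) (f : T -> \bar R) :
  'N[m]_p%:E[f] = (\int[m]_x (`|f x| `^ p)) `^ p^-1.
Proof. by rewrite unlock. Qed.

Lemma Lnorm_y d (T : measurableType d) (m : {measure set T -> \bar R})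
    (f : T -> \bar R) : 0 < m [set: T] ->
  'N[m]_+oo[f] = ess_sup m (abse \o f).
Proof. by move=> m0; rewrite unlock m0. Qed.

(** The density e^((2 nu + 2) v) is moved inside as a p-th power. At p = +oo the convention
    [rinv p = 0] makes the factor 1, as it should be. *)
Lemma Lnorm_eta nu (p : \bar R) (h : R -> \bar R) : 1 <= p ->
  measurable_fun [set: R] h ->
  'N[eta nu]_p[h] =
  'N[mu]_p[(fun v => (expR ((2 * nu + 2) * rinv p * v))%:E * h (expR v))].
Proof.
move=> p1 mh; case: p p1 => [r r1|_|//].
  have r0 := gt0_of_ge1e r1.
  rewrite !Lnorm_ereal; congr (_ `^ _).
  have mhr : measurable_fun [set: R] (fun x => `|h x| `^ r).
    by apply: (measurableT_comp (measurable_poweR r)); exact: measurableT_comp.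
  rewrite ge0_integral_eta_Rpos//; last by move=> x; exact: poweR_ge0.
  rewrite ge0_integral_eta_log; last 2 first.
  - exact: measurable_funTS.
  - by move=> x _; exact: poweR_ge0.
  apply: eq_integral => v _; rewrite abseM poweRM//.
  rewrite muleC; congr (_ * _); rewrite abse_EFin ger0_norm ?expR_ge0//.
  rewrite poweR_EFin -expRM rinv_real//; congr (expR _)%:E.
  by field; rewrite gt_eqF.
rewrite !Lnorm_y ?eta_setT_gt0 ?lebesgue_setT_gt0// rinvy.
apply/eqP; rewrite eq_le; apply/andP; split; apply/ess_supP.
  apply/ae_eta_exp; have := ess_sup_ge mu (abse \o fun v => (expR ((2 * nu + 2) * 0 * v))%:E * h (expR v)).
  by apply: filterS => v /=; rewrite mulr0 mul0r expR0 mul1e.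
have /ae_eta_exp[N [mN N0 hN]] := ess_sup_ge (eta nu) (abse \o h).
exists N; split => // v hv; apply: hN => /= hv'; apply: hv => /=.
by rewrite mulr0 mul0r expR0 mul1e.
Qed.

Lemma le_Lnorm d (T : measurableType d) (m : {measure set T -> \bar R})
    (q : \bar R) (f g : T -> \bar R) : 1 <= q ->
  measurable_fun [set: T] f -> measurable_fun [set: T] g ->
  {ae m, forall x, `|f x| <= `|g x|} -> 'N[m]_q[f] <= 'N[m]_q[g].
Proof.
move=> q1 mf mg fg; case: q q1 => [r r1|_|//].
  have r0 := gt0_of_ge1e r1.
  rewrite !Lnorm_ereal.
  have i0 (k : T -> \bar R) : 0 <= \int[m]_x (`|k x| `^ r).
    by apply: integral_ge0 => x _; exact: poweR_ge0.
  apply: gt0_ler_poweR; rewrite ?invr_ge0 ?(ltW r0)// ?in_itv/= ?leey ?andbT ?i0//.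
  apply: ae_ge0_le_integral => //.
  - by move=> x _; exact: poweR_ge0.
  - by apply: (measurableT_comp (measurable_poweR r)); exact: measurableT_comp.
  - by move=> x _; exact: poweR_ge0.
  - by apply: (measurableT_comp (measurable_poweR r)); exact: measurableT_comp.
  - move: fg; apply: filterS => x fgx _.
    by apply: gt0_ler_poweR; rewrite ?(ltW r0)// in_itv/= leey abse_ge0.
by rewrite unlock; case: ifP => // _; exact: le_ess_sup.
Qed.

Lemma Lnorm_scale d (T : measurableType d) (m : {measure set T -> \bar R})
    (q : \bar R) (k : R) (f : T -> \bar R) : 1 <= q -> (0 < k)%R ->
  measurable_fun [set: T] f ->
  'N[m]_q[(fun x => k%:E * f x)] = k%:E * 'N[m]_q[f].
Proof.
move=> q1 k0 mf; case: q q1 => [r r1|_|//].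
  have r0 := gt0_of_ge1e r1.
  rewrite !Lnorm_ereal.
  under eq_integral => x _ do rewrite abseM poweRM ?abse_ge0// abse_EFin (gtr0_norm k0).
  rewrite ge0_integralZl//; last 3 first.
  - by apply: (measurableT_comp (measurable_poweR r)); exact: measurableT_comp.
  - by move=> x _; exact: poweR_ge0.
  - exact: poweR_ge0.
  rewrite poweRM ?poweR_ge0//; last by apply: integral_ge0 => x _; exact: poweR_ge0.
  congr (_ * _); rewrite !poweR_EFin -powRrM divff ?gt_eqF// powRr1//; exact: ltW.
rewrite unlock; case: ifPn => [m0|_]; last by rewrite mule0.
rewrite -ess_supZl//; last exact: ltW.
by apply: eq_ess_sup; apply: aeW => x /=; rewrite abseM abse_EFin gtr0_norm.
Qed.

End eta_transfer.

(** * The operator in logarithmic coordinates *)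

Section log_reduction.
Context {R : realType}.
Local Open Scope ereal_scope.
Local Notation mu := (@lebesgue_measure R).
Implicit Types (nu A e : R) (p q : \bar R) (f F : R -> R).

(* [e] is the exponent turning [f] on (0, +oo) into a function on the line:
   [F v = e^(e v) f (e^v)]. *)
Definition explift (e : R) (f : R -> R) (v : R) : R := (expR (e * v) * f (expR v))%R.

Lemma measurable_explift e f : measurable_fun Rpos f -> measurable_fun [set: R] (explift e f).
Proof.
move=> mf; apply: measurable_funM.
  exact: measurable_expRM.
apply: (measurable_comp (@measurable_Rpos R)) mf _ => //.
by move=> _ [v _ <-]; rewrite RposE expR_gt0.
Qed.

Lemma measurable_pow_weight_Rpos A f :
  measurable_fun [set: R] (pow_weight A f) -> measurable_fun Rpos f.
Proof.
move=> mf.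
apply: (eq_measurable_fun (fun x => x `^ (- A) * pow_weight A f x)%R).
  move=> x; rewrite inE RposE => x0; rewrite /pow_weight mulrA -gt0_powRD//.
  by rewrite addNr powRr0 mul1r.
by apply: measurable_funTS; apply: measurable_funM => //; exact: measurable_powR.
Qed.

Lemma wLpE nu A p f : wLp nu A p f <->
  measurable_fun [set: R] (pow_weight A f) /\ wnorm nu A p f < +oo.
Proof.
rewrite /wLp /wnorm /=; split.
  by move=> /andP[]; rewrite !inE.
by move=> [mf nf]; apply/andP; rewrite !inE.
Qed.

Lemma wnorm_explift nu A p f : 1 <= p -> measurable_fun [set: R] (pow_weight A f) ->
  wnorm nu A p f = 'N[mu]_p[EFin \o explift (A + (2 * nu + 2) * rinv p) f].
Proof.
move=> p1 mf; rewrite /wnorm Lnorm_eta//; last exact/measurable_EFinP.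
congr ('N[mu]_p[_]); apply/funext => v /=; rewrite -EFinM; congr (_%:E).
rewrite /pow_weight /explift mulrA -expRM -expRD; congr (expR _ * _)%R.
by ring.
Qed.

Definition expunlift e F : R -> R := (fun y => y `^ (- e) * F (ln y))%R \_ Rpos.

Lemma expunliftK e F : explift e (expunlift e F) = F.
Proof.
apply/funext => v; rewrite /explift /expunlift patchE ifT; last by rewrite inE RposE expR_gt0.
by rewrite expRK mulrA -expRM -expRD mulrC (_ : _ + _ = 0)%R ?expR0 ?mulr1//; ring.
Qed.

Lemma measurable_expunlift e F : measurable_fun [set: R] F ->
  measurable_fun [set: R] (expunlift e F).
Proof.
move=> mF; apply/(measurable_restrictT _ (@measurable_Rpos R)).
apply: measurable_funTS; apply: measurable_funM; first exact: measurable_powR.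
by apply: (measurableT_comp mF); exact: measurable_ln.
Qed.

Lemma expunlift_ge0 e F y : (forall v, (0 <= F v)%R) -> (0 <= expunlift e F y)%R.
Proof.
by move=> F0; rewrite /expunlift patchE; case: ifP => // _; rewrite mulr_ge0 ?powR_ge0.
Qed.

Variables (nu sigma : R).
Hypotheses (nu1 : (nu < 1)%R) (sigma0 : (0 < sigma)%R) (sigma1 : (sigma < - nu + 1)%R).

Definition hker (c w : R) : \bar R := (expR (c * w))%:E * kprof nu sigma w.

Definition econv (H : R -> \bar R) (F : R -> R) (u : R) : \bar R :=
  \int[mu]_v (H (u - v)%R * (F v)%:E).

Lemma hker_ge0 c w : 0 <= hker c w.
Proof. by rewrite mule_ge0 ?lee_fin ?expR_ge0// kprof_ge0. Qed.

Lemma measurable_hker c : measurable_fun [set: R] (hker c).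
Proof.
apply: emeasurable_funM; last exact: measurable_kprof.
by apply/measurable_EFinP; exact: measurable_expRM.
Qed.

Lemma measurable_econv_kernel c (F : R -> R) : measurable_fun [set: R] F ->
  measurable_fun [set: R * R] (fun z : R * R => hker c (z.1 - z.2)%R * (F z.2)%:E).
Proof.
move=> mF; apply: emeasurable_funM.
  by apply: (measurableT_comp (measurable_hker c)); exact: measurable_funB.
by apply/measurable_EFinP; exact: measurableT_comp.
Qed.

Lemma measurable_econv_slice c (F : R -> R) u : measurable_fun [set: R] F ->
  measurable_fun [set: R] (fun v : R => hker c (u - v)%R * (F v)%:E).
Proof.
move=> mF; apply: emeasurable_funM; last exact/measurable_EFinP.
by apply: (measurableT_comp (measurable_hker c)); exact: measurable_funB.
Qed.

Lemma measurable_econv c (F : R -> R) : measurable_fun [set: R] F ->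
  (forall v, (0 <= F v)%R) -> measurable_fun [set: R] (econv (hker c) F).
Proof.
move=> mF F0.
apply: (measurable_fun_fubini_tonelli_F (m2 := mu) _ (measurable_econv_kernel c mF)).
by move=> z; rewrite mule_ge0 ?hker_ge0// lee_fin.
Qed.

Lemma econv_ge0 c (F : R -> R) u : (forall v, (0 <= F v)%R) -> 0 <= econv (hker c) F u.
Proof. by move=> F0; apply: integral_ge0 => v _; rewrite mule_ge0 ?hker_ge0// lee_fin. Qed.

Lemma exotic_kernel_ln x y : (0 < x)%R -> (0 < y)%R ->
  exotic_kernel nu sigma x y =
  (kconst nu sigma * expR ((ln x + ln y) * (sigma - 1 - nu)))%:E * kprof nu sigma (ln x - ln y)%R.
Proof. by move=> x0 y0; rewrite -{1}(lnK x0) -{1}(lnK y0) exotic_kernel_exp. Qed.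

Lemma exotic_kernel_ge0 x y : (0 < x)%R -> (0 < y)%R -> 0 <= exotic_kernel nu sigma x y.
Proof.
move=> x0 y0; rewrite exotic_kernel_ln// mule_ge0 ?kprof_ge0// lee_fin.
by rewrite mulr_ge0 ?expR_ge0// ltW// kconst_gt0.
Qed.

Lemma measurable_exotic_kernel x : (0 < x)%R ->
  measurable_fun Rpos (exotic_kernel nu sigma x).
Proof.
move=> x0.
apply: (eq_measurable_fun (fun y => (kconst nu sigma * expR ((ln x + ln y) * (sigma - 1 - nu)))%:E *
    kprof nu sigma (ln x - ln y)%R)).
  by move=> y; rewrite inE RposE => y0; rewrite exotic_kernel_ln.
apply: measurable_funTS.
have mln : measurable_fun [set: R] (@ln R) by exact: measurable_ln.
apply: emeasurable_funM.
  apply/measurable_EFinP; apply: measurable_funM => //; apply: measurableT_comp => //.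
  by apply: measurable_funM => //; exact: measurable_funD.
apply: (measurableT_comp (measurable_kprof nu1 sigma0 sigma1)).
exact: measurable_funB.
Qed.

(** The exponent [e] is free: the total exponents sigma - 1 - nu of e^u and sigma + 1 + nu of e^v
    determine c = e - sigma - 1 - nu in the convolution kernel and leave e^((2 sigma - e) u)
    outside. The weights select [e] later. *)
Lemma integral_exotic_ge0 e (f : R -> R) (u : R) :
  measurable_fun Rpos f -> (forall y, Rpos y -> (0 <= f y)%R) ->
  \int[eta nu]_(y in Rpos) (exotic_kernel nu sigma (expR u) y * (f y)%:E) =
  (kconst nu sigma * expR ((2 * sigma - e) * u))%:E *
  econv (hker (e - sigma - 1 - nu)) (explift e f) u.
Proof.
move=> mf f0; have u0 := expR_gt0 u.
rewrite ge0_integral_eta_log; last 2 first.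
- apply: emeasurable_funM; first exact: measurable_exotic_kernel.
  exact/measurable_EFinP.
- by move=> y Ry; rewrite mule_ge0 ?lee_fin ?f0// exotic_kernel_ge0// -RposE.
have ml : measurable_fun [set: R] (explift e f) by exact: measurable_explift.
have l0 v : (0 <= explift e f v)%R.
  by rewrite mulr_ge0 ?expR_ge0// f0// RposE expR_gt0.
rewrite /econv -ge0_integralZl//=; last 3 first.
- exact: measurable_econv_slice.
- by move=> v _; rewrite mule_ge0 ?hker_ge0// lee_fin.
- by rewrite lee_fin mulr_ge0 ?expR_ge0// ltW// kconst_gt0.
apply: eq_integral => v _; rewrite exotic_kernel_exp// /hker /explift.
move: (kconst _ _) (kprof _ _ _) => a k; rewrite !(muleAC _ k) muleA -!EFinM; congr (_%:E * _).
rewrite -!mulrA; congr (_ * _)%R; rewrite !mulrA (mulrC _ (f _)) [RHS]mulrC -!mulrA; congr (_ * _)%R.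
by rewrite !mulrA -!expRD; congr (expR _); ring.
Qed.

Lemma integral_exotic_abs e f (u : R) : measurable_fun Rpos f ->
  \int[eta nu]_(y in Rpos) `|exotic_kernel nu sigma (expR u) y * (f y)%:E| =
  (kconst nu sigma * expR ((2 * sigma - e) * u))%:E *
  econv (hker (e - sigma - 1 - nu)) (fun v => `|explift e f v|)%R u.
Proof.
move=> mf.
rewrite (_ : (fun v => `|explift e f v|)%R = explift e (fun y => `|f y|)%R); last first.
  by apply/funext => v; rewrite /explift normrM ger0_norm ?expR_ge0.
rewrite -integral_exotic_ge0//; last exact: measurableT_comp.
apply: eq_integral => y; rewrite inE RposE => y0.
by rewrite abseM gee0_abs// exotic_kernel_ge0// expR_gt0.
Qed.

Lemma measurable_exotic_mul f (x : R) : (0 < x)%R -> measurable_fun Rpos f ->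
  measurable_fun Rpos (fun y => exotic_kernel nu sigma x y * (f y)%:E).
Proof.
move=> x0 mf; apply: emeasurable_funM; last exact/measurable_EFinP.
exact: measurable_exotic_kernel.
Qed.

Lemma exotic_domainE e f : measurable_fun Rpos f ->
  exotic_domain nu sigma f <->
  {ae mu, forall u, econv (hker (e - sigma - 1 - nu)) (fun v => `|explift e f v|)%R u < +oo}.
Proof.
move=> mf; rewrite /exotic_domain /= ae_eta_exp.
have H u : ((eta nu).-integrable Rpos
    (fun y => exotic_kernel nu sigma (expR u) y * (f y)%:E) : Prop) <->
    econv (hker (e - sigma - 1 - nu)) (fun v => `|explift e f v|)%R u < +oo.
  have k0 : (0 < kconst nu sigma * expR ((2 * sigma - e) * u))%R.
    by rewrite mulr_gt0 ?expR_gt0// kconst_gt0.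
  split=> [/integrableP[_]|h].
    rewrite (integral_exotic_abs e)//; apply: contraTT; rewrite -!leNgt !leye_eq => /eqP ->.
    by rewrite gt0_muley.
  apply/integrableP; split; first exact: (measurable_exotic_mul (expR_gt0 u) mf).
  rewrite (integral_exotic_abs e)// lte_mul_pinfty// lee_fin; exact: ltW.
by split; move=> [N [mN N0 hN]]; exists N; split => // u /= hu; apply: hN => /= hu'; apply: hu; exact/H.
Qed.

Lemma measurable_exotic_ge0 f : measurable_fun Rpos f ->
  (forall y, Rpos y -> (0 <= f y)%R) ->
  measurable_fun Rpos (fun x => \int[eta nu]_(y in Rpos) (exotic_kernel nu sigma x y * (f y)%:E)).
Proof.
move=> mf f0.
apply: (eq_measurable_fun (fun x => (kconst nu sigma * expR ((2 * sigma - 0) * ln x))%:E *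
    econv (hker (0 - sigma - 1 - nu)) (explift 0 f) (ln x))).
  move=> x; rewrite inE RposE => x0.
  by rewrite -[in RHS](lnK x0) (integral_exotic_ge0 0).
apply: measurable_funTS; apply: emeasurable_funM.
  apply/measurable_EFinP; apply: measurable_funM => //; apply: measurableT_comp => //.
  by apply: measurable_funM => //; exact: measurable_ln.
apply: measurableT_comp; last exact: measurable_ln.
apply: measurable_econv => //; first exact: measurable_explift.
by move=> v; rewrite mulr_ge0 ?expR_ge0// f0// RposE expR_gt0.
Qed.

(** Since the kernel is nonnegative, the positive and negative parts of the integrand come from
    those of f, and each gives a measurable extended-valued integral. No membership in the domain is
    needed. *)
Lemma measurable_exotic_integral f : measurable_fun Rpos f ->
  measurable_fun [set: R] (exotic_integral nu sigma f).
Proof.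
move=> mf; apply/(measurable_restrictT _ (@measurable_Rpos R)).
apply: measurableT_comp; first exact: fine_measurable.
apply: (eq_measurable_fun (fun x =>
   \int[eta nu]_(y in Rpos) (exotic_kernel nu sigma x y * (Num.max (f y) 0)%:E) -
   \int[eta nu]_(y in Rpos) (exotic_kernel nu sigma x y * (Num.max (- f y) 0)%:E))).
  move=> x; rewrite inE RposE => x0; rewrite [RHS]integralE; congr (_ - _);
    apply: eq_integral => y; rewrite inE RposE => y0;
    have k0 := exotic_kernel_ge0 x0 y0.
    rewrite funeposE; have [f0|f0] := leP 0%R (f y).
      by rewrite max_l// mule_ge0// lee_fin.
    by rewrite mule0 max_r// mule_ge0_le0// lee_fin ltW.
  rewrite funenegE -muleN -EFinN; have [f0|f0] := leP 0%R (- f y)%R.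
    by rewrite max_l// mule_ge0// lee_fin.
  by rewrite mule0 max_r// mule_ge0_le0// lee_fin ltW.
apply: emeasurable_funB; apply: measurable_exotic_ge0.
- by apply: measurable_maxr.
- by move=> y _; rewrite le_max lexx orbT.
- by apply: measurable_maxr => //; exact: measurableT_comp.
- by move=> y _; rewrite le_max lexx orbT.
Qed.

Lemma exotic_integral_abs_le e f (u : R) : measurable_fun Rpos f ->
  `|(exotic_integral nu sigma f (expR u))%:E| <=
  (kconst nu sigma * expR ((2 * sigma - e) * u))%:E *
  econv (hker (e - sigma - 1 - nu)) (fun v => `|explift e f v|)%R u.
Proof.
move=> mf; rewrite -integral_exotic_abs//.
rewrite /exotic_integral patchE ifT; last by rewrite inE RposE expR_gt0.
(* When the integral is infinite [fine] returns 0, so the bound holds at every point without any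
   domain assumption. *)
set z := integral _ _ _; apply: (@le_trans _ _ `|z|).
  by case: z => // *; rewrite abse0.
by apply: le_abse_integral; [exact: measurable_Rpos|exact: (measurable_exotic_mul (expR_gt0 u) mf)].
Qed.

Lemma exotic_integral_ge0E e f (u : R) : measurable_fun Rpos f ->
  (forall y, Rpos y -> (0 <= f y)%R) ->
  econv (hker (e - sigma - 1 - nu)) (explift e f) u < +oo ->
  (exotic_integral nu sigma f (expR u))%:E =
  (kconst nu sigma * expR ((2 * sigma - e) * u))%:E *
  econv (hker (e - sigma - 1 - nu)) (explift e f) u.
Proof.
move=> mf f0 h; rewrite /exotic_integral patchE ifT; last by rewrite inE RposE expR_gt0.
have k0 : (0 < kconst nu sigma * expR ((2 * sigma - e) * u))%R.
  by rewrite mulr_gt0 ?expR_gt0// kconst_gt0.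
have l0 v : (0 <= explift e f v)%R.
  by rewrite mulr_ge0 ?expR_ge0// f0// RposE expR_gt0.
rewrite (integral_exotic_ge0 e)// fineK// ge0_fin_numE.
  by rewrite lte_mul_pinfty// lee_fin ltW.
by rewrite mule_ge0 ?econv_ge0// lee_fin ltW.
Qed.

(** The domain inclusion read on the line. Nonnegative functions suffice, because absolute
    integrability against a nonnegative kernel depends on |f| only. *)
Definition finite_ae (c : R) p := forall F, measurable_fun [set: R] F ->
  (forall v, (0 <= F v)%R) -> 'N[mu]_p[EFin \o F] < +oo ->
  {ae mu, forall u, econv (hker c) F u < +oo}.

(* [d] is the defect of homogeneity: it vanishes exactly under condition (b). *)
Definition conv_bounded (c d : R) p q := exists2 C : R, (0 <= C)%R &
  forall F, measurable_fun [set: R] F ->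
  (forall v, (0 <= F v)%R) -> 'N[mu]_p[EFin \o F] < +oo ->
  'N[mu]_q[(fun u => (expR (d * u))%:E * econv (hker c) F u)]
    <= C%:E * 'N[mu]_p[EFin \o F].

Lemma Lnorm_abs_fun p F : 'N[mu]_p[EFin \o (fun v => `|F v|)%R] = 'N[mu]_p[EFin \o F].
Proof. by rewrite -[RHS]Lnorm_abse. Qed.

Lemma domain_reduction A p : 1 <= p ->
  wLp nu A p `<=` exotic_domain nu sigma <->
  finite_ae (A + (2 * nu + 2) * rinv p - sigma - 1 - nu) p.
Proof.
move=> p1; set e := (A + (2 * nu + 2) * rinv p)%R; split=> [h F mF F0 nF|h f /wLpE[mf nf]].
  have mw : measurable_fun [set: R] (pow_weight A (expunlift e F)).
    by apply: measurable_funM; [exact: measurable_powR|exact: measurable_expunlift].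
  have /h : wLp nu A p (expunlift e F) by apply/wLpE; split; rewrite ?wnorm_explift// expunliftK.
  move/(exotic_domainE e); rewrite expunliftK (_ : (fun v => `|F v|)%R = F); last first.
    by apply/funext => v; rewrite ger0_norm.
  by apply; apply: measurable_funTS; exact: measurable_expunlift.
have mf' := measurable_pow_weight_Rpos mf.
apply/(exotic_domainE e mf'); apply: h => //.
  by apply: measurableT_comp => //; exact: measurable_explift.
by rewrite Lnorm_abs_fun -wnorm_explift.
Qed.

(** From left to right, F >= 0 is lifted back to (0, +oo); the domain inclusion makes the
    convolution finite almost everywhere, so that [fine] is harmless. From right to left, |T f| <= T
    |f| pointwise. *)
Lemma bounded_reduction A p B q : 1 <= p -> 1 <= q ->
  let e := (A + (2 * nu + 2) * rinv p)%R in let c := (e - sigma - 1 - nu)%R in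
  let d := (- B + (2 * nu + 2) * rinv q + 2 * sigma - e)%R in
  exotic_bounded nu sigma A p B q <-> finite_ae c p /\ conv_bounded c d p q.
Proof.
move=> p1 q1 e c d.
have kc : (0 < kconst nu sigma)%R by exact: kconst_gt0.
have mT f : measurable_fun Rpos f ->
    measurable_fun [set: R] (pow_weight (- B) (exotic_integral nu sigma f)).
  move=> mf; apply: measurable_funM; first exact: measurable_powR.
  exact: measurable_exotic_integral.
have mG F : measurable_fun [set: R] F -> (forall v, (0 <= F v)%R) ->
    measurable_fun [set: R] (fun u => (expR (d * u))%:E * econv (hker c) F u).
  move=> mF F0; apply: emeasurable_funM; last exact: measurable_econv.
  by apply/measurable_EFinP; exact: measurable_expRM.
split=> [[dom [C hC]]|[dom [C C0 hC]]].
  have hd := (domain_reduction A p1).1 dom; split => //.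
  exists (`|C| / kconst nu sigma)%R; first by rewrite divr_ge0// ltW.
  move=> F mF F0 nF; pose f := expunlift e F.
  have mf : measurable_fun [set: R] f by exact: measurable_expunlift.
  have mw : measurable_fun [set: R] (pow_weight A f).
    by apply: measurable_funM => //; exact: measurable_powR.
  have nf : wnorm nu A p f = 'N[mu]_p[EFin \o F] by rewrite wnorm_explift// expunliftK.
  have /hC[_ hn] : wLp nu A p f by apply/wLpE; split => //; rewrite nf.
  have mRf : measurable_fun Rpos f by exact: measurable_funTS.
  have fF : explift e f = F by exact: expunliftK.
  move: hn; rewrite nf (@wnorm_explift nu (- B) q)//; last exact: mT.
  move=> hn; have : 'N[mu]_q[(fun u => (kconst nu sigma)%:E * ((expR (d * u))%:E * econv (hker c) F u))]
      <= `|C|%:E * 'N[mu]_p[EFin \o F].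
    apply: (le_trans (le_trans _ hn)); last first.
      by rewrite lee_wpmul2r ?Lnorm_ge0// lee_fin ler_norm.
    apply: le_Lnorm => //.
    - by apply: measurable_funeM; apply: mG.
    - by apply/measurable_EFinP; apply: measurable_explift; apply: measurable_funTS; exact: measurable_exotic_integral.
    have [N [mN N0 hN]] := hd F mF F0 nF; exists N; split => // u hu; apply: hN => /= hu'; apply: hu.
    have TE : (exotic_integral nu sigma f (expR u))%:E =
        (kconst nu sigma * expR ((2 * sigma - e) * u))%:E * econv (hker c) F u.
      rewrite -fF; apply: exotic_integral_ge0E => //; first by move=> y _; exact: expunlift_ge0.
      by rewrite fF.
    change (`|(kconst nu sigma)%:E * ((expR (d * u))%:E * econv (hker c) F u)| <=
      `|(expR ((- B + (2 * nu + 2) * rinv q) * u) * exotic_integral nu sigma f (expR u))%:E|).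
    rewrite [X in _ <= `|X|]EFinM TE.
    rewrite le_eqVlt; apply/orP; left; apply/eqP; congr (`|_|).
    rewrite !muleA -!EFinM; congr (_%:E * _); rewrite mulrCA -expRD; congr (_ * expR _)%R.
    by rewrite /d; ring.
  rewrite Lnorm_scale//; last exact: mG.
  by rewrite (mulrC `|C|%R) (EFinM (kconst nu sigma)^-1) -muleA lee_pdivlMl.
split; first exact/(domain_reduction A p1).2.
exists (kconst nu sigma * C)%R => f /wLpE[mf nf].
have mRf := measurable_pow_weight_Rpos mf.
have mA : measurable_fun [set: R] (fun v => `|explift e f v|)%R.
  by apply: measurableT_comp => //; exact: measurable_explift.
have main : wnorm nu (- B) q (exotic_integral nu sigma f) <=
    (kconst nu sigma * C)%:E * wnorm nu A p f.
  rewrite (@wnorm_explift nu (- B) q)//; last exact: mT.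
  rewrite EFinM -muleA (@wnorm_explift nu A p)//.
  apply: (@le_trans _ _ ('N[mu]_q[(fun u => (kconst nu sigma)%:E * ((expR (d * u))%:E * econv (hker c) (fun v => `|explift e f v|)%R u))])).
    apply: le_Lnorm => //.
    - by apply/measurable_EFinP; apply: measurable_explift; apply: measurable_funTS; exact: measurable_exotic_integral.
    - by apply: measurable_funeM; apply: mG.
    exists set0; split => // u hu; exfalso; apply: hu => /=.
    set b := (- B + (2 * nu + 2) * rinv q)%R; set L := explift e f.
    have b0 : 0 <= (expR (b * u))%:E by rewrite lee_fin expR_ge0.
    have step : `|(expR (b * u) * exotic_integral nu sigma f (expR u))%:E| <= (expR (b * u))%:E *
      ((kconst nu sigma * expR ((2 * sigma - e) * u))%:E * econv (hker c) (fun v => `|L v|)%R u).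
      by rewrite EFinM abseM (gee0_abs b0) lee_pmul2l ?lte_fin ?expR_gt0//; exact: exotic_integral_abs_le.
    apply: (le_trans step).
    rewrite gee0_abs; last by rewrite !mule_ge0 ?lee_fin ?expR_ge0 ?econv_ge0// ltW.
    rewrite le_eqVlt; apply/orP; left; apply/eqP.
    rewrite !muleA -!EFinM; congr (_%:E * _); rewrite mulrCA -expRD; congr (_ * expR _)%R.
    by rewrite /d /b; ring.
  rewrite Lnorm_scale//; last exact: mG.
  by rewrite lee_pmul2l// (le_trans (hC _ mA _ _))// ?Lnorm_abs_fun// -wnorm_explift.
by split => //; apply/wLpE; split; [exact: mT|rewrite (le_lt_trans main)//; rewrite lte_mul_pinfty// lee_fin mulr_ge0// ltW].
Qed.

End log_reduction.

(** * Norm inequalities for convolutions with real kernels *)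

Section conv_norms.
Context {R : realType}.
Local Open Scope ereal_scope.
Local Notation mu := (@lebesgue_measure R).
Implicit Types (K F : R -> R) (p q r : R).

Lemma Lnorm_nneg d (T : measurableType d) (m : {measure set T -> \bar R}) r (G : T -> \bar R) :
  (forall u, 0 <= G u) -> 'N[m]_r%:E[G] = (\int[m]_u (G u `^ r)) `^ r^-1.
Proof.
by move=> G0; rewrite Lnorm_ereal; congr (_ `^ _); apply: eq_integral => u _; rewrite gee0_abs.
Qed.

Lemma Lnorm_nnegr d (T : measurableType d) (m : {measure set T -> \bar R}) r (F : T -> R) :
  (forall u, (0 <= F u)%R) -> 'N[m]_r%:E[EFin \o F] = (\int[m]_u (F u `^ r)%:E) `^ r^-1.
Proof.
by move=> F0; rewrite Lnorm_nneg.
Qed.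

Lemma le_poweR_root q (x y : \bar R) : (0 < q)%R -> 0 <= x -> 0 <= y -> x <= y `^ q -> x `^ q^-1 <= y.
Proof.
move=> q0 x0 y0 xy; rewrite -[leRHS](poweRe1 y0) -(divff (lt0r_neq0 q0)) poweRrM.
by apply: gt0_ler_poweR; rewrite ?invr_ge0 ?(ltW q0)// in_itv/= leey ?andbT ?poweR_ge0.
Qed.

Lemma poweRK q (x : \bar R) : (0 < q)%R -> 0 <= x -> (x `^ q^-1) `^ q = x.
Proof. by move=> q0 x0; rewrite -poweRrM mulVf ?gt_eqF// poweRe1. Qed.

Lemma convol_ge0 K F (u : R) : (forall x, (0 <= K x)%R) -> (forall x, (0 <= F x)%R) -> 0 <= convol K F u.
Proof. by move=> K0 F0; apply: integral_ge0 => v _; rewrite lee_fin mulr_ge0. Qed.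

Lemma Lnorm_schur K F p :
  measurable_fun [set: R] K -> measurable_fun [set: R] F ->
  (forall x, (0 <= K x)%R) -> (forall x, (0 <= F x)%R) -> (1 <= p)%R ->
  'N[mu]_p%:E[convol K F] <= (\int[mu]_x (K x)%:E) * 'N[mu]_p%:E[EFin \o F].
Proof.
move=> mK mF K0 F0 p1; have p0 : (0 < p)%R by lra.
have K00 : 0 <= \int[mu]_x (K x)%:E by apply: integral_ge0 => x _; rewrite lee_fin.
rewrite Lnorm_nneg//; last by move=> u; exact: convol_ge0.
apply: le_poweR_root => //; first by apply: integral_ge0 => x _; exact: poweR_ge0.
  by rewrite mule_ge0// Lnorm_ge0.
rewrite Lnorm_nnegr// poweRM ?poweR_ge0// poweRK//; first exact: conv_schur.
by apply: integral_ge0 => x _; rewrite lee_fin powR_ge0.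
Qed.

Lemma Lnorm_conv_L1 K F q :
  measurable_fun [set: R] K -> measurable_fun [set: R] F ->
  (forall x, (0 <= K x)%R) -> (forall x, (0 <= F x)%R) -> (1 <= q)%R ->
  'N[mu]_q%:E[convol K F] <= 'N[mu]_q%:E[EFin \o K] * 'N[mu]_1[EFin \o F].
Proof.
move=> mK mF K0 F0 q1; have q0 : (0 < q)%R by lra.
rewrite Lnorm_nneg//; last by move=> u; exact: convol_ge0.
apply: le_poweR_root => //; first by apply: integral_ge0 => x _; exact: poweR_ge0.
  by rewrite mule_ge0// Lnorm_ge0.
rewrite !Lnorm_nnegr// poweRM ?poweR_ge0// poweRK//; last first.
  by apply: integral_ge0 => x _; rewrite lee_fin powR_ge0.
rewrite invr1 poweRe1; last by apply: integral_ge0 => x _; rewrite lee_fin powR_ge0.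
under [X in _ * X `^ _]eq_integral => x _ do rewrite powRr1//.
by rewrite muleC; exact: conv_L1.
Qed.

Lemma Lnorm_y_le d (T : measurableType d) (m : {measure set T -> \bar R}) (f : T -> \bar R) (M : \bar R) :
  0 <= M -> {ae m, forall x, `|f x| <= M} -> 'N[m]_+oo[f] <= M.
Proof. by move=> M0 fM; rewrite unlock; case: ifPn => // _; exact/ess_supP. Qed.

Lemma ae_le_Lnorm_y (f : R -> \bar R) :
  {ae mu, forall x, `|f x| <= 'N[mu]_+oo[f]}.
Proof. by rewrite Lnorm_y ?lebesgue_setT_gt0//; exact: ess_sup_ge. Qed.

Lemma Lnorm_conv_dual K F p p' :
  measurable_fun [set: R] K -> measurable_fun [set: R] F ->
  (forall x, (0 <= K x)%R) -> (forall x, (0 <= F x)%R) ->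
  (0 < p)%R -> (0 < p')%R -> (p'^-1 + p^-1 = 1)%R ->
  'N[mu]_+oo[convol K F] <= 'N[mu]_p'%:E[EFin \o K] * 'N[mu]_p%:E[EFin \o F].
Proof.
move=> mK mF K0 F0 p0 p'0 pp.
apply: Lnorm_y_le; first by rewrite mule_ge0// Lnorm_ge0.
apply: aeW => u; rewrite gee0_abs ?convol_ge0// !Lnorm_nnegr//.
exact: conv_hoelder.
Qed.

Lemma Lnorm_conv_infty K F :
  measurable_fun [set: R] K -> measurable_fun [set: R] F ->
  (forall x, (0 <= K x)%R) -> (forall x, (0 <= F x)%R) ->
  'N[mu]_+oo[convol K F] <= (\int[mu]_x (K x)%:E) * 'N[mu]_+oo[EFin \o F].
Proof.
move=> mK mF K0 F0.
have K00 : 0 <= \int[mu]_x (K x)%:E by apply: integral_ge0 => x _; rewrite lee_fin.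
apply: Lnorm_y_le; first by rewrite mule_ge0// Lnorm_ge0.
apply: aeW => u; rewrite gee0_abs ?convol_ge0//.
set M := 'N[mu]_+oo[_]; have M0 : 0 <= M by exact: Lnorm_ge0.
rewrite -(ge0_integral_subl (g := fun x => (K x)%:E) u); last 2 first.
- exact/measurable_EFinP.
- by move=> x; rewrite lee_fin.
have mKu : measurable_fun [set: R] (fun v : R => (K (u - v)%R)%:E).
  by apply/measurable_EFinP; apply: (measurableT_comp mK); exact: measurable_funB.
rewrite muleC -ge0_integralZl//; last by move=> v _; rewrite lee_fin.
apply: ae_ge0_le_integral => //.
- by move=> v _; rewrite lee_fin mulr_ge0.
- exact: measurable_conv_slice.
- by move=> v _; rewrite mule_ge0 ?lee_fin.
- exact: measurable_funeM.
have [N [mN N0 hN]] := ae_le_Lnorm_y (EFin \o F); exists N; split => // v hv; apply: hN => hv'; apply: hv => _.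
by rewrite mulrC EFinM lee_wpmul2r ?lee_fin// -(ger0_norm (F0 v)).
Qed.

Lemma Lnorm_conv_bounded K F (M : R) : (0 <= M)%R -> (forall x, (K x <= M)%R) ->
  measurable_fun [set: R] K -> measurable_fun [set: R] F ->
  (forall x, (0 <= K x)%R) -> (forall x, (0 <= F x)%R) ->
  forall u, convol K F u <= M%:E * 'N[mu]_1[EFin \o F].
Proof.
move=> M0 KM mK mF K0 F0 u.
rewrite Lnorm_nnegr// invr1 poweRe1; last by apply: integral_ge0 => x _; rewrite lee_fin powR_ge0.
under [X in _ * X]eq_integral => x _ do rewrite powRr1//.
rewrite -ge0_integralZl//; last 2 first.
- exact/measurable_EFinP.
- by move=> x _; rewrite lee_fin.
apply: ge0_le_integral => //.
- by move=> v _; rewrite lee_fin mulr_ge0.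
- exact: measurable_conv_slice.
- exact/measurable_funeM/measurable_EFinP.
- by move=> v _; rewrite -EFinM lee_fin ler_wpM2r.
Qed.

Lemma Lnorm_hls p q : (1 < p)%R -> (p < q)%R -> exists2 C : R, (0 <= C)%R & forall F,
  measurable_fun [set: R] F -> (forall x, (0 <= F x)%R) ->
  'N[mu]_p%:E[EFin \o F] < +oo ->
  'N[mu]_q%:E[convol (fun w => `|w| `^ (- (1 - p^-1 + q^-1)))%R F] <= C%:E * 'N[mu]_p%:E[EFin \o F].
Proof.
move=> p1 pq; have [C C0 hC] := hardy_littlewood_sobolev p1 pq.
have p0 : (0 < p)%R by lra. have q0 : (0 < q)%R by lra.
set lam := (1 - p^-1 + q^-1)%R in hC *.
pose K := (fun w : R => `|w| `^ (- lam))%R.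
have mK : measurable_fun [set: R] K.
  by apply: (measurableT_comp (measurable_powR _)); exact: normr_measurable.
have K0 x : (0 <= K x)%R by exact: powR_ge0.
exists (C `^ q^-1)%R; first exact: powR_ge0.
move=> F mF F0; set N := 'N[mu]_p%:E[_] => Nfin.
have N0 : 0 <= N by exact: Lnorm_ge0.
have Nf : N \is a fin_num by rewrite ge0_fin_numE.
apply/lee_addgt0Pr => eps eps0.
set C' := (C `^ q^-1)%R; have C'0 : (0 <= C')%R by exact: powR_ge0.
(* Normalizing by slightly more than the norm keeps the divisor positive even when the norm is 0;
   the excess costs at most C' eps / (C' + 1) <= eps. *)
pose D := (fine N + eps / (C' + 1))%R.
have e1 : (0 < eps / (C' + 1))%R by rewrite divr_gt0// ltr_wpDl.
have D0 : (0 < D)%R by rewrite ltr_wpDl// fine_ge0.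
have ND : N <= D%:E by rewrite -(fineK Nf) lee_fin lerDl ltW.
pose G x := (D^-1 * F x)%R.
have mG : measurable_fun [set: R] G by exact: measurable_funM.
have G0 x : (0 <= G x)%R by rewrite mulr_ge0// invr_ge0 ltW.
have hG : \int[mu]_x (G x `^ p)%:E <= 1.
  under eq_integral => x _ do rewrite powRM ?invr_ge0 ?(ltW D0)// EFinM.
  rewrite integral_scale ?powR_ge0//; last first.
    by move=> x; exact: powR_ge0.
    by apply: (measurableT_comp (measurable_powR _)).
  rewrite gt0_powRV// powRN lee_pdivrMl ?powR_gt0// mule1.
  move: ND; rewrite /N Lnorm_nnegr// => ND.
  rewrite -[leLHS](poweRK p0); last by apply: integral_ge0 => x _; rewrite lee_fin powR_ge0.
  rewrite -poweR_EFin; apply: gt0_ler_poweR => //; rewrite ?(ltW p0)// in_itv/= leey andbT.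
    exact: poweR_ge0.
  by rewrite lee_fin ltW.
have -> : convol K F = (fun u => D%:E * convol K G u).
  apply/funext => u; rewrite /convol -ge0_integralZl//; last 3 first.
  - exact: measurable_conv_slice.
  - by move=> v _; rewrite lee_fin mulr_ge0.
  - by rewrite lee_fin ltW.
  apply: eq_integral => v _; rewrite -EFinM /G; congr (_%:E).
  by rewrite mulrCA mulVKf// gt_eqF.
rewrite Lnorm_scale//; last 2 first.
- by rewrite lee_fin; lra.
- exact: measurable_convol.
have hq : 'N[mu]_q%:E[convol K G] <= C'%:E.
  rewrite Lnorm_nneg//; last by move=> u; exact: convol_ge0.
  apply: le_poweR_root => //.
    by apply: integral_ge0 => x _; exact: poweR_ge0.
  by rewrite poweR_EFin -powRrM mulVf ?gt_eqF// powRr1//; exact: hC.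
apply: (le_trans (lee_wpmul2l _ hq)); first by rewrite lee_fin ltW.
rewrite -(fineK Nf) -!EFinM -EFinD lee_fin mulrC /D mulrDr lerD2l mulrCA.
rewrite ger_pMr// ler_pdivrMr ?mul1r ?lerDl//; exact: ltr_wpDl.
Qed.

End conv_norms.

(** * Boundedness of the convolution operator *)

Section conv_bounds.
Context {R : realType}.
Local Open Scope ereal_scope.
Local Notation mu := (@lebesgue_measure R).
Implicit Types (a b c d lam m r t w x y C : R) (F G K : R -> R).

Lemma integral_expRN_abs a : (0 < a)%R ->
  \int[mu]_w (expR (- (a * `|w|)))%:E = (2 / a)%:E.
Proof.
move=> a0; rewrite (@ge0_integral_even _ (fun w => (expR (- (a * w)))%:E)).
- rewrite /Rpos integral_itv_obnd_cbnd.
    by rewrite integral_expRN_ray// mulr0 oppr0 expR0 mul1r -EFinM.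
  by apply/measurable_EFinP; apply: measurableT_comp => //; apply: measurable_funN; exact: measurable_funM.
- by apply/measurable_EFinP; apply: measurableT_comp => //; apply: measurable_funN; exact: measurable_funM.
- by move=> w; rewrite lee_fin expR_ge0.
Qed.

(** Separating the tail from the truncated singularity lets each be integrated in closed form, also
    after taking r-th powers. *)
Definition bker a lam C w : R := (C * (expR (- (a * `|w|)) + `|w| `^ (- lam) * (`|w| < 1)%R%:R))%R.

Lemma bker_ge0 a lam C w : (0 <= C)%R -> (0 <= bker a lam C w)%R.
Proof. by move=> C0; rewrite mulr_ge0// addr_ge0 ?expR_ge0// mulr_ge0 ?powR_ge0. Qed.

Lemma measurable_expRN_abs a : measurable_fun [set: R] (fun w => expR (- (a * `|w|)))%R.
Proof.
by apply: measurableT_comp => //; apply: measurable_funN; exact: measurable_funM.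
Qed.

Lemma measurable_powR_ball lam : measurable_fun [set: R] (fun w => `|w| `^ (- lam) * (`|w| < 1)%R%:R)%R.
Proof.
apply: measurable_funM.
  by apply: (measurableT_comp (measurable_powR _)).
by apply: measurable_natr_bool; apply: measurable_fun_ltr.
Qed.

Lemma measurable_bker a lam C : measurable_fun [set: R] (bker a lam C).
Proof.
apply: measurable_funM => //; apply: measurable_funD; first exact: measurable_expRN_abs.
exact: measurable_powR_ball.
Qed.

Lemma expRN_le1 (x : R) : (0 <= x)%R -> (expR (- x) <= 1)%R.
Proof. by move=> x0; rewrite -expR0 ler_expR oppr_le0. Qed.

Lemma powRD_le (x y r : R) : (0 <= x)%R -> (0 <= y)%R -> (0 <= r)%R ->
  ((x + y) `^ r <= 2 `^ r * (x `^ r + y `^ r))%R.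
Proof.
move=> x0 y0 r0; wlog xy : x y x0 y0 / (x <= y)%R => [H|].
  have [xy|yx] := leP x y; first exact: H.
  by rewrite addrC [X in (_ <= _ * X)%R]addrC H// ltW.
apply: (@le_trans _ _ ((2 * y) `^ r)%R).
  by apply: ge0_ler_powR => //; rewrite ?nnegrE; lra.
rewrite powRM// ler_wpM2l ?powR_ge0// lerDr; exact: powR_ge0.
Qed.

Lemma bker_Lr a lam C r : (0 < a)%R -> (0 < r)%R -> (lam * r < 1)%R -> (0 <= C)%R ->
  \int[mu]_w (bker a lam C w `^ r)%:E < +oo.
Proof.
move=> a0 r0 lr C0.
have CC : (0 <= C `^ r * 2 `^ r)%R by rewrite mulr_ge0 ?powR_ge0.
apply: (@le_lt_trans _ _ (\int[mu]_w ((C `^ r * 2 `^ r)%:E *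
    ((expR (- ((a * r) * `|w|)))%:E + (`|w| `^ (- (lam * r)) * (`|w| < 1)%R%:R)%:E)))).
  apply: ge0_le_integral => //.
  - by move=> w _; rewrite lee_fin powR_ge0.
  - by apply/measurable_EFinP; apply: (measurableT_comp (measurable_powR _)); exact: measurable_bker.
  - apply: measurable_funeM; apply: emeasurable_funD; apply/measurable_EFinP.
      exact: measurable_expRN_abs.
    exact: measurable_powR_ball.
  move=> w _; rewrite -EFinD -EFinM lee_fin /bker powRM//.
  rewrite -[leRHS]mulrA ler_wpM2l ?powR_ge0//.
  apply: (le_trans (powRD_le _ _ (ltW r0))); rewrite ?expR_ge0 ?mulr_ge0 ?powR_ge0//.
  rewrite ler_wpM2l ?powR_ge0// -expRM mulNr (mulrAC a); apply: lerD => //.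
  rewrite powRM ?powR_ge0// -powRrM mulNr ler_wpM2l ?powR_ge0//.
  by case: (_ < _)%R; rewrite ?powR1// powR0// gt_eqF.
rewrite ge0_integralZl//=; last 2 first.
- apply: emeasurable_funD; apply/measurable_EFinP.
    exact: measurable_expRN_abs.
  exact: measurable_powR_ball.
- by move=> w _; rewrite adde_ge0 ?lee_fin ?expR_ge0 ?mulr_ge0 ?powR_ge0.
rewrite ge0_integralD//=; last 2 first.
- by apply/measurable_EFinP; exact: measurable_expRN_abs.
- by apply/measurable_EFinP; exact: measurable_powR_ball.
by rewrite integral_expRN_abs ?mulr_gt0// integral_powR_ball// -EFinD -EFinM ltry.
Qed.

Lemma exists_singularity (sigma r : R) : (1 <= r)%R -> (1 - 2 * sigma < r^-1)%R ->
  exists lam, [/\ (0 < lam)%R, (lam < 1)%R, (1 - 2 * sigma <= lam)%R & (lam * r < 1)%R].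
Proof.
move=> r1 sr; have r0 : (0 < r)%R by lra.
have i0 : (0 < r^-1)%R by rewrite invr_gt0.
have i1 : (r^-1 <= 1)%R by rewrite invf_le1.
(* The midpoint of max(0, 1 - 2 sigma) and 1/r, an interval that the hypotheses make nonempty. *)
exists ((Num.max 0 (1 - 2 * sigma) + r^-1) / 2)%R.
have [h|h] := leP 0%R (1 - 2 * sigma)%R; split; rewrite -?(ltr_pdivlMr _ _ r0) ?div1r; lra.
Qed.

Lemma mulr_ge_Nnorm x y M : (`|y| <= M)%R -> (- (`|x| * M) <= x * y)%R.
Proof.
move=> yM; have h1 : (- (x * y) <= `|x| * `|y|)%R by rewrite -normrM -normrN ler_norm.
have h2 : (`|x| * `|y| <= `|x| * M)%R by rewrite ler_wpM2l.
lra.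
Qed.

(** Families of test functions at scale e^t or e^(-t) yield estimates of this form. If x > y, then t
    = 1 + |M| / (x - y) gives e^(t (x - y)) > |M|. *)
Lemma exp_growth x y M : (forall t, (1 <= t)%R -> (expR (t * x) <= M * expR (t * y))%R) -> (x <= y)%R.
Proof.
move=> h; rewrite leNgt; apply/negP => yx.
pose t := (1 + `|M| / (x - y))%R.
have xy0 : (0 < x - y)%R by rewrite subr_gt0.
have t1 : (1 <= t)%R by rewrite /t lerDl divr_ge0// ltW.
have := h t t1; rewrite -ler_pdivrMr ?expR_gt0// -expRB -mulrBr => hM.
have := expR_ge1Dx (t * (x - y))%R.
have : (t * (x - y) = x - y + `|M|)%R by rewrite /t mulrDl mul1r divfK// gt_eqF.
by have := ler_norm M; lra.
Qed.

Lemma indic_itvE a b x : \1_`[a, b] x = (a <= x <= b)%R%:R :> R.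
Proof. by rewrite indicE; congr (nat_of_bool _)%:R; apply/idP/idP; rewrite inE/= in_itv. Qed.

Lemma integral_itv_scale a b m : (a <= b)%R -> (0 <= m)%R ->
  \int[mu]_x (m * \1_`[a, b] x)%:E = (m * (b - a))%:E.
Proof.
move=> ab m0; under eq_integral do rewrite EFinM.
rewrite integral_scale// integral_indic ?setIT//= lebesgue_measure_itv/= lte_fin.
case: ltP => // ba; have -> : a = b by apply/eqP; rewrite eq_le ab.
by rewrite subrr mule0 mulr0.
Qed.

Lemma Lnorm_indic_le (p : \bar R) a b : 1 <= p -> (a < b)%R ->
  'N[mu]_p[EFin \o \1_`[a, b]] <= ((b - a) `^ rinv p)%:E.
Proof.
move=> + ab; case: p => [r r1|_|//].
  have r0 := gt0_of_ge1e r1.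
  rewrite Lnorm_nnegr// rinv_real// -poweR_EFin.
  have -> : \int[mu]_x (\1_`[a, b] x `^ r)%:E = (b - a)%:E; last by [].
  rewrite -[in RHS](mul1r (b - a)%R) -integral_itv_scale ?ltW//.
  apply: eq_integral => x _; rewrite mul1r indicE; case: (_ \in _) => /=.
    by rewrite powR1.
  by rewrite powR0// gt_eqF.
rewrite rinvy powRr0; apply: Lnorm_y_le => //; apply: aeW => x /=.
by rewrite lee_fin ger0_norm// indicE; case: (_ \in _).
Qed.

Lemma Lnorm_ge (q : \bar R) (g : R -> \bar R) a b m : 1 <= q -> (a < b)%R -> (0 <= m)%R ->
  measurable_fun [set: R] g -> (forall x, 0 <= g x) ->
  (forall x, (a <= x <= b)%R -> m%:E <= g x) ->
  (m * (b - a) `^ rinv q)%:E <= 'N[mu]_q[g].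
Proof.
move=> + ab m0 mg g0 h; case: q => [r r1|_|//].
  have r0 := gt0_of_ge1e r1.
  rewrite Lnorm_nneg// rinv_real//.
  have -> : (m * (b - a) `^ r^-1)%:E = ((m `^ r * (b - a))%:E) `^ r^-1.
    rewrite poweR_EFin powRM ?powR_ge0// ?subr_ge0 ?ltW//.
    by rewrite -powRrM divff ?gt_eqF// powRr1.
  apply: gt0_ler_poweR; rewrite ?invr_ge0 ?(ltW r0)// ?in_itv/= ?leey ?andbT.
  - by rewrite lee_fin mulr_ge0 ?powR_ge0// subr_ge0 ltW.
  - by apply: integral_ge0 => x _; exact: poweR_ge0.
  rewrite -integral_itv_scale ?powR_ge0 ?(ltW ab)//.
  apply: ge0_le_integral => //.
  - by move=> x _; rewrite lee_fin mulr_ge0 ?powR_ge0.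
  - by apply/measurable_EFinP; apply: measurable_funM => //; exact: measurable_indic.
  - exact: (measurableT_comp (measurable_poweR r)).
  move=> x _; rewrite indic_itvE; have [hx|_] := boolP (a <= x <= b)%R; last by rewrite mulr0 poweR_ge0.
  rewrite mulr1 -poweR_EFin.
  by apply: gt0_ler_poweR; rewrite ?(ltW r0)// ?in_itv/= ?leey ?andbT ?lee_fin// h.
rewrite rinvy powRr0 mulr1; rewrite leNgt; apply/negP => hlt.
have [N [mN N0 hN]] := ae_le_Lnorm_y g.
have : mu `[a, b] <= mu N.
  apply: le_measure; rewrite ?inE//; move=> x /=; rewrite in_itv/= => hx; apply: hN => /= hx'.
  have := le_lt_trans (le_trans (h x hx) (le_trans _ hx')) hlt; rewrite gee0_abs// ltxx.
  by move=> /(_ (lexx _)).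
by rewrite N0 lebesgue_measure_itv/= lte_fin ab -EFinD lee_fin subr_le0 leNgt ab.
Qed.

Lemma measurable_inv_itv a b : (0 < a)%R ->
  measurable_fun [set: R] (fun x => x^-1 * \1_`[a, b] x)%R.
Proof.
move=> a0; apply: (eq_measurable_fun (fun x => x `^ (-1) * \1_`[a, b] x)%R).
  move=> x _; rewrite indic_itvE; have [/andP[ax _]|_] := boolP (a <= x <= b)%R; last by rewrite !mulr0.
  by rewrite powR_inv1// (le_trans (ltW a0)).
by apply: measurable_funM; [exact: measurable_powR|exact: measurable_indic].
Qed.

Lemma inv_itv_ge0 a b x : (0 < a)%R -> (0 <= x^-1 * \1_`[a, b] x)%R.
Proof.
move=> a0; rewrite indic_itvE; have [/andP[ax _]|_] := boolP (a <= x <= b)%R; last by rewrite mulr0.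
by rewrite mulr1 invr_ge0 (le_trans (ltW a0)).
Qed.

Lemma integral_inv_itv a b : (0 < a)%R -> (a <= b)%R ->
  \int[mu]_x (x^-1 * \1_`[a, b] x)%:E = (ln b - ln a)%:E.
Proof.
move=> a0 ab.
transitivity (\int[mu]_(x in `]a, b]) (x^-1)%:E).
  rewrite integral_itv_obnd_cbnd; last first.
    apply/measurable_EFinP; apply: (eq_measurable_fun (fun x => x `^ (-1))%R).
      move=> x; rewrite inE/= in_itv/= => /andP[ax _].
      by rewrite powR_inv1// ltW// (lt_trans a0).
    by apply: measurable_funTS; exact: measurable_powR.
  rewrite [RHS]integral_mkcond; apply: eq_integral => x _; rewrite patchE indicE.
  by case: (_ \in _); rewrite ?mulr1 ?mulr0.
have [->|/eqP nab] := eqVneq a b; first by rewrite set_itvoc0 ?integral_set0 ?subrr.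
apply: integral_ocitv_FTC.
- by rewrite lt_neqAle ab andbT; apply/eqP.
- by move=> x; rewrite in_itv/= => /andP[ax _]; apply: inv_continuous; rewrite gt_eqF// (lt_le_trans a0).
- by move=> x; rewrite in_itv/= => /andP[ax _]; apply: is_derive1_ln; rewrite (lt_le_trans a0).
Qed.

Variables (nu sigma : R).
Hypotheses (nu1 : (nu < 1)%R) (sigma0 : (0 < sigma)%R) (sigma1 : (sigma < - nu + 1)%R).
Local Notation s := (1 - nu - sigma)%R.

Lemma hker_le c lam : (`|c| <= s)%R -> (0 <= lam < 1)%R -> (1 - 2 * sigma <= lam)%R ->
  (0 < lam)%R \/ (1 < 2 * sigma)%R ->
  exists2 C, (0 < C)%R & forall w, w != 0%R -> hker nu sigma c w <= (bker (s - `|c|) lam C w)%:E.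
Proof.
move=> cs l01 ls lsig; have [C C0 hC] := kprof_le nu1 sigma0 sigma1 l01 ls lsig.
move/andP: l01 => [l0 l1].
(* For |w| >= 1 the singular term is at most 1 and is absorbed by the exponential; hence the factor
   2. *)
exists (2 * C)%R; first by rewrite mulr_gt0.
move=> w w0; rewrite /hker.
apply: (le_trans (lee_wpmul2l _ (hC w w0))); first by rewrite lee_fin expR_ge0.
rewrite -EFinM lee_fin /bker mulrCA [leRHS]mulrAC [leRHS]mulrC ler_wpM2l ?(ltW C0)//.
have w1 : (0 < `|w|)%R by rewrite normr_gt0.
have hh : (expR (c * w) * expR (- (s * `|w|)) <= expR (- ((s - `|c|) * `|w|)))%R.
  rewrite -expRD ler_expR; have : (c * w <= `|c| * `|w|)%R by rewrite -normrM ler_norm.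
  lra.
rewrite mulrA; set e1 := (_ * _)%R in hh *; set e2 := expR _ in hh *.
have e21 : (e2 <= 1)%R.
  by rewrite /e2 expRN_le1// mulr_ge0// subr_ge0.
have e10 : (0 <= e1)%R by rewrite mulr_ge0 ?expR_ge0.
have p0 : (0 <= `|w| `^ (- lam))%R by exact: powR_ge0.
case: (ltP `|w|%R 1%R) => hw /=; last first.
  have p1 : (`|w| `^ (- lam) <= 1)%R.
    by rewrite -(powRr0 `|w|) ler_powR// oppr_le0.
  nra.
nra.
Qed.

(** The majorant may fail only where the kernel is evaluated at 0, that is at the single point v =
    u. *)
Lemma econv_le_convol c K F (u : R) : measurable_fun [set: R] K -> measurable_fun [set: R] F ->
  (forall x, (0 <= K x)%R) -> (forall x, (0 <= F x)%R) ->
  (forall w, w != 0%R -> hker nu sigma c w <= (K w)%:E) ->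
  econv (hker nu sigma c) F u <= convol K F u.
Proof.
move=> mK mF K0 F0 hK; apply: ae_ge0_le_integral => //.
- by move=> v _; rewrite mule_ge0 ?hker_ge0// lee_fin.
- exact: measurable_econv_slice.
- by move=> v _; rewrite lee_fin mulr_ge0.
- exact: measurable_conv_slice.
exists [set u]; split; [exact: measurable_set1|exact: lebesgue_measure_set1|].
move=> v /= hv; apply: contrapT => vu; apply: hv => _.
rewrite EFinM lee_wpmul2r ?lee_fin// hK// subr_eq0 eq_sym; exact/eqP.
Qed.

Lemma conv_bounded_of_kernel c K C (p q : \bar R) : 1 <= q -> measurable_fun [set: R] K ->
  (forall x, (0 <= K x)%R) ->
  (forall w, w != 0%R -> hker nu sigma c w <= (K w)%:E) -> (0 <= C)%R ->
  (forall F, measurable_fun [set: R] F -> (forall x, (0 <= F x)%R) ->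
    'N[mu]_p[EFin \o F] < +oo -> 'N[mu]_q[convol K F] <= C%:E * 'N[mu]_p[EFin \o F]) ->
  conv_bounded nu sigma c 0 p q.
Proof.
move=> q1 mK K0 hK C0 hC; exists C => // F mF F0 nF; apply: le_trans (hC F mF F0 nF).
apply: le_Lnorm => //.
- under eq_fun do rewrite mul0r expR0 mul1e; exact: measurable_econv.
- exact: measurable_convol.
apply: aeW => u; rewrite mul0r expR0 mul1e !gee0_abs ?econv_ge0 ?convol_ge0//.
exact: econv_le_convol.
Qed.

Lemma hker_majorant c r : (`|c| < s)%R -> (1 <= r)%R -> (1 - 2 * sigma < r^-1)%R ->
  exists K : R -> R, [/\ measurable_fun [set: R] K, forall x, (0 <= K x)%R,
    forall w, w != 0%R -> hker nu sigma c w <= (K w)%:E &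
    \int[mu]_w (K w `^ r)%:E < +oo].
Proof.
move=> cs r1 sr; have [lam [l0 l1 ls lr]] := exists_singularity r1 sr.
have [C C0 hC] := @hker_le c lam (ltW cs) (introT andP (conj (ltW l0) l1)) ls (or_introl l0).
exists (bker (s - `|c|) lam C); split => //; first exact: measurable_bker.
  by move=> x; apply: bker_ge0; exact: ltW.
by apply: bker_Lr; rewrite ?subr_gt0 ?(ltW C0)//; exact: lt_le_trans r1.
Qed.

Lemma conv_bounded_diag c (p : \bar R) : (`|c| < s)%R -> 1 <= p -> conv_bounded nu sigma c 0 p p.
Proof.
move=> cs p1; have [n1 n2 n3] := And3 nu1 sigma0 sigma1.
have [//||K [mK K0 hC]] := @hker_majorant c 1 cs; first by rewrite invr1; lra.
under eq_integral do rewrite powRr1//.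
have I0 : 0 <= \int[mu]_w (K w)%:E by apply: integral_ge0 => x _; rewrite lee_fin.
rewrite -ge0_fin_numE// => Ifin.
apply: (conv_bounded_of_kernel (K := K) (C := fine (\int[mu]_w (K w)%:E))) => //.
  exact: fine_ge0.
move=> F mF F0 nF; rewrite fineK//; case: p p1 nF => [r r1 _|_ _|//].
  by apply: Lnorm_schur; rewrite // -lee_fin.
exact: Lnorm_conv_infty.
Qed.

Lemma conv_bounded_L1_Lq c (q : R) : (`|c| < s)%R -> (1 <= q)%R -> (1 - 2 * sigma < q^-1)%R ->
  conv_bounded nu sigma c 0 1 q%:E.
Proof.
move=> cs q1 sq; have q0 : (0 < q)%R by lra.
have [K [mK K0 hC Kq]] := hker_majorant cs q1 sq.
have Nfin : 'N[mu]_q%:E[EFin \o K] \is a fin_num.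
  by rewrite ge0_fin_numE ?Lnorm_ge0// Lnorm_nnegr// poweR_lty.
apply: (conv_bounded_of_kernel (K := K) (C := fine 'N[mu]_q%:E[EFin \o K])) => //.
  by rewrite fine_ge0// Lnorm_ge0.
by move=> F mF F0 nF; rewrite fineK//; exact: Lnorm_conv_L1.
Qed.

Lemma conv_bounded_dual c (p : R) : (`|c| < s)%R -> (1 < p)%R -> (p^-1 < 2 * sigma)%R ->
  conv_bounded nu sigma c 0 p%:E +oo.
Proof.
move=> cs p1 sp; have p0 : (0 < p)%R by lra.
have ip : (p^-1 < 1)%R by rewrite invf_lt1.
have ip0 : (0 < p^-1)%R by rewrite invr_gt0.
pose p' := ((1 - p^-1)^-1)%R; have p'i : (p'^-1 = 1 - p^-1)%R by rewrite invrK.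
have p'1 : (1 <= p')%R by rewrite invf_ge1; lra.
have p'0 : (0 < p')%R by lra.
have [|K [mK K0 hC Kq]] := hker_majorant cs p'1; first by rewrite p'i; lra.
have Nfin : 'N[mu]_p'%:E[EFin \o K] \is a fin_num.
  by rewrite ge0_fin_numE ?Lnorm_ge0// Lnorm_nnegr// poweR_lty.
apply: (conv_bounded_of_kernel (K := K) (C := fine 'N[mu]_p'%:E[EFin \o K])) => //.
- exact: leey.
- by rewrite fine_ge0// Lnorm_ge0.
move=> F mF F0 nF; rewrite fineK//; apply: Lnorm_conv_dual => //.
by rewrite p'i subrK.
Qed.

(** Boundedness of the kernel is all that is needed here, not decay; this is why |c| = s is allowed
    for p = q' = 1. *)
Lemma conv_bounded_L1_Linfty c : (`|c| <= s)%R -> (1 < 2 * sigma)%R ->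
  conv_bounded nu sigma c 0 1 +oo.
Proof.
move=> cs s2.
have ls : (1 - 2 * sigma <= 0)%R by lra.
have [C C0 hC] := @hker_le c 0%R cs (introT andP (conj (lexx 0%R) ltr01)) ls (or_intror s2).
set K := bker _ _ _ in hC; have mK : measurable_fun [set: R] K by exact: measurable_bker.
have K0 x : (0 <= K x)%R by apply: bker_ge0; exact: ltW.
have KM x : (K x <= C * 2)%R.
  rewrite /K /bker ler_wpM2l ?(ltW C0)// oppr0 powRr0 mul1r.
  have -> : (2 = 1 + 1 :> R)%R by lra.
  apply: lerD; last by case: (_ < _)%R.
  by rewrite expRN_le1// mulr_ge0// subr_ge0.
have C2 : (0 <= C * 2)%R by rewrite mulr_ge0// ltW.
apply: (conv_bounded_of_kernel (K := K) (C := C * 2)%R) => //; first exact: leey.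
move=> F mF F0 nF; apply: Lnorm_y_le; first by rewrite mule_ge0// Lnorm_ge0.
apply: aeW => u; rewrite gee0_abs ?convol_ge0//.
exact: Lnorm_conv_bounded.
Qed.

Lemma conv_bounded_hls c (p q : R) : (`|c| < s)%R -> (1 < p)%R -> (p < q)%R ->
  (- (2 * sigma) <= q^-1 - p^-1)%R ->
  conv_bounded nu sigma c 0 p%:E q%:E.
Proof.
move=> cs p1 pq hs; have [C C0 hC] := Lnorm_hls p1 pq.
have p0 : (0 < p)%R by lra. have q0 : (0 < q)%R by lra.
have ip : (p^-1 < 1)%R by rewrite invf_lt1.
have ip0 : (0 < p^-1)%R by rewrite invr_gt0.
have iq0 : (0 < q^-1)%R by rewrite invr_gt0.
have iqp : (q^-1 < p^-1)%R by rewrite ltf_pV2.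
set lam := (1 - p^-1 + q^-1)%R in hC.
have l0 : (0 < lam)%R by rewrite /lam; lra.
have l1 : (lam < 1)%R by rewrite /lam; lra.
have ls : (1 - 2 * sigma <= lam)%R by rewrite /lam; lra.
have [D D0 hD] := @hker_le c lam (ltW cs) (introT andP (conj (ltW l0) l1)) ls (or_introl l0).
set a := (s - `|c|)%R in hD; have a0 : (0 < a)%R by rewrite subr_gt0.
pose P w := (`|w| `^ (- lam))%R.
(* The exponential is dominated by the pure power as well: |w|^lam e^(-a|w|) <= (1 + |w|) e^(-a|w|)
   <= 1 + 1/a. The last 1 is for the truncated singularity. *)
pose M := (D * (1 + a^-1 + 1))%R.
have ia : (0 < a^-1)%R by rewrite invr_gt0.
have M0 : (0 < M)%R by rewrite mulr_gt0//; lra.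
have hM w : w != 0%R -> hker nu sigma c w <= (M * P w)%:E.
  move=> w0; apply: (le_trans (hD w w0)); rewrite lee_fin /bker /M -mulrA ler_wpM2l ?(ltW D0)//.
  have w1 : (0 < `|w|)%R by rewrite normr_gt0.
  have P0 : (0 < P w)%R by rewrite powR_gt0.
  rewrite [leRHS]mulrDl [X in (_ <= _ + X)%R]mul1r; apply: lerD; last first.
    by case: (_ < _)%R; rewrite ?mulr1// mulr0 ltW.
  have Pi : (`|w| `^ lam * P w = 1)%R by rewrite -gt0_powRD// subrr powRr0.
  rewrite -[leLHS]mulr1 -[X in (_ * X <= _)%R]Pi mulrA ler_wpM2r ?(ltW P0)//.
  have h1 : (`|w| `^ lam <= 1 + `|w|)%R.
    have [w2|w2] := leP `|w|%R 1%R.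
      apply: (@le_trans _ _ 1%R); last by rewrite lerDl.
      by apply: (@le_trans _ _ (1 `^ lam)%R); [rewrite ge0_ler_powR ?nnegrE// ltW|rewrite powR1].
    apply: (@le_trans _ _ (`|w| `^ 1)%R); first by rewrite ler_powR// ltW.
    by rewrite powRr1// lerDr.
  have h2 : (expR (- (a * `|w|)) * (a * `|w|) <= 1)%R.
    rewrite expRN ler_pdivrMl ?expR_gt0// mulr1.
    by have := expR_ge1Dx (a * `|w|)%R; lra.
  have h3 : (expR (- (a * `|w|)) <= 1)%R.
    by rewrite expRN_le1// mulr_ge0// ltW.
  have h4 : (expR (- (a * `|w|)) * `|w| <= a^-1)%R.
    by rewrite -[leRHS]mul1r ler_pdivlMr// -mulrA (mulrC `|w|%R).
  apply: (@le_trans _ _ (expR (- (a * `|w|)) * (1 + `|w|))%R).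
    by rewrite ler_wpM2l ?expR_ge0.
  by rewrite mulrDr mulr1; exact: lerD.
have mP : measurable_fun [set: R] P by apply: (measurableT_comp (measurable_powR _)).
have P0 x : (0 <= P x)%R by exact: powR_ge0.
apply: (conv_bounded_of_kernel (K := fun w => (M * P w)%R) (C := (M * C)%R)) => //.
- by rewrite lee_fin; lra.
- exact: measurable_funM.
- by move=> x; rewrite mulr_ge0// ltW.
- by rewrite mulr_ge0// ltW.
move=> F mF F0 nF.
have -> : convol (fun w => M * P w)%R F = (fun u => M%:E * convol P F u).
  apply/funext => u; rewrite /convol -ge0_integralZl//; last 3 first.
  - exact: measurable_conv_slice.
  - by move=> v _; rewrite lee_fin mulr_ge0.
  - by rewrite lee_fin ltW.
  by apply: eq_integral => v _; rewrite -EFinM mulrA.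
rewrite Lnorm_scale//; last 2 first.
- by rewrite lee_fin; lra.
- exact: measurable_convol.
by rewrite (EFinM M) -muleA lee_pmul2l//; exact: hC.
Qed.

Lemma finite_Lnorm_ae (p : \bar R) (f : R -> \bar R) : 1 <= p -> measurable_fun [set: R] f ->
  (forall x, 0 <= f x) -> 'N[mu]_p[f] < +oo -> {ae mu, forall x, f x < +oo}.
Proof.
move=> p1 mf f0; case: p p1 => [r r1|_|//].
  have r0 := gt0_of_ge1e r1.
  rewrite Lnorm_nneg// => h.
  have h2 : \int[mu]_u (f u `^ r) < +oo.
    by move: h; apply: lty_poweRy; rewrite invr_eq0 gt_eqF.
  have : mu.-integrable [set: R] (fun u => f u `^ r).
    apply/integrableP; split; first exact: (measurableT_comp (measurable_poweR r)).
    by under eq_integral => u _ do rewrite gee0_abs ?poweR_ge0//.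
  move=> /integrable_ae -/(_ measurableT)[N [mN N0 hN]]; exists N; split => // u hu.
  apply: hN => hu'; apply: hu => /=; have := hu' I; rewrite ge0_fin_numE ?poweR_ge0//.
  by apply: lty_poweRy; rewrite gt_eqF.
move=> h; have [N [mN N0 hN]] := ae_le_Lnorm_y f; exists N; split => // u hu.
by apply: hN => /= hu'; apply: hu => /=; rewrite -(gee0_abs (f0 u)); exact: le_lt_trans hu' h.
Qed.

Lemma finite_ae_strict c (p : \bar R) : (`|c| < s)%R -> 1 <= p -> finite_ae nu sigma c p.
Proof.
move=> cs p1 F mF F0 nF; have [C C0 hC] := conv_bounded_diag cs p1.
apply: (finite_Lnorm_ae p1).
- exact: measurable_econv.
- by move=> u; exact: econv_ge0.
have := hC F mF F0 nF; under [X in 'N[mu]_p[X] <= _]eq_fun do rewrite mul0r expR0 mul1e.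
by move/le_lt_trans; apply; rewrite lte_mul_pinfty// lee_fin.
Qed.

(** At |c| = s the kernel need not be integrable, but it is at most a constant plus an integrable
    function. The constant contributes a multiple of the L^1 norm, and the rest is covered by
    Schur's test. *)
Lemma finite_ae_L1 c : (`|c| <= s)%R -> finite_ae nu sigma c 1.
Proof.
move=> cs F mF F0 nF; have [n1 n2 n3] := And3 nu1 sigma0 sigma1.
have [//||lam [l0 l1 ls lr]] := @exists_singularity sigma 1; first by rewrite invr1; lra.
have [C C0 hC] := @hker_le c lam cs (introT andP (conj (ltW l0) l1)) ls (or_introl l0).
pose K := bker 1 lam C; have mK : measurable_fun [set: R] K by exact: measurable_bker.
have K0 x : (0 <= K x)%R by apply: bker_ge0; exact: ltW.
have : \int[mu]_w (K w `^ 1)%:E < +oo by apply: bker_Lr; rewrite ?ltW//.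
under eq_integral do rewrite powRr1//.
move=> Ifin.
have fin1 : {ae mu, forall u, convol K F u < +oo}.
  apply: (@finite_Lnorm_ae 1) => //.
  - exact: measurable_convol.
  - by move=> u; exact: convol_ge0.
  apply: (le_lt_trans (Lnorm_schur _ _ _ _ _)) => //.
  by rewrite lte_mul_pinfty// ?ge0_fin_numE//; apply: integral_ge0 => x _; rewrite lee_fin.
have [N [mN N0 hN]] := fin1; exists N; split => // u hu; apply: hN => /= hu'; apply: hu.
have hK w : w != 0%R -> hker nu sigma c w <= (C + K w)%:E.
  move=> w0; apply: (le_trans (hC w w0)); rewrite lee_fin /K /bker !mulrDr.
  rewrite addrA lerD2r; apply: ler_wpDr; first by rewrite mulr_ge0 ?expR_ge0// ltW.
  by rewrite -[leRHS]mulr1 ler_wpM2l ?(ltW C0)// expRN_le1// mulr_ge0// subr_ge0.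
change (econv (hker nu sigma c) F u < +oo).
apply: (@le_lt_trans _ _ (convol (fun w => C + K w)%R F u)).
  apply: econv_le_convol => //; first exact: measurable_funD.
  by move=> x; rewrite addr_ge0// ltW.
have -> : convol (fun w => C + K w)%R F u = convol (fun=> C) F u + convol K F u.
  rewrite /convol -ge0_integralD//.
  - by apply: eq_integral => v _; rewrite -EFinD mulrDl.
  - by move=> v _; rewrite lee_fin mulr_ge0// ltW.
  - exact: (measurable_conv_slice (K := fun=> C)).
  - by move=> v _; rewrite lee_fin mulr_ge0.
  - exact: measurable_conv_slice.
rewrite lte_add_pinfty//.
have h := Lnorm_conv_bounded (K := fun=> C) (ltW C0) (fun=> lexx C) (measurable_cst C) mF (fun=> ltW C0) F0 u.
apply: (le_lt_trans h).
by rewrite lte_mul_pinfty// lee_fin ltW.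
Qed.

Lemma conv_bounded_suff c (p q : \bar R) : (`|c| < s)%R -> 1 <= p -> p <= q ->
  (- (2 * sigma) < rinv q - rinv p ?<= if (~~ ((p == 1%E) || (q == +oo%E))))%R ->
  conv_bounded nu sigma c 0 p q.
Proof.
move=> cs; case: p => [r r1|_|//]; last first.
  by rewrite leye_eq => /eqP -> _; apply: conv_bounded_diag => //; exact: leey.
have r0 := gt0_of_ge1e r1.
case: q => [t|_|//].
  rewrite lee_fin le_eqVlt => /orP[/eqP <- _|rt]; first exact: conv_bounded_diag.
  have t0 : (0 < t)%R by lra.
  rewrite orbF !rinv_real//; have [r11|rn1] := eqVneq r%:E 1.
    case: r11 => {r1} r1; subst r; rewrite /= invr1 => h.
    apply: conv_bounded_L1_Lq; [by []|lra|lra].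
  rewrite /= => h; apply: conv_bounded_hls => //.
  by rewrite lt_neqAle -lee_fin r1 andbT eq_sym; move: rn1; rewrite eqe.
rewrite eqxx orbT rinv_real// rinvy sub0r => h.
have [r11|rn1] := eqVneq r%:E 1.
  by case: r11 => ?; subst r; apply: conv_bounded_L1_Linfty; [exact: ltW|move: h; rewrite /= invr1; lra].
apply: conv_bounded_dual => //.
  by rewrite lt_neqAle -lee_fin r1 andbT eq_sym; move: rn1; rewrite eqe.
by move: h => /=; lra.
Qed.

(** * Necessity: lower bounds and test functions *)

Local Notation H := (hker nu sigma).

Lemma hker_ge c : exists2 k : R, (0 < k)%R &
  forall w : R, (k * expR (c * w - s * `|w|))%:E <= H c w.
Proof.
have [k k0 hk] := kprof_ge_exp nu1 sigma0 sigma1; exists k => // w.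
rewrite /hker expRD mulrCA EFinM lee_wpmul2l ?lee_fin ?expR_ge0//; exact: hk.
Qed.

Lemma hker_ge_near c M : (0 <= M)%R -> exists2 k : R, (0 < k)%R &
  forall w : R, (`|w| <= M)%R -> k%:E <= H c w.
Proof.
move=> M0; have [k k0 hk] := hker_ge c; have [n1 n2 n3] := And3 nu1 sigma0 sigma1; have s0 : (0 < s)%R by lra.
exists (k * expR (- ((`|c| + s) * M)))%R; first by rewrite mulr_gt0 ?expR_gt0.
move=> w wM; apply: le_trans (hk w); rewrite lee_fin ler_wpM2l ?(ltW k0)// ler_expR.
have h1 := mulr_ge_Nnorm c wM; have h2 : (s * `|w| <= s * M)%R by rewrite ler_wpM2l// ltW.
by rewrite mulrDl; lra.
Qed.

Lemma econv_ge c F G (u : R) : measurable_fun [set: R] F -> (forall v, (0 <= F v)%R) ->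
  measurable_fun [set: R] G -> (forall v, (0 <= G v)%R) ->
  (forall v, v != u -> (G v)%:E <= H c (u - v)%R * (F v)%:E) ->
  \int[mu]_v (G v)%:E <= econv (H c) F u.
Proof.
move=> mF F0 mG G0 h; apply: ae_ge0_le_integral => //.
- by move=> v _; rewrite lee_fin.
- exact/measurable_EFinP.
- by move=> v _; rewrite mule_ge0 ?hker_ge0// lee_fin.
- exact: measurable_econv_slice.
exists [set u]; split; [exact: measurable_set1|exact: lebesgue_measure_set1|].
move=> v /= hv; apply: contrapT => vu; apply: hv => _.
by apply: h; apply/eqP.
Qed.

Lemma econv_indic_ge c a b a' b' m (u : R) : (0 <= m)%R -> (a <= a')%R -> (a' <= b')%R -> (b' <= b)%R ->
  (forall v, (a' <= v <= b')%R -> v != u -> m%:E <= H c (u - v)%R) ->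
  (m * (b' - a'))%:E <= econv (H c) \1_`[a, b] u.
Proof.
move=> m0 aa ab bb h; rewrite -integral_itv_scale//.
apply: econv_ge => //.
- by apply: measurable_funM => //; exact: measurable_indic.
- by move=> v; rewrite mulr_ge0.
move=> v vu; rewrite !indic_itvE; have [hv|_] := boolP (a' <= v <= b')%R; last first.
  by rewrite mulr0 mule_ge0 ?hker_ge0 ?lee_fin.
have /andP[h1 h2] := hv; rewrite (le_trans aa h1) (le_trans h2 bb)/= mulr1 mule1.
exact: h.
Qed.

Lemma conv_bounded_test c d (p q : \bar R) : 1 <= p -> 1 <= q -> conv_bounded nu sigma c d p q ->
  exists2 C : R, (0 <= C)%R & forall a b a' b' m, (a < b)%R -> (a' < b')%R -> (0 <= m)%R ->
   (forall u, (a' <= u <= b')%R -> m%:E <= (expR (d * u))%:E * econv (H c) \1_`[a, b] u) ->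
   (m * (b' - a') `^ rinv q <= C * (b - a) `^ rinv p)%R.
Proof.
move=> p1 q1 [C C0 hC]; exists C => // a b a' b' m ab ab' m0 h; rewrite -lee_fin.
have mI : measurable_fun [set: R] (\1_`[a, b] : R -> R) by exact: measurable_indic.
have NI := Lnorm_indic_le p1 ab.
apply: le_trans (le_trans (hC _ mI _ (le_lt_trans NI (ltry _))) _) => //.
- apply: Lnorm_ge => //.
    apply: emeasurable_funM; last exact: measurable_econv.
    by apply/measurable_EFinP; exact: measurable_expRM.
  by move=> x; rewrite mule_ge0 ?lee_fin ?expR_ge0// econv_ge0.
- by rewrite EFinM lee_wpmul2l ?lee_fin.
Qed.

(** Convolution commutes with translations, so testing on [t, t + 1] bounds e^(d t) uniformly over
    all real t, of either sign. *)
Lemma conv_bounded_homogeneous c d (p q : \bar R) : 1 <= p -> 1 <= q ->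
  conv_bounded nu sigma c d p q -> d = 0%R.
Proof.
move=> p1 q1 /(conv_bounded_test p1 q1)[C C0 hC].
have [k k0 hk] := hker_ge_near c ler01.
have h t : (k * expR (- `|d|) * expR (d * t) <= C)%R.
  have t1 : (t < t + 1)%R by rewrite ltrDl.
  have := hC t (t + 1)%R t (t + 1)%R (k * expR (- `|d|) * expR (d * t))%R t1 t1.
  rewrite (_ : t + 1 - t = 1)%R; last by lra.
  rewrite !powR1 !mulr1; apply; first by rewrite !mulr_ge0 ?expR_ge0// ltW.
  move=> u /andP[tu ut]; apply: (@le_trans _ _ ((expR (d * u))%:E * k%:E)).
    rewrite -EFinM lee_fin -mulrA mulrC ler_wpM2r ?(ltW k0)// -expRD ler_expR.
    have ut1 : (`|u - t| <= 1)%R by rewrite ler_norml; lra.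
    by have := mulr_ge_Nnorm d ut1; lra.
  rewrite lee_wpmul2l ?lee_fin ?expR_ge0//.
  have -> : k = (k * (t + 1 - t))%R by lra.
  apply: econv_indic_ge => //; [exact: ltW|exact: ltW|].
  by move=> v /andP[tv vt] _; apply: hk; rewrite ler_norml; lra.
pose M := (C / (k * expR (- `|d|)))%R.
have hM t : (expR (d * t) <= M)%R.
  by rewrite /M ler_pdivlMr ?mulr_gt0 ?expR_gt0// mulrC.
apply/eqP; rewrite eq_le; apply/andP; split.
  by apply: (@exp_growth _ _ M) => t _; rewrite mulr0 expR0 mulr1 mulrC.
rewrite -oppr_le0; apply: (@exp_growth _ _ M) => t _.
by rewrite mulr0 expR0 mulr1 mulrN -mulNr mulrC.
Qed.

Lemma conv_bounded_le c (p q : \bar R) : 1 <= p -> 1 <= q ->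
  conv_bounded nu sigma c 0 p q -> (rinv q <= rinv p)%R.
Proof.
move=> p1 q1 /(conv_bounded_test p1 q1)[C C0 hC].
have [k k0 hk] := hker_ge_near c ler01.
apply: (@exp_growth _ _ (C / k)) => t t1; rewrite !expRM -mulrA mulrCA ler_pdivlMl//.
have N2 : (2 <= expR t)%R by have := expR_ge1Dx t; lra.
have N0 : (0 < expR t)%R by exact: expR_gt0.
have := hC 0%R (expR t) 0%R (expR t) k N0 N0 (ltW k0); rewrite !subr0; apply.
move=> u /andP[u0 uN]; rewrite mul0r expR0 mul1e.
(* Each u in [0, N] is an endpoint of a unit interval inside [0, N], since N >= 2; that alone
   contributes k. *)
have [u1|u1] := leP u 1%R.
  have -> : k = (k * (u + 1 - u))%R by lra.
  apply: econv_indic_ge; rewrite ?(ltW k0)//; [lra|lra|].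
  by move=> v /andP[tv vt] _; apply: hk; rewrite ler_norml; lra.
have -> : k = (k * (u - (u - 1)))%R by lra.
apply: econv_indic_ge; rewrite ?(ltW k0)//; [lra|lra|].
by move=> v /andP[tv vt] _; apply: hk; rewrite ler_norml; lra.
Qed.

Lemma hker_ge_pow c : (sigma < 1 / 2)%R -> exists2 k : R, (0 < k)%R &
  forall w : R, w != 0%R -> (`|w| <= 1)%R -> (k * `|w| `^ (2 * sigma - 1))%:E <= H c w.
Proof.
move=> s2; have [k k0 hk] := kprof_ge_pow nu1 sigma0 sigma1 s2.
exists (expR (- `|c|) * k)%R; first by rewrite mulr_gt0 ?expR_gt0.
move=> w w0 w1; rewrite /hker.
apply: (@le_trans _ _ ((expR (c * w))%:E * (k * `|w| `^ (2 * sigma - 1))%:E)); last first.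
  by rewrite lee_wpmul2l ?lee_fin ?expR_ge0//; exact: hk.
rewrite -EFinM lee_fin -mulrA ler_wpM2r ?mulr_ge0 ?powR_ge0 ?(ltW k0)// ler_expR.
by have := mulr_ge_Nnorm c w1; rewrite mulr1.
Qed.

Lemma powR_antitone x y t : (0 < x)%R -> (x <= y)%R -> (t <= 0)%R -> (y `^ t <= x `^ t)%R.
Proof.
move=> x0 xy t0; have y0 := lt_le_trans x0 xy.
have [r rE] : exists r, t = (- r)%R by exists (- t)%R; rewrite opprK.
rewrite {}rE oppr_le0 in t0 *; rewrite !powRN lef_pV2 ?posrE ?powR_gt0//.
by rewrite ge0_ler_powR ?nnegrE// ltW.
Qed.

(** At distances at most e the kernel is at least k e^(2 sigma - 1), so the image of the indicator
    of [0, e] is at least k e^(2 sigma) there. Letting e tend to 0 compares exponents. *)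
Lemma conv_bounded_scaling c (p q : \bar R) : 1 <= p -> 1 <= q ->
  conv_bounded nu sigma c 0 p q -> (sigma < 1 / 2)%R -> (- (2 * sigma) <= rinv q - rinv p)%R.
Proof.
move=> p1 q1 /(conv_bounded_test p1 q1)[C C0 hC] s2.
have [k k0 hk] := hker_ge_pow c s2.
suff : (- (2 * sigma + rinv q) <= - rinv p)%R by lra.
apply: (@exp_growth _ _ (C / k)) => t t1; rewrite !mulrN -!mulNr.
set e := expR (- t).
have e0 : (0 < e)%R by exact: expR_gt0.
have e1 : (e <= 1)%R by rewrite expRN_le1//; lra.
rewrite !expRM -/e -mulrA mulrCA ler_pdivlMl//.
rewrite gt0_powRD// mulrA.
have e20 : (0 <= k * e `^ (2 * sigma))%R by rewrite mulr_ge0 ?powR_ge0 ?ltW.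
have := hC 0%R e 0%R e (k * e `^ (2 * sigma))%R e0 e0 e20.
rewrite !subr0; apply => u /andP[u0 ue]; rewrite mul0r expR0 mul1e.
have -> : (k * e `^ (2 * sigma) = k * e `^ (2 * sigma - 1) * (e - 0))%R.
  by rewrite subr0 -mulrA -[X in (_ * (_ * X))%R](powRr1 (ltW e0)) -gt0_powRD// subrK.
apply: econv_indic_ge; rewrite ?mulr_ge0 ?powR_ge0 ?(ltW k0) ?(ltW e0)//.
move=> v /andP[v0 ve] vu; have uv0 : (u - v != 0)%R by rewrite subr_eq0 eq_sym.
have uve : (`|u - v| <= e)%R by rewrite ler_norml; lra.
apply: le_trans (hk _ uv0 (le_trans uve e1)); rewrite lee_fin ler_wpM2l ?(ltW k0)//.
by apply: powR_antitone => //; [rewrite normr_gt0|lra].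
Qed.

Lemma conv_bounded_half c : sigma = (1 / 2)%R -> ~ conv_bounded nu sigma c 0 1 +oo.
Proof.
move=> s2 /(conv_bounded_test (lexx 1) (leey 1))[C C0 hC].
(* The factor e^|c| compensates e^(c w) for |w| <= 1. On a short interval of length e the image then
   exceeds (C + 1) e, against an L^1 norm of e. *)
have [d d0 hd] := kprof_unbounded nu1 sigma0 sigma1 s2 ((C + 1) * expR `|c|).
pose e := Num.min d 1%R.
have e0 : (0 < e)%R by rewrite lt_min d0 ltr01.
have ed : (e <= d)%R by rewrite ge_min lexx.
have e1 : (e <= 1)%R by rewrite ge_min lexx orbT.
have := hC 0%R e 0%R e ((C + 1) * e)%R e0 e0.
rewrite !subr0 rinvy powRr0 mulr1 rinv_real// invr1 powRr1 ?(ltW e0)//.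
rewrite ler_pM2r// => h; have : (C + 1 <= C)%R; last lra.
apply: h; first by rewrite mulr_ge0 ?(ltW e0)//; lra.
move=> u /andP[u0 ue]; rewrite mul0r expR0 mul1e.
have -> : ((C + 1) * e = (C + 1) * (e - 0))%R by rewrite subr0.
apply: econv_indic_ge => //; [lra|exact: ltW|].
move=> v /andP[v0 ve] vu.
have uve : (`|u - v| <= e)%R by rewrite ler_norml; lra.
rewrite /hker; apply: (@le_trans _ _ ((expR (c * (u - v)))%:E * ((C + 1) * expR `|c|)%:E)); last first.
  by rewrite lee_wpmul2l ?lee_fin ?expR_ge0//; apply: hd; exact: le_trans ed.
rewrite -EFinM lee_fin mulrCA ler_peMr//; first lra.
rewrite -expRD -[leLHS]expR0 ler_expR.
by have := mulr_ge_Nnorm c (le_trans uve e1); lra.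
Qed.

(** When |c| = s the kernel stays above a positive constant on the half-line given by the sign of c,
    so the image of the indicator of [0, 1] is bounded below on arbitrarily long intervals. *)
Lemma conv_bounded_L1_strict c (q : R) : (`|c| = s)%R -> (1 <= q)%R -> ~ conv_bounded nu sigma c 0 1 q%:E.
Proof.
move=> cs q1; have q1' : 1 <= q%:E by rewrite lee_fin.
move=> /(conv_bounded_test (lexx 1) q1')[C C0 hC]; have q0 : (0 < q)%R by lra.
have [k k0 hk] := hker_ge c.
have [n1 n2 n3] := And3 nu1 sigma0 sigma1; have s0 : (0 < s)%R by lra.
have h t : (1 <= t)%R -> (expR (t * q^-1) <= C / k * expR (t * 0))%R.
  move=> t1; rewrite mulr0 expR0 mulr1 ler_pdivlMr// mulrC expRM.
  have et := expR_gt0 t.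
  have T a' b' : (b' - a' = expR t)%R -> (forall u v, (a' <= u <= b')%R -> (0 <= v <= 1)%R ->
      (c * (u - v) - s * `|u - v| = 0)%R) -> (k * expR t `^ q^-1 <= C)%R.
    move=> ab h; have := hC 0%R 1%R a' b' k ltr01 _ (ltW k0).
    rewrite subr0 powR1 mulr1 ab rinv_real//; apply; first by rewrite -subr_gt0 ab.
    move=> u hu; rewrite mul0r expR0 mul1e.
    have -> : k = (k * (1 - 0))%R by rewrite subr0 mulr1.
    apply: econv_indic_ge; rewrite ?(ltW k0)//.
    by move=> v hv _; have := hk (u - v)%R; rewrite h// expR0 mulr1.
  have [c0|c0] := leP 0%R c.
    apply: (T 1%R (1 + expR t)%R); first by lra.
    move=> u v /andP[u1 _] /andP[v0 v1]; rewrite -cs !ger0_norm//; lra.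
  apply: (T (- expR t)%R 0%R); first by lra.
  move=> u v /andP[_ u1] /andP[v0 v1]; rewrite -cs ltr0_norm// ler0_norm; lra.
by have := exp_growth h; rewrite leNgt invr_gt0 q0.
Qed.

(** The indicator of [0, e] has L^1 norm e, and its image is at least k e u^(2 sigma - 1) on [e, 1].
    The q-th power of this is (k e)^q / u, so the bound would give (k e)^q ln(1/e) <= (C e)^q; t =
    ln(1/e) is chosen to violate it. *)
Lemma conv_bounded_L1_critical c (q : R) : (1 <= q)%R -> (q^-1 = 1 - 2 * sigma)%R ->
  ~ conv_bounded nu sigma c 0 1 q%:E.
Proof.
move=> q1 qs [C C0 hC]; have q0 : (0 < q)%R by lra.
have iq0 : (0 < q^-1)%R by rewrite invr_gt0.
have s2 : (sigma < 1 / 2)%R by lra.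
have q1' : 1 <= q%:E by rewrite lee_fin.
have [k k0 hk] := hker_ge_pow c s2.
pose t := (C `^ q / k `^ q + 1)%R; pose e := expR (- t).
have kq0 : (0 < k `^ q)%R by rewrite powR_gt0.
have t0 : (0 < t)%R by rewrite ltr_wpDl// divr_ge0 ?powR_ge0.
have e0 : (0 < e)%R by exact: expR_gt0.
have e1 : (e <= 1)%R by rewrite expRN_le1// ltW.
have ke : (0 <= k * e)%R by rewrite mulr_ge0// ltW.
have mI : measurable_fun [set: R] (\1_`[0%R, e] : R -> R) by exact: measurable_indic.
have NI : 'N[mu]_1[EFin \o \1_`[0%R, e]] <= e%:E.
  have := Lnorm_indic_le (lexx 1) e0; rewrite subr0 rinv_real// invr1 powRr1//; exact: ltW.
pose g u := (k * e * (u `^ (2 * sigma - 1) * \1_`[e, 1%R] u))%R.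
have mg : measurable_fun [set: R] g.
  apply: measurable_funM => //; apply: measurable_funM; last exact: measurable_indic.
  exact: measurable_powR.
have g0 u : (0 <= g u)%R by rewrite mulr_ge0// mulr_ge0 ?powR_ge0.
have le1 : 'N[mu]_q%:E[EFin \o g] <= (C * e)%:E.
  apply: (@le_trans _ _ (C%:E * 'N[mu]_1[EFin \o \1_`[0%R, e]])); last first.
    by rewrite EFinM lee_wpmul2l ?lee_fin.
  apply: le_trans (hC _ mI _ (le_lt_trans NI (ltry _))) => //.
  apply: le_Lnorm => //; first exact/measurable_EFinP.
    under eq_fun do rewrite mul0r expR0 mul1e; exact: measurable_econv.
  apply: aeW => u /=; rewrite mul0r expR0 mul1e gee0_abs ?econv_ge0// ger0_norm//.
  rewrite /g indic_itvE; have [/andP[eu u1]|_] := boolP (e <= u <= 1)%R; last first.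
    by rewrite !mulr0 econv_ge0.
  have -> : (k * e * (u `^ (2 * sigma - 1) * 1) = k * u `^ (2 * sigma - 1) * (e - 0))%R by ring.
  apply: econv_indic_ge; rewrite ?mulr_ge0 ?powR_ge0 ?(ltW k0) ?(ltW e0)//.
  move=> v /andP[v0 ve] vu; have uv0 : (u - v != 0)%R by rewrite subr_eq0 eq_sym.
  have uvu : (`|u - v| <= u)%R by rewrite ler_norml; lra.
  apply: le_trans (hk _ uv0 (le_trans uvu u1)); rewrite lee_fin ler_wpM2l ?(ltW k0)//.
  by apply: powR_antitone => //; [rewrite normr_gt0|lra].
have Ig : \int[mu]_u (g u `^ q)%:E = ((k * e) `^ q * t)%:E.
  have -> : t = (ln 1 - ln e)%R by rewrite ln1 expRK sub0r opprK.
  rewrite EFinM -integral_inv_itv// -integral_scale ?powR_ge0//; last 2 first.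
  - exact: measurable_inv_itv.
  - by move=> x; exact: inv_itv_ge0.
  apply: eq_integral => u _; rewrite -EFinM /g; congr (_%:E).
  rewrite indic_itvE; have [/andP[eu _]|_] := boolP (e <= u <= 1)%R; last first.
    by rewrite !mulr0 powR0// gt_eqF.
  rewrite !mulr1 powRM ?powR_ge0// -powRrM -(opprB 1%R) -qs mulNr mulVf ?gt_eqF//.
  by rewrite powR_inv1// (le_trans (ltW e0)).
move: le1; rewrite Lnorm_nnegr// Ig poweR_EFin lee_fin => le1.
have Ce : (0 <= C * e)%R by rewrite mulr_ge0// ltW.
have le2 : ((k * e) `^ q * t <= (C * e) `^ q)%R.
  rewrite -[leLHS]powRr1; last by rewrite mulr_ge0 ?powR_ge0// ltW.
  rewrite -(mulVf (lt0r_neq0 q0)) powRrM; apply: ge0_ler_powR; rewrite ?nnegrE ?powR_ge0 ?(ltW q0)//.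
move: le2; rewrite !powRM ?(ltW k0) ?(ltW e0)// mulrAC ler_pM2r ?powR_gt0//.
rewrite /t mulrDr mulr1 mulrCA mulfV ?gt_eqF// mulr1.
by lra.
Qed.

(** For F = v^(-2 sigma) on [e, 1/2] the integral of F^p is t = ln(1/(2 e)). At u in [-e, 0] one has
    |u - v| <= 2 v, so the kernel times F is at least [k1] / v and the image is at least [k1] t.
    Then [k1] t <= C t^(1/p) fails for large t. *)
Lemma conv_bounded_Linfty_critical c (p : R) : (1 < p)%R -> (p^-1 = 2 * sigma)%R ->
  ~ conv_bounded nu sigma c 0 p%:E +oo.
Proof.
move=> p1 ps [C C0 hC]; have p0 : (0 < p)%R by lra.
have ip0 : (0 < p^-1)%R by rewrite invr_gt0.
have ip1 : (p^-1 < 1)%R by rewrite invf_lt1.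
have s2 : (sigma < 1 / 2)%R by lra.
have [k k0 hk] := hker_ge_pow c s2.
pose k1 := (k * 2 `^ (2 * sigma - 1))%R.
have k10 : (0 < k1)%R by rewrite mulr_gt0 ?powR_gt0.
suff h tau : (1 <= tau)%R -> (expR (tau * 1) <= C / k1 * expR (tau * p^-1))%R.
  by have := exp_growth h; lra.
move=> tau1; rewrite mulr1 expRM -mulrA mulrCA ler_pdivlMl//.
set t := expR tau; have t0 : (0 < t)%R by exact: expR_gt0.
pose e := (expR (- t) / 2)%R.
have e0 : (0 < e)%R by rewrite divr_gt0 ?expR_gt0.
have e1 : (e <= 1 / 2)%R.
  by rewrite ler_pM2r ?invr_gt0// expRN_le1// ltW.
have tE : t = (ln (1 / 2) - ln e)%R.
  by rewrite div1r /e lnM ?posrE ?expR_gt0 ?invr_gt0// expRK; ring.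
pose F v := (v `^ (- (2 * sigma)) * \1_`[e, (1 / 2)%R] v)%R.
have mF : measurable_fun [set: R] F.
  by apply: measurable_funM; [exact: measurable_powR|exact: measurable_indic].
have F0 v : (0 <= F v)%R by rewrite mulr_ge0 ?powR_ge0.
have NF : 'N[mu]_p%:E[EFin \o F] = (t `^ p^-1)%:E.
  rewrite Lnorm_nnegr// -poweR_EFin; congr (_ `^ _).
  rewrite [in RHS]tE -integral_inv_itv//; apply: eq_integral => v _; congr (_%:E).
  rewrite /F indic_itvE; have [/andP[ev _]|_] := boolP (e <= v <= 1 / 2)%R; last first.
    by rewrite !mulr0 powR0// gt_eqF.
  by rewrite !mulr1 -powRrM -ps mulNr mulVf ?gt_eqF// powR_inv1// (le_trans (ltW e0)).
have ee : (- e < 0)%R by lra.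
have le1 : (k1 * t)%:E <= C%:E * 'N[mu]_p%:E[EFin \o F].
  apply: le_trans (hC _ mF F0 _); last by rewrite NF ltry.
  have -> : (k1 * t = k1 * t * (0 - - e) `^ @rinv R +oo)%R by rewrite rinvy powRr0 mulr1.
  apply: Lnorm_ge; rewrite ?leey//.
  - by rewrite mulr_ge0 ?ltW.
  - under eq_fun do rewrite mul0r expR0 mul1e; exact: measurable_econv.
  - by move=> u; rewrite mul0r expR0 mul1e econv_ge0.
  move=> u /andP[u1 u0]; rewrite mul0r expR0 mul1e [in leLHS]tE EFinM.
  rewrite -integral_inv_itv// -integral_scale ?(ltW k10)//; last 2 first.
  - exact: measurable_inv_itv.
  - by move=> x; exact: inv_itv_ge0.
  have gE v : (e <= v <= 1 / 2)%R -> (k1 * v^-1 = k * (2 * v) `^ (2 * sigma - 1) * v `^ (- (2 * sigma)))%R.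
    move=> /andP[ev _]; have v0 : (0 < v)%R by lra.
    rewrite powRM ?(ltW v0)// -[RHS]mulrA -mulrA -gt0_powRD// mulrA; congr (_ * _)%R.
    rewrite -powR_inv1 ?(ltW v0)//; congr (_ `^ _)%R; ring.
  under eq_integral do rewrite -EFinM.
  apply: econv_ge => //.
  - by apply: measurable_funM => //; exact: measurable_inv_itv.
  - by move=> x; rewrite mulr_ge0 ?(ltW k10)// inv_itv_ge0.
  move=> v vu; rewrite /F indic_itvE; have [ev|_] := boolP (e <= v <= 1 / 2)%R; last first.
    by rewrite !mulr0 mule0.
  rewrite !mulr1 gE// EFinM lee_wpmul2r ?lee_fin ?powR_ge0//; have /andP[ev1 ev2] := ev.
  have uv0 : (u - v != 0)%R by rewrite subr_eq0 eq_sym.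
  have uv : (`|u - v| <= 2 * v)%R by rewrite ler_norml; lra.
  apply: le_trans (hk _ uv0 _); last lra.
  rewrite lee_fin ler_wpM2l ?(ltW k0)//.
  by apply: powR_antitone => //; [rewrite normr_gt0|lra].
by move: le1; rewrite NF -EFinM lee_fin.
Qed.

(** * Necessity: divergence of the convolution *)

Lemma finite_ae_contra c (p : \bar R) F a b : measurable_fun [set: R] F ->
  (forall v, (0 <= F v)%R) -> 'N[mu]_p[EFin \o F] < +oo -> (a < b)%R ->
  (forall u, (a <= u <= b)%R -> econv (H c) F u = +oo) -> ~ finite_ae nu sigma c p.
Proof.
move=> mF F0 nF ab h /(_ F mF F0 nF)[N [mN N0 hN]].
have : mu `[a, b] <= mu N.
  apply: le_measure; rewrite ?inE//; move=> x /=; rewrite in_itv/= => hx; apply: hN => /=.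
  by rewrite h// ltxx.
by rewrite N0 lebesgue_measure_itv/= lte_fin ab -EFinD lee_fin subr_le0 leNgt ab.
Qed.

(* [tau] is the sign of [c], which lets both ends of the line be treated at once. *)
Lemma finite_ae_diverge c (p : \bar R) (tau : R) (phi : R -> R) : (tau = 1 \/ tau = -1)%R ->
  measurable_fun [set: R] phi -> (forall w, (0 <= phi w <= 1)%R) ->
  (forall w, (w < 0)%R -> phi w = 0%R) ->
  (p = +oo \/ exists2 r, p = r%:E & \int[mu]_w (phi w `^ r)%:E < +oo) ->
  (s <= tau * c)%R ->
  \int[mu]_w (expR ((tau * c - s) * w) * phi w)%:E = +oo ->
  ~ finite_ae nu sigma c p.
Proof.
move=> htau mphi phi01 phi_neg hp sc hoo.
have [k k0 hk] := hker_ge c.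
have phi0 w : (0 <= phi w)%R by have /andP[] := phi01 w.
have tau2 : (tau * tau = 1)%R by case: htau => ->; ring.
have tauR (g : R -> \bar R) : measurable_fun [set: R] g -> (forall x, 0 <= g x) ->
    \int[mu]_v g (- (tau * v))%R = \int[mu]_v g v.
  move=> mg g0; case: htau => ->.
    by under eq_integral do rewrite mul1r; exact: ge0_integral_reflect.
  by under eq_integral do rewrite mulN1r opprK.
pose F v := phi (- (tau * v))%R.
have mF : measurable_fun [set: R] F.
  by apply: (measurableT_comp mphi); apply: measurable_funN; exact: measurable_funM.
have F0 v : (0 <= F v)%R by exact: phi0.
have NF : 'N[mu]_p[EFin \o F] < +oo.
  case: hp => [->|[r -> hr]].
    apply: (@le_lt_trans _ _ 1); last exact: ltry.
    apply: Lnorm_y_le => //; apply: aeW => v /=; rewrite lee_fin ger0_norm//.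
    by have /andP[] := phi01 (- (tau * v))%R.
  have mr : measurable_fun [set: R] (fun w => (phi w `^ r)%:E).
    by apply/measurable_EFinP; apply: (measurableT_comp (measurable_powR _)).
  have r0 w : 0 <= (phi w `^ r)%:E by rewrite lee_fin powR_ge0.
  by rewrite Lnorm_nnegr//; apply: poweR_lty; rewrite /F (tauR _ mr r0).
pose psi w := (expR ((tau * c - s) * w) * phi w)%R.
have mpsi : measurable_fun [set: R] psi.
  by apply: measurable_funM => //; apply: measurableT_comp => //; exact: measurable_funM.
have psi0 w : (0 <= psi w)%R by rewrite mulr_ge0 ?expR_ge0.
(* For w = -tau v >= 0 one has |u - v| = tau u + w, so the exponent of the kernel, (tau c - s) (tau
   u + w), is at least (tau c - s) w. *)
have main u : (0 <= tau * u)%R -> econv (H c) F u = +oo.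
  move=> u0; apply/eqP; rewrite -leye_eq.
  have <- : \int[mu]_v (k * psi (- (tau * v)))%:E = +oo.
    under eq_integral do rewrite EFinM.
    rewrite (tauR (fun w => k%:E * (psi w)%:E)); last 2 first.
    - by apply: measurable_funeM; exact/measurable_EFinP.
    - by move=> x; rewrite mule_ge0 ?lee_fin// ltW.
    by rewrite integral_scale ?(ltW k0)// hoo gt0_muley.
  apply: econv_ge => //.
  - apply: measurable_funM => //; apply: (measurableT_comp mpsi).
    by apply: measurable_funN; exact: measurable_funM.
  - by move=> v; rewrite mulr_ge0// ltW.
  move=> v _; rewrite /psi /F; set w := (- (tau * v))%R.
  have [w0|w0] := ltP w 0%R; first by rewrite phi_neg// !mulr0 mule0.
  rewrite mulrA EFinM lee_wpmul2r ?lee_fin//; apply: le_trans (hk _).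
  rewrite lee_fin ler_wpM2l ?(ltW k0)// ler_expR.
  have uvE : (tau * (u - v) = tau * u + w)%R by rewrite /w; ring.
  have cE : (c * (u - v) = (tau * c) * (tau * u + w))%R.
    by rewrite -uvE -[LHS]mul1r -tau2; ring.
  have nE : (`|u - v| = tau * u + w)%R.
    rewrite -uvE -[RHS]ger0_norm ?uvE ?addr_ge0// -uvE normrM.
    by case: htau => ->; rewrite ?normrN normr1 mul1r.
  rewrite cE nE -mulrBl mulrDr lerDr mulr_ge0//; lra.
case: htau => tE; subst tau.
  apply: (finite_ae_contra (a := 0%R) (b := 1%R) mF F0 NF ltr01) => u /andP[u0 _].
  by apply: main; rewrite mul1r.
have N10 : (- 1 < 0 :> R)%R by rewrite ltrN10.
apply: (finite_ae_contra (a := (- 1)%R) (b := 0%R) mF F0 NF N10) => u /andP[_ u0].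
by apply: main; rewrite mulN1r oppr_ge0.
Qed.

Lemma inv_ray_powR (w : R) : (w^-1 * (1 <= w)%R%:R = w `^ (-1) * (1 <= w)%R%:R)%R.
Proof. by have [w1|_] := leP 1%R w; rewrite ?mulr0// powR_inv1//; lra. Qed.

Lemma measurable_inv_ray : measurable_fun [set: R] (fun w : R => w^-1 * (1 <= w)%R%:R)%R.
Proof.
under eq_fun do rewrite inv_ray_powR.
apply: measurable_funM; first exact: measurable_powR.
by apply: measurable_natr_bool; apply: measurable_fun_ler.
Qed.

Lemma integral_inv_ray : \int[mu]_w (w^-1 * (1 <= w)%R%:R)%:E = +oo :> \bar R.
Proof.
apply: eq_infty => M; pose t := Num.max 0%R M.
have t0 : (0 <= t)%R by rewrite le_max lexx.
have e1 : (1 <= expR t)%R by have := expR_ge1Dx t; lra.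
apply: (@le_trans _ _ t%:E); first by rewrite lee_fin le_max lexx orbT.
have -> : t = (ln (expR t) - ln 1)%R by rewrite expRK ln1 subr0.
rewrite -integral_inv_itv//; apply: ge0_le_integral => //.
- by move=> w _; rewrite lee_fin inv_itv_ge0.
- by apply/measurable_EFinP; exact: measurable_inv_itv.
- by apply/measurable_EFinP; exact: measurable_inv_ray.
move=> w _; rewrite indic_itvE lee_fin; have [w1|w1] := leP 1%R w; last by rewrite mulr0 lexx.
by rewrite ler_wpM2l ?invr_ge0 ?(le_trans ler01 w1)//; case: (w <= expR t)%R; rewrite /= ?lexx ?ler01.
Qed.

Lemma sign_norm c : exists2 tau : R, (tau = 1 \/ tau = -1)%R & (tau * c = `|c|)%R.
Proof.
have [c0|c0] := leP 0%R c; [exists 1%R|exists (-1)%R].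
- by left.
- by rewrite mul1r ger0_norm.
- by right.
- by rewrite mulN1r ltr0_norm.
Qed.

(** The function 1/w on [1, +oo) lies in every L^p with p > 1 but is not integrable; if |c| >= s,
    the kernel provides no decay on one side to compensate. *)
Lemma finite_ae_strict_nec c (p : \bar R) : 1 < p -> finite_ae nu sigma c p -> (`|c| < s)%R.
Proof.
move=> p1 h; rewrite ltNge; apply/negP => sc; move: h.
have [tau tau1 tauc] := sign_norm c.
pose phi w := (w^-1 * (1 <= w)%R%:R : R)%R.
have mphi : measurable_fun [set: R] phi by exact: measurable_inv_ray.
have phi01 w : (0 <= phi w <= 1)%R.
  rewrite /phi; have [w1|_] := leP 1%R w; rewrite ?mulr0 ?lexx ?ler01// mulr1.
  by rewrite invr_ge0 invf_le1 ?w1; lra.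
apply: (finite_ae_diverge (phi := phi) tau1) => //; rewrite ?tauc//.
- by move=> w w0; rewrite /phi leNgt (lt_trans w0 ltr01) mulr0.
- case: p p1 => [r|_|//]; last by left.
  rewrite lte_fin => r1; right; exists r => //.
  apply: (@le_lt_trans _ _ (\int[mu]_w (`|w| `^ (- r) * (1 <= `|w|)%R%:R)%:E)).
    apply: ge0_le_integral => //.
    - by move=> w _; rewrite lee_fin powR_ge0.
    - by apply/measurable_EFinP; apply: (measurableT_comp (measurable_powR _)).
    - apply/measurable_EFinP; apply: measurable_funM.
        by apply: (measurableT_comp (measurable_powR _)).
      by apply: measurable_natr_bool; apply: measurable_fun_ler.
    move=> w _; rewrite lee_fin /phi inv_ray_powR; have [w1|_] := leP 1%R w; last first.
      by rewrite mulr0 powR0 ?mulr_ge0 ?powR_ge0//; rewrite gt_eqF//; lra.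
    rewrite mulr1 -powRrM mulN1r ger0_norm; last lra.
    by rewrite w1 mulr1.
  by rewrite integral_powR_coball// ltry.
apply/eqP; rewrite -leye_eq -integral_inv_ray; apply: ge0_le_integral => //.
- by move=> w _; rewrite lee_fin; have /andP[] := phi01 w.
- exact/measurable_EFinP.
- apply/measurable_EFinP; apply: measurable_funM => //; apply: measurableT_comp => //; exact: measurable_funM.
move=> w _; rewrite lee_fin -/(phi w); have /andP[p0 _] := phi01 w.
have [w1|w1] := leP 1%R w; last first.
  have -> : phi w = 0%R by rewrite /phi leNgt w1 mulr0.
  by rewrite mulr0.
rewrite ler_peMl//; apply: le_trans (expR_ge1Dx _).
by rewrite lerDl mulr_ge0 ?subr_ge0//; exact: le_trans ler01 w1.
Qed.

(** If |c| exceeds s by g, the integrable function e^(-g w) on the half-line exactly cancels the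
    growth of the kernel and leaves the constant 1. *)
Lemma finite_ae_L1_nec c : finite_ae nu sigma c 1 -> (`|c| <= s)%R.
Proof.
move=> h; rewrite leNgt; apply/negP => sc; move: h.
have [tau tau1 tauc] := sign_norm c.
pose g := (`|c| - s)%R; have g0 : (0 < g)%R by rewrite subr_gt0.
pose phi w := (expR (- (g * w)) * (0 <= w)%R%:R : R)%R.
have mind : measurable_fun [set: R] (fun w : R => (0 <= w)%R%:R : R).
  by apply: measurable_natr_bool; apply: measurable_fun_ler.
have mphi : measurable_fun [set: R] phi.
  by apply: measurable_funM => //; apply: measurableT_comp => //; apply: measurable_funN; exact: measurable_funM.
have phi01 w : (0 <= phi w <= 1)%R.
  rewrite /phi; have [w0|_] := leP 0%R w; rewrite ?mulr0 ?lexx ?ler01// mulr1.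
  by rewrite expR_ge0 expRN_le1// mulr_ge0// ltW.
apply: (finite_ae_diverge (phi := phi) tau1) => //; rewrite ?tauc; try exact: ltW.
- by move=> w w0; rewrite /phi leNgt w0 mulr0.
- right; exists 1%R => //.
  apply: (@le_lt_trans _ _ (\int[mu]_w (expR (- (g * `|w|)))%:E)); last first.
    by rewrite integral_expRN_abs// ltry.
  apply: ge0_le_integral => //.
  - by move=> w _; rewrite lee_fin powR_ge0.
  - by apply/measurable_EFinP; apply: (measurableT_comp (measurable_powR _)).
  - by apply/measurable_EFinP; exact: measurable_expRN_abs.
  move=> w _; rewrite lee_fin powRr1; last by have /andP[] := phi01 w.
  by rewrite /phi; have [w0|_] := leP 0%R w; rewrite ?mulr1 ?mulr0 ?expR_ge0// ger0_norm.
rewrite -/g.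
have -> : \int[mu]_w (expR (g * w) * phi w)%:E = \int[mu]_w (\1_`[0%R, +oo[ w)%:E.
  apply: eq_integral => w _; congr (_%:E); rewrite /phi mulrA -expRD addrN expR0 mul1r indicE.
  by congr (nat_of_bool _)%:R; apply/idP/idP; rewrite inE/= in_itv/= andbT.
by rewrite integral_indic ?setIT//= lebesgue_measure_itv/= ltry.
Qed.

End conv_bounds.

(** * The exact ranges of the parameters *)

Section characterization.
Context {R : realType}.
Local Open Scope ereal_scope.
Implicit Types (c d : R) (p q : \bar R).

Lemma rinv_conjugate p : 1 <= p -> rinv (hoelder_conjugate p) = (1 - rinv p)%R.
Proof.
case: p => [r r1|_|//]; last by rewrite hoelder_conjugatey rinvy rinv_real// invr1 subr0.
have r0 := gt0_of_ge1e r1.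
have [->|rn1] := eqVneq r 1%R; first by rewrite hoelder_conjugate1 rinvy rinv_real// invr1 subrr.
have : (r%:E)^-1 + (hoelder_conjugate r%:E)^-1 = 1.
  by apply: hoelder_conjugate_eq1; rewrite ?ltNyr// eqe gt_eqF.
rewrite /rinv inver gt_eqF//.
case: (_^-1) => [x|//|//] /=; rewrite -EFinD => -[<-].
by rewrite addrAC subrr add0r.
Qed.

Lemma hoelder_conjugate_1 q : 1 <= q -> (hoelder_conjugate q == 1) = (q == +oo).
Proof.
move=> q1; apply/eqP/eqP => [h|->]; last exact: hoelder_conjugatey.
by rewrite -(hoelder_conjugateK q) h hoelder_conjugate1.
Qed.

Lemma rinv_ge0 p : 1 <= p -> (0 <= rinv p)%R.
Proof.
case: p => [r r1|_|//]; last by rewrite rinvy.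
have r0 := gt0_of_ge1e r1.
by rewrite rinv_real// invr_ge0 ltW.
Qed.

Lemma rinv_le1 p : 1 <= p -> (rinv p <= 1)%R.
Proof.
case: p => [r r1|_|//]; last by rewrite rinvy.
have r0 := gt0_of_ge1e r1.
by rewrite rinv_real// invf_le1// -lee_fin.
Qed.

Lemma le_of_rinv p q : 1 <= p -> 1 <= q -> (rinv q <= rinv p)%R -> p <= q.
Proof.
case: q => [t|_ _ _|//]; last exact: leey.
case: p => [r|_|//] => [r1 t1|t1].
  have r0 := gt0_of_ge1e r1.
  have t0 := gt0_of_ge1e t1.
  by rewrite !rinv_real// lef_pV2 ?posrE// lee_fin.
have t0 := gt0_of_ge1e t1.
by rewrite rinvy rinv_real// leNgt invr_gt0 t0.
Qed.

Variables (nu sigma : R).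
Hypotheses (nu1 : (nu < 1)%R) (sigma0 : (0 < sigma)%R) (sigma1 : (sigma < - nu + 1)%R).
Local Notation s := (1 - nu - sigma)%R.

Lemma finite_ae_iff c p : 1 <= p ->
  finite_ae nu sigma c p <-> (`|c| < s ?<= if (p == 1%E))%R.
Proof.
move=> p1; have [->|pn1] := eqVneq p 1.
  by split; [exact: finite_ae_L1_nec|exact: finite_ae_L1].
split; last by move=> cs; exact: finite_ae_strict.
by apply: finite_ae_strict_nec => //; rewrite lt_neqAle eq_sym pn1.
Qed.

Lemma conv_bounded_iff c d p q : 1 <= p -> 1 <= q ->
  finite_ae nu sigma c p /\ conv_bounded nu sigma c d p q <->
  [/\ p <= q, d = 0%R, (`|c| < s ?<= if ((p == 1%E) && (q == +oo%E)))%R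
    & (- (2 * sigma) < rinv q - rinv p ?<= if (~~ ((p == 1%E) || (q == +oo%E))))%R].
Proof.
move=> p1 q1; have [n1 n2 n3] := And3 nu1 sigma0 sigma1; split; last first.
  move=> [pq -> cs he].
  have cs1 : (`|c| < s ?<= if (p == 1%E))%R.
    by move: cs; case: (p == 1) => //; case: (q == +oo) => //= /ltW.
  split; first exact/finite_ae_iff.
  move: cs; case: (boolP ((p == 1) && (q == +oo))) => [/andP[/eqP pE /eqP qE]|_] cs; last first.
    exact: conv_bounded_suff.
  subst p q; apply: conv_bounded_L1_Linfty => //.
  by move: he; rewrite eqxx/= rinvy rinv_real// invr1; lra.
move=> [fin bd]; have d0 := conv_bounded_homogeneous nu1 sigma0 sigma1 p1 q1 bd; subst d.
have cs := (finite_ae_iff c p1).1 fin.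
split=> //.
- by apply: le_of_rinv => //; exact: (conv_bounded_le nu1 sigma0 sigma1 p1 q1 bd).
(* Finiteness alone gives |c| <= s when p = 1; strictness for finite q comes from boundedness. *)
- move: cs; have [pE|_] := eqVneq p 1 => //= cs; have [qE|qn] := eqVneq q +oo => //=.
  subst p; case: q q1 qn bd => [t t1 _ bd|//|//].
  rewrite lt_neqAle cs andbT; apply/eqP => cE.
  by apply: (conv_bounded_L1_strict nu1 sigma0 sigma1 cE _ bd); rewrite -lee_fin.
have hle : (- (2 * sigma) <= rinv q - rinv p)%R.
  have [s2|s2] := ltP sigma (1 / 2)%R; first exact: (conv_bounded_scaling nu1 sigma0 sigma1 p1 q1 bd).
  (* For sigma >= 1/2 the inequality is automatic, since 1/q - 1/p >= -1. *)
  by have := rinv_ge0 q1; have := rinv_le1 p1; lra.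
case: (boolP ((p == 1) || (q == +oo))) => //= hpq.
rewrite lt_neqAle hle andbT; apply/eqP => hE.
case: q q1 bd hpq hE {hle} => [t t1 bd|_ bd _|//].
  rewrite orbF => /eqP pE; subst p.
  have t0 := gt0_of_ge1e t1.
  rewrite !rinv_real// invr1 => hE.
  by apply: (conv_bounded_L1_critical nu1 sigma0 sigma1 _ _ bd); [rewrite -lee_fin|lra].
rewrite rinvy sub0r; case: p p1 bd {fin cs} => [r r1 bd|_ _|//]; last by rewrite rinvy; lra.
have r0 := gt0_of_ge1e r1.
rewrite rinv_real//; have [rE|rn] := eqVneq r 1%R => hE.
  subst r; apply: (conv_bounded_half nu1 sigma0 sigma1 _ bd).
  by move: hE; rewrite invr1; lra.
apply: (conv_bounded_Linfty_critical nu1 sigma0 sigma1 _ _ bd); last by lra.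
by rewrite lt_neqAle eq_sym rn -lee_fin.
Qed.

End characterization.

Lemma lteif_norm (R : realType) (c s : R) (b : bool) :
  (`|c| < s ?<= if b) = (- s < c ?<= if b) && (c < s ?<= if b).
Proof. by case: b => /=; rewrite ?ler_norml ?ltr_norml. Qed.

Theorem theorem6p2 (R : realType) (nu sigma A B : R) (p q : \bar R)
    (nu_lt1 : nu < 1) (sigma_gt0 : 0 < sigma) (sigma_lt : sigma < - nu + 1)
    (p_ge1 : (1 <= p)%E) (q_ge1 : (1 <= q)%E) :
  (wLp nu A p `<=` exotic_domain nu sigma <->
    (2 * sigma - (2 * nu + 2) * rinv p + 2 * nu < A ?<= if (p == 1%E)) /\
    (A < (2 * nu + 2) * rinv (hoelder_conjugate p) - 2 * nu
       ?<= if (p == 1%E)))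
  /\
  (exotic_bounded nu sigma A p B q <->
    [/\ (p <= q)%E,
        A + B - 2 * sigma = (2 * nu + 2) * (rinv q - rinv p),
        (A < (2 * nu + 2) * rinv (hoelder_conjugate p) - 2 * nu
           ?<= if ((p == 1%E) && (hoelder_conjugate q == 1%E))),
        (B < (2 * nu + 2) * rinv q - 2 * nu
           ?<= if ((p == 1%E) && (hoelder_conjugate q == 1%E)))
      & (- (2 * sigma) < rinv q - rinv p
           ?<= if (~~ ((p == 1%E) || (q == +oo%E))))]).
Proof.
rewrite (rinv_conjugate p_ge1) (hoelder_conjugate_1 q_ge1).
rewrite (domain_reduction nu_lt1 sigma_gt0 sigma_lt A p_ge1).
rewrite (bounded_reduction nu_lt1 sigma_gt0 sigma_lt A B p_ge1 q_ge1).
rewrite (conv_bounded_iff nu_lt1 sigma_gt0 sigma_lt _ _ p_ge1 q_ge1).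
rewrite (finite_ae_iff nu_lt1 sigma_gt0 sigma_lt _ p_ge1).
(* The inequality c < s is the upper bound on A, and -s < c the lower bound in (i); once (b) holds,
   the latter is the bound (d) on B. *)
set P := rinv p; set Q := rinv q; rewrite !lteif_norm; split.
  split=> [/andP[]|[]]; first by case: (p == 1%E) => /=; split; lra.
  by case: (p == 1%E) => /= h1 h2; apply/andP; split; lra.
split=> -[pq].
  move=> dE /andP[h1 h2] he; split => //; first by lra.
    by move: h2; case: (_ && _) => /=; lra.
  by move: h1; case: (_ && _) => /=; lra.
move=> dE h1 h2 he; split => //; first by lra.
by apply/andP; split; move: h1 h2; case: (_ && _) => /= h1 h2; lra.
Qed.
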